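(* Consider the supervised learning algorithm $$\theta_{n+1}=\theta_n+\alpha_n(y_n-G_{\theta_n}(x_n))H_{\theta_n}(x_n),\qquad n\ge0,$$ described in the context. Suppose that: (i) $\lim_{n\to\infty}\alpha_n=0$, $\limsup_{n\to\infty}|\alpha_{n+1}^{-1}-\alpha_n^{-1}|<\infty$, $\sum_{n=0}^\infty\alpha_n=\infty$, and there exists a real number $r\in(0,\infty)$ such that $\sum_{n=0}^\infty\alpha_n^2\gamma_n^{2r}<\infty$; (ii) $\phi_1,\phi_2$ are real-analytic and have complex-valued continuations $\hat\phi_1,\hat\phi_2:\mathbb{C}\to\mathbb{C}$ such that $\hat\phi_1(x)=\phi_1(x)$, $\hat\phi_2(x)=\phi_2(x)$ for all $x\in\mathbb{R}$, and there exist real numbers $\varepsilon\in(0,1)$, $K\in[1,\infty)$ such that $\hat\phi_1,\hat\phi_2$ are analytic on $\hat V_\varepsilon=\{z\in\mathbb{C}:d(z,\mathbb{R})\le\varepsilon\}$ and $|\hat\phi_1(z)|\le K(1+|z|)$, $\max\{|\hat\phi_1'(z)|,|\hat\phi_2(z)|,|\hat\phi_2'(z)|\}\le K$ for all $z\in\hat V_\varepsilon$ (where $\hat\phi_1',\hat\phi_2'$ are the derivatives of $\hat\phi_1,\hat\phi_2$); (iii) $\{(x_n,y_n)\}_{n\ge0}$ are i.i.d. random variables distributed according to $\pi$, and there exists $L\in[1,\infty)$ such that $\max_{1\le k\le N_2}|\psi_k(x_0)|\le L$ and $|y_0|\le L$ w.p.1. Let $p=\min\{1,r\}$ and $\Lambda=\{\sup_{n\ge0}\|\theta_n\|<\infty\}$.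 Then $$\|\nabla f(\theta_n)\|^2=o(\gamma_n^{-p}),\qquad d(f(\theta_n),C)=o(\gamma_n^{-p})$$ w.p.1 on $\Lambda$. Moreover, $$\|\nabla f(\theta_n)\|^2=o(\gamma_n^{-\hat p}),\quad d(f(\theta_n),C)=o(\gamma_n^{-\hat p}),\quad d(\theta_n,S)=o(\gamma_n^{-\hat q})$$ w.p.1 on $\Lambda\cap\{\hat r>r\}$, and $$\|\nabla f(\theta_n)\|^2=O(\gamma_n^{-\hat p}),\quad d(f(\theta_n),C)=O(\gamma_n^{-\hat p}),\quad d(\theta_n,S)=O(\gamma_n^{-\hat q})$$ w.p.1 on $\Lambda\cap\{\hat r\le r\}$.
   Context: $N_1,N_2$ are positive integers, $d_\theta=N_1(N_2+1)$. $\phi_1,\phi_2:\mathbb{R}\to\mathbb{R}$ are differentiable functions and $\psi_1,\dots,\psi_{N_2}:\mathbb{R}^{d_x}\to\mathbb{R}$ are Borel-measurable. For $\theta=[a'_1\cdots a'_{N_1}\;a''_{1,1}\cdots a''_{N_1,N_2}]^T\in\mathbb{R}^{d_\theta}$ and $x\in\mathbb{R}^{d_x}$, $$G_\theta(x)=\phi_1\left(\sum_{i_1=1}^{N_1}a'_{i_1}\phi_2\left(\sum_{i_2=1}^{N_2}a''_{i_1,i_2}\psi_{i_2}(x)\right)\right),\qquad H_\theta(x)=\nabla_\theta G_\theta(x).$$ $\pi$ is a probability measure on $\mathbb{R}^{d_x}\times\mathbb{R}$ and $f(\theta)=\frac12\int(y-G_\theta(x))^2\,\pi(dx,dy)$ for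 $\theta\in\mathbb{R}^{d_\theta}$. $\{\alpha_n\}_{n\ge0}$ is a sequence of positive reals. $\theta_0$ is an $\mathbb{R}^{d_\theta}$-valued random variable defined on a probability space $(\Omega,\mathcal{F},P)$, and $\{(x_n,y_n)\}_{n\ge0}$ is an $\mathbb{R}^{d_x}\times\mathbb{R}$-valued stochastic process defined on the same probability space. $\|\cdot\|$ is the Euclidean norm and $d(\cdot,\cdot)$ the induced distance. $\gamma_0=0$, $\gamma_n=\sum_{i=0}^{n-1}\alpha_i$ for $n\ge1$. $S=\{\theta\in\mathbb{R}^{d_\theta}:\nabla f(\theta)=0\}$, $C=\{f(\theta):\theta\in S\}$. ''W.p.1 on an event $A$'' means for all $\omega\in A$ outside a set of probability zero; $o,O$ are as $n\to\infty$ for each fixed $\omega$. For each compact $Q\subset\mathbb{R}^{d_\theta}$ and $a\in f(Q)$, $\delta_{Q,a}\in(0,1)$, $\mu_{Q,a}\in(1,2]$, $M_{Q,a}\in[1,\infty)$, $\nu_Q\in(0,1]$, $N_Q\in[1,\infty)$ denote fixed constants such that $|f(\theta)-a|\le M_{Q,a}\|\nabla f(\theta)\|^{\mu_{Q,a}}$ for all $\theta\in Q$ with $|f(\theta)-a|\le\delta_{Q,a}$, and $d(\theta,S)\le N_Q\|\nabla f(\theta)\|^{\nu_Q}$ for all $\theta\in Q$ (these are Lojasiewicz inequalities, available because $f$ is real-analytic under (ii) and (iii)). $\hat A$ is the (random) set of accumulation points of $\{\theta_n\}_{n\ge0}$, $\hat f=\liminf_{n\to\infty}f(\theta_n)$,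 and $\hat Q=\{\theta:d(\theta,\hat A)\le\rho\}$ on $\Lambda$, $\hat Q=\hat A$ otherwise, where $\rho$ is an arbitrary positive (deterministic or random) quantity. On $\Lambda$, $\hat\mu=\mu_{\hat Q,\hat f}$ and $\hat\nu=\mu_{\hat Q,\hat f}\,\nu_{\hat Q}/2$; off $\Lambda$, $\hat\mu=2$, $\hat\nu=1$. $\hat r=1/(2-\hat\mu)$ if $\hat\mu<2$ and $\hat r=\infty$ if $\hat\mu=2$; $\hat p=\hat\mu\min\{r,\hat r\}$; $\hat q=\hat\nu\min\{r,\hat r\}$. *)

(* Defs.v *)
From HB Require Import structures.
From mathcomp Require Import all_boot all_order all_algebra.
From mathcomp Require Import all_classical all_reals all_analysis.
From mathcomp Require Import complex.

Set Implicit Arguments.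
Unset Strict Implicit.
Unset Printing Implicit Defensive.

Import Order.TTheory GRing.Theory Num.Theory.
Import numFieldTopology.Exports numFieldNormedType.Exports.

Local Open Scope classical_set_scope.
Local Open Scope ring_scope.

(* The library norm on ['rV_n] is the sup norm (with the same topology). *)
Definition enorm (R : realType) (n : nat) (v : 'rV[R]_n) : R :=
  Num.sqrt (\sum_(i < n) v 0 i ^+ 2).

(* [dist_to d x A] is [+oo] when [A] is empty. *)
Definition dist_to (R : realType) (T : Type) (d : T -> T -> R) (x : T)
  (A : set T) : \bar R := ereal_inf [set (d x a)%:E | a in A].

Definition eudist (R : realType) (n : nat) (u v : 'rV[R]_n) : R := enorm (u - v).
Definition rdist (R : realType) (s t : R) : R := `|s - t|.
Definition cdist (R : realType) (z w : R[i]) : R := ComplexField.Normc.normc (z - w).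

Definition grad (R : realType) (n : nat) (f : 'rV[R]_n -> R) (t : 'rV[R]_n) :
  'rV[R]_n := \row_(i < n) 'D_(delta_mx 0 i) f t.

(* For nonnegative extended-real [u]: a distance to a set may be infinite. *)
Definition little_o (R : realType) (u : nat -> \bar R) (v : nat -> R) : Prop :=
  forall e : R, 0 < e -> \forall n \near \oo, (u n <= (e * v n)%:E)%E.

Definition big_O (R : realType) (u : nat -> \bar R) (v : nat -> R) : Prop :=
  exists K : R, \forall n \near \oo, (u n <= (K * v n)%:E)%E.

Definition analytic_at (K : numFieldType) (f : K -> K) (x : K) : Prop :=
  exists a : nat -> K,
    \forall y \near x, series (fun n => a n * (y - x) ^+ n) @ \oo --> f y.

Definition deriv (K : numFieldType) (f : K -> K) : K -> K :=
  @derive1 K K f.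

Definition strip (R : realType) (eps : R) : set R[i] :=
  [set z | (dist_to (@cdist R) z [set (x%:C)%C | x in [set: R]] <= eps%:E)%E].

Definition analytic_continuations (R : realType) (phi1 phi2 : R -> R) : Prop :=
  exists (h1 h2 : R[i] -> R[i]) (eps K : R),
    let cabs := @ComplexField.Normc.normc R in
    [/\ forall x : R, h1 (x%:C)%C = ((phi1 x)%:C)%C /\
                      h2 (x%:C)%C = ((phi2 x)%:C)%C,
        0 < eps < 1,
        1 <= K,
        forall z, strip eps z -> analytic_at h1 z /\ analytic_at h2 z &
        forall z, strip eps z ->
          [/\ cabs (h1 z) <= K * (1 + cabs z),
              cabs (deriv h1 z) <= K,
              cabs (h2 z) <= K &
              cabs (deriv h2 z) <= K]].

Definition borelRV (R : realType) (n : nat) :=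
  g_sigma_algebraType (@open 'rV[R]_n).

Definition mutually_independent d d' (Omega : measurableType d)
    (T : measurableType d') (R : realType) (P : probability Omega R)
    (Z : nat -> Omega -> T) : Prop :=
  forall (s : seq nat) (A : nat -> set T), uniq s ->
    (forall i, measurable (A i)) ->
    P (\bigcap_(i in [set` s]) (Z i @^-1` A i)) =
    \big[*%E/1%E]_(i <- s) P (Z i @^-1` A i).

Definition iid_with_law d d' (Omega : measurableType d)
    (T : measurableType d') (R : realType) (P : probability Omega R)
    (pi : probability T R) (Z : nat -> Omega -> T) : Prop :=
  mutually_independent P Z /\
  forall n (A : set T), measurable A -> P (Z n @^-1` A) = pi A.

(* The parameter is the row vector (a'_1, ..., a'_N1, a''_(1,1), ...,
   a''_(N1,N2)), the second block being in row-major order. *)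
Definition dtheta (N1 N2 : nat) : nat := (N1 + N1 * N2)%N.

Fact dthetaE (N1 N2 : nat) : dtheta N1 N2 = (N1 * (N2 + 1))%N.
Proof. by rewrite /dtheta mulnDr muln1 addnC. Qed.

Definition outer_w (R : realType) (N1 N2 : nat) (t : 'rV[R]_(dtheta N1 N2))
  (i1 : 'I_N1) : R := t 0 (lshift (N1 * N2) i1).

Definition inner_w (R : realType) (N1 N2 : nat) (t : 'rV[R]_(dtheta N1 N2))
  (i1 : 'I_N1) (i2 : 'I_N2) : R := t 0 (rshift N1 (mxvec_index i1 i2)).

Section network.
Context (R : realType) (N1 N2 dx : nat).
Variables (phi1 phi2 : R -> R) (psi : 'I_N2 -> borelRV R dx -> R).

Definition net_G (t : 'rV[R]_(dtheta N1 N2)) (x : borelRV R dx) : R :=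
  phi1 (\sum_(i1 < N1)
    outer_w t i1 * phi2 (\sum_(i2 < N2) inner_w t i1 i2 * psi i2 x)).

Definition net_H (t : 'rV[R]_(dtheta N1 N2)) (x : borelRV R dx) :
  'rV[R]_(dtheta N1 N2) := grad (fun s => net_G s x) t.

Definition risk (pi : probability (borelRV R dx * R)%type R)
  (t : 'rV[R]_(dtheta N1 N2)) : R :=
  2^-1 * \int[pi]_z (z.2 - net_G t z.1) ^+ 2.

End network.

Definition gamma (R : realType) (alpha : nat -> R) (n : nat) : R :=
  \sum_(0 <= i < n) alpha i.

Section lojasiewicz.
Context (R : realType) (n : nat).
Variable f : 'rV[R]_n -> R.

Definition crit : set 'rV[R]_n := [set t | grad f t = 0].
Definition crit_values : set R := f @` crit.

Definition lojasiewicz_value (delta mu M : set 'rV[R]_n -> R -> R) : Prop :=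
  forall (Q : set 'rV[R]_n) (a : R), compact Q -> (f @` Q) a ->
    [/\ 0 < delta Q a < 1, 1 < mu Q a <= 2, 1 <= M Q a &
        forall t, Q t -> `|f t - a| <= delta Q a ->
          `|f t - a| <= M Q a * enorm (grad f t) `^ mu Q a].

(* Without critical points the distance is infinite and no constants could
   satisfy the inequality; the guard makes constants available for every
   real-analytic [f]. *)
Definition lojasiewicz_dist (nu N : set 'rV[R]_n -> R) : Prop :=
  forall Q : set 'rV[R]_n, compact Q ->
    [/\ 0 < nu Q <= 1, 1 <= N Q &
        crit !=set0 -> forall t, Q t ->
          (dist_to (@eudist R n) t crit <=
           (N Q * enorm (grad f t) `^ nu Q)%:E)%E].

Definition stable (u : nat -> 'rV[R]_n) : Prop :=
  (ereal_sup (range (fun k => (enorm (u k))%:E)) < +oo)%E.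

Definition A_hat (u : nat -> 'rV[R]_n) : set 'rV[R]_n := cluster (u @ \oo).

Definition f_hat (u : nat -> 'rV[R]_n) : R :=
  fine (limn_einf (fun k => (f (u k))%:E)).

Definition Q_hat (rho : R) (u : nat -> 'rV[R]_n) : set 'rV[R]_n :=
  if `[< stable u >]
  then [set t | (dist_to (@eudist R n) t (A_hat u) <= rho%:E)%E]
  else A_hat u.

Variables (mu : set 'rV[R]_n -> R -> R) (nu : set 'rV[R]_n -> R).

Definition mu_hat (rho : R) (u : nat -> 'rV[R]_n) : R :=
  if `[< stable u >] then mu (Q_hat rho u) (f_hat u) else 2.

Definition nu_hat (rho : R) (u : nat -> 'rV[R]_n) : R :=
  if `[< stable u >]
  then mu (Q_hat rho u) (f_hat u) * nu (Q_hat rho u) / 2 else 1.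

Definition r_hat (rho : R) (u : nat -> 'rV[R]_n) : \bar R :=
  if mu_hat rho u < 2 then ((2 - mu_hat rho u)^-1)%:E else +oo%E.

Definition p_hat (r rho : R) (u : nat -> 'rV[R]_n) : R :=
  mu_hat rho u * fine (Order.min r%:E (r_hat rho u)).

Definition q_hat (r rho : R) (u : nat -> 'rV[R]_n) : R :=
  nu_hat rho u * fine (Order.min r%:E (r_hat rho u)).

End lojasiewicz.

(* Main.v *)
Require Import Defs.
From HB Require Import structures.
From mathcomp Require Import all_boot all_order all_algebra.
From mathcomp Require Import all_classical all_reals all_analysis.
From mathcomp Require Import complex ring lra measurable_realfun.

(** The update is a gradient step for the risk [f] plus the noise
[noise F w n t = F t (Z_n) - E F t] taken at [t = theta_n], where [Z_n = (x_n, y_n)] and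
[F t z] is minus the gradient in [t] of the squared error of one sample [z].  The proof
separates a probabilistic statement about [noise], uniform in the parameter, from a
deterministic statement about a single trajectory.

The uniform statement ([uniform_noise]): for almost every [w], the sums of
[c_i * noise F w i t], [c_i = alpha_i gamma_i^r], over blocks of indices beyond [m] tend
to 0 as [m] grows, together with their Lipschitz constants in [t], uniformly over a
compact set of parameters.  The uniformity covers whatever dependence [theta_n] has on
the samples, be it through [theta_0].  For one fixed function of the sample, such
sums are dominated by an integrable variable ([kolmogorov_maximal]).  To pass to a
family indexed by [t], the functions [B t z] act by multiplication on the families [F]
whose noise is dominated uniformly in [t] (the class [good]); the norm of this action
([mult]) is submultiplicative and countably subadditive, a bounded function of the sample
has norm at most its bound, and [t 0 j - t0 0 j] has norm at most [2 delta] on the ball of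
radius [delta].  Hence the families whose variation around [t0] has norm tending to 0 on
small balls (the predicate [germ]) are stable under sums, products and, by expanding power
series, under composition with real-analytic functions ([germ_comp]).  The network, built
from coordinates of [t], bounded functions of the sample, sums, products, [phi1], [phi2]
and their derivatives, gives such families, and compactness turns germs into a bound on
balls ([good_compact]).  Since [theta_n] moves by [O(alpha_n)], summation by parts turns
the uniform statement into a bound [o(gamma_m^-r)] for the accumulated noise over a window
of bounded length in the time scale [gamma] ([noise_of_uniform]).

The deterministic part groups the steps into windows of length about [t] in the time
scale [gamma].  Over a window starting at [m], a gradient step with noise of size [eta]
satisfies [f (theta_nxt) <= f (theta_m) - b |grad f (theta_m)|^2 + K eta^2]
([window_descent]), so with [u = f (theta) - fhat] the error is of order
[o(gamma_m^(-2r))].  The Lojasiewicz inequality [|u| <= M |grad f|^mu] makes [u] tend to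
0 and [|grad f|] tend to 0 along the whole trajectory ([u_limsup], [G_small]).  The
recursion behaves like the differential inequality [u' <= - c u^(2/mu) + o(T^(-2r))],
whose solutions decay like [T^(-mu min(r, 1/(2 - mu)))]: a curve [c T^(-mu rho)] cannot be
crossed upwards as soon as [rho <= r] and [rho (2 - mu) <= 1] ([u_upper]), with [c]
arbitrarily small when the second inequality is strict (this is the [o] regime, [r] smaller
than [rhat]).  A value far below the negative of such a curve could never return to 0
([u_lower]).  The gradient is recovered from the decrease of [u] over one window, the
distance to the critical values from [|u|], since [fhat] is a critical value, and the
distance to the critical points from the second Lojasiewicz inequality.  Finally
[mu > 1] makes [phat] larger than [min(1, r)], which gives the estimates with exponent
[p]. *)

Set Implicit Arguments.
Unset Strict Implicit.
Unset Printing Implicit Defensive.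

Import Order.TTheory GRing.Theory Num.Theory.
Import numFieldTopology.Exports numFieldNormedType.Exports.

Local Open Scope classical_set_scope.
Local Open Scope ring_scope.

(** * Independence and integrals of bounded functions *)

Lemma bounded_integrable d (T : measurableType d) (R : realType)
  (P : probability T R) (f : T -> R) (K : R) :
  measurable_fun setT f -> (forall x, `|f x| <= K) ->
  P.-integrable setT (EFin \o f).
Proof.
move=> mf fK; apply: measurable_bounded_integrable => //.
  by rewrite (@le_lt_trans _ _ 1%E) ?ltry// probability_le1.
exists K; split; first exact: num_real.
by move=> M KM x _; apply: le_trans (fK x) (ltW KM).
Qed.

Lemma norm_Rintegral_le d (T : measurableType d) (R : realType)
  (P : probability T R) (f : T -> R) (K : R) :
  measurable_fun setT f -> (forall x, `|f x| <= K) ->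
  `|\int[P]_x f x| <= K.
Proof.
move=> mf fK; have fi := bounded_integrable P mf fK.
apply: le_trans (le_normr_Rintegral measurableT fi) _.
have -> : K = \int[P]_x cst K x.
  by rewrite Rintegral_cst//= probability_setT mulr1.
apply: le_Rintegral => //.
- exact: integrable_norm.
- by apply: (bounded_integrable P (K := `|K|)).
Qed.

Section independence.
Context (R : realType) d d1 d2 (Omega : measurableType d)
  (T1 : measurableType d1) (T2 : measurableType d2)
  (P : probability Omega R) (pi : probability T2 R)
  (X : {mfun Omega >-> T1}) (Y : {mfun Omega >-> T2}).

(** The joint law of [X] and [Y] is the product of the law of [X] and [pi], because both
agree on rectangles; the factorization is then Fubini's theorem. *)
Lemma indep_Rintegral_mul (f : T1 -> R) (g : T2 -> R) (K K' : R) :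
  (forall A B, measurable A -> measurable B ->
    P ((X @^-1` A) `&` (Y @^-1` B)) = (P (X @^-1` A) * pi B)%E) ->
  measurable_fun setT f -> (forall x, `|f x| <= K) ->
  measurable_fun setT g -> (forall x, `|g x| <= K') ->
  \int[P]_w (f (X w) * g (Y w)) = (\int[P]_w f (X w)) * \int[pi]_z g z.
Proof.
move=> XY mf fK mg gK.
have mXY : measurable_fun setT (fun w => (X w, Y w)).
  by apply/measurable_fun_pairP; split => /=.
pose XYm := HB.pack_for {mfun Omega >-> (T1 * T2)%type} (fun w => (X w, Y w)) (isMeasurableFun.Build _ _ _ _ _ mXY).
have mfg : measurable_fun setT (fun z : T1 * T2 => f z.1 * g z.2).
  apply: measurable_funM.
    exact: (measurableT_comp mf).
  exact: (measurableT_comp mg).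
have K0 : 0 <= K by apply: le_trans (normr_ge0 _) (fK point).
have fgK z : `|f z.1 * g z.2| <= K * K'.
  by rewrite normrM ler_pM.
have E : forall A, measurable A -> (distribution P X \x pi)%E A = distribution P XYm A.
  apply: product_measure_unique => A B mA mB.
  rewrite -XY//.
have ifg : (distribution P X \x pi)%E.-integrable setT (EFin \o (fun z => f z.1 * g z.2)).
  apply: measurable_bounded_integrable => //.
    apply: (@le_lt_trans _ _ (distribution P XYm setT)).
      by rewrite le_eqVlt; apply/orP; left; apply/eqP; exact: E.
    by rewrite probability_setT ltry.
  exists (K * K'); split; first exact: num_real.
  by move=> M KM x _; apply: le_trans (fgK x) (ltW KM).
have -> : \int[P]_w (f (X w) * g (Y w)) =
          \int[distribution P XYm]_z (f z.1 * g z.2).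
  congr fine; rewrite integral_distribution//.
    exact/measurable_EFinP.
  apply: (bounded_integrable P (f := fun w => f (X w) * g (Y w)) (K := K * K')) => [|w].
    by apply: measurable_funM; exact: measurableT_comp.
  exact: (fgK (X w, Y w)).
have -> : \int[distribution P XYm]_z (f z.1 * g z.2) =
  \int[(distribution P X \x pi)%E]_z (f z.1 * g z.2).
  congr fine; apply: eq_measure_integral => A mA _; exact/esym/E.
rewrite {1}/Rintegral -(integral12_prod_meas1 ifg) /fubini_F /=.
have -> : (\int[distribution P X]_x \int[pi]_y (f x * g y)%:E =
   \int[distribution P X]_x (f x * \int[pi]_y g y)%:E)%E.
  apply: eq_integral => x _.
  rewrite -RintegralZl//; last exact: (bounded_integrable pi mg gK).
  rewrite /Rintegral fineK//; apply: integrable_fin_num => //.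
  apply: (bounded_integrable pi (f := fun y => f x * g y) (K := K * K')).
    exact: measurable_funM.
  by move=> y; exact: (fgK (x, y)).
rewrite -/(Rintegral _ _ _).
rewrite RintegralZr//; last exact: (bounded_integrable _ mf fK).
congr (_ * _); congr fine.
rewrite integral_distribution//; first exact/measurable_EFinP.
apply: (bounded_integrable P (f := fun w => f (X w)) (K := K)) => //.
exact: measurableT_comp.
Qed.

End independence.

(** * A maximal inequality for weighted sums of independent variables *)

Section maximal.
Context (R : realType) d dT (Omega : measurableType d) (T : measurableType dT)
  (P : probability Omega R) (pi : probability T R) (Z : nat -> Omega -> T).
Hypothesis mZ : forall n, measurable_fun setT (Z n).
Hypothesis iidZ : iid_with_law P pi Z.

(** The events that prescribe [Z 0, ..., Z n.-1] coordinatewise: a family closed under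
intersection that generates the history before time [n], so that independence needs to be
checked on it only. *)
Definition past (n : nat) : set (set Omega) :=
  [set B | exists A : nat -> set T, (forall i, measurable (A i)) /\
     B = \bigcap_(i in [set` iota 0 n]) (Z i @^-1` A i)].

Let mpre n A : measurable A -> measurable (Z n @^-1` A).
Proof. by move=> mA; rewrite -[X in measurable X]setTI; exact: mZ. Qed.

Lemma past_measurable n : past n `<=` measurable.
Proof.
move=> B [A [mA ->]]; apply: bigcap_measurableType => i _; exact: mpre.
Qed.

Lemma past_sub n : <<s past n >> `<=` @measurable _ Omega.
Proof.
apply: smallest_sub; first exact: sigma_algebra_measurable.
exact: past_measurable.
Qed.

Lemma past_setI n : setI_closed (past n).
Proof.
move=> _ _ [A [mA ->]] [B [mB ->]]; exists (fun i => A i `&` B i); split.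
  by move=> i; exact: measurableI.
apply/seteqP; split=> w /=.
  by move=> [wA wB] i ni; split; [exact: wA|exact: wB].
by move=> h; split=> i ni; have [] := h i ni.
Qed.

Lemma past_setT n : past n setT.
Proof.
exists (fun=> setT); split=> //; apply/seteqP; split=> //.
Qed.

Lemma past_indep n B A : <<s past n >> B -> measurable A ->
  P (B `&` Z n @^-1` A) = (P B * pi A)%E.
Proof.
move=> pB mA; have [ind law] := iidZ.
have pA0 : 0 <= fine (pi A) by rewrite fine_ge0.
have -> : (P B * pi A)%E = mscale (NngNum pA0) P B.
  by rewrite -[RHS]/((fine (pi A))%:E * P B)%E muleC fineK// fin_num_measure.
change (mrestr P (mpre n mA) B = mscale (NngNum pA0) P B).
apply: (g_sigma_algebra_measure_unique (past n) (@past_measurable n) (fun=> setT)) => //.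
- by move=> _; exact: past_setT.
- by rewrite bigcup_const.
- exact: past_setI.
- move=> _ [C [mC ->]]; rewrite -[RHS]/((fine (pi A))%:E * P _)%E fineK ?fin_num_measure// muleC /mrestr.
  pose D i := if i == n then A else C i.
  have mD i : measurable (D i) by rewrite /D; case: ifP.
  have := ind (iota 0 n.+1) D (iota_uniq _ _) mD.
  rewrite -(addn1 n) iotaD add0n big_cat/= big_seq1.
  have E1 : \bigcap_(i in [set` iota 0 n ++ [:: n]]) (Z i @^-1` D i) =
            \bigcap_(i in [set` iota 0 n]) (Z i @^-1` C i) `&` Z n @^-1` A.
    apply/seteqP; split=> w /=.
      move=> h; split.
        move=> i /= ni; have := h i; rewrite /= mem_cat ni => /(_ isT).
        by rewrite /D; case: eqP ni => // ->; rewrite mem_iota add0n ltnn andbF.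
      by have := h n; rewrite /= mem_cat inE eqxx orbT /D eqxx => /(_ isT).
    move=> [h1 h2] i; rewrite /= mem_cat inE => /orP[ni|/eqP->].
      have := h1 i ni; rewrite /D; case: eqP ni => // ->.
      by rewrite mem_iota add0n ltnn andbF.
    by rewrite /D eqxx.
  rewrite E1 => H; apply: (etrans H); rewrite {2}/D eqxx law//; congr (_ * _)%E.
  have := ind (iota 0 n) C (iota_uniq _ _) mC => ->.
  rewrite big_seq [RHS]big_seq; apply: eq_bigr => i.
  rewrite mem_iota add0n => /andP[_ ni].
  by rewrite /D ltn_eqF.
- move=> _; rewrite /= /mrestr setTI.
  by apply: le_lt_trans (probability_le1 _ _) _ => //; [exact: mpre|rewrite ltry].
Qed.

(** [Omega] with the history before time [n] as its sigma-algebra; being a measurable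
function of the past is measurability on this type. *)
Definition pastT n := g_sigma_algebraType (past n).

Definition toPast n : Omega -> pastT n := fun w => w.

Lemma measurable_toPast n : measurable_fun setT (toPast n).
Proof. by move=> _ B mB; rewrite setTI; apply: past_sub mB. Qed.

Lemma Z_past n i : (i < n)%N -> measurable_fun setT (Z i : pastT n -> T).
Proof.
move=> ni _ B mB; rewrite setTI; apply: sub_sigma_algebra.
exists (fun j => if j == i then B else setT); split.
  by move=> j; case: ifP.
apply/seteqP; split=> w /=.
  by move=> wB j _ /=; case: eqP => // ->.
by move=> /(_ i); rewrite /= eqxx; apply; rewrite mem_iota.
Qed.

Lemma past_Rintegral_mul n (f : Omega -> R) (g : T -> R) (K K' : R) :
  measurable_fun setT (f : pastT n -> R) -> (forall w, `|f w| <= K) ->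
  measurable_fun setT g -> (forall x, `|g x| <= K') ->
  \int[P]_w (f w * g (Z n w)) = (\int[P]_w f w) * \int[pi]_z g z.
Proof.
move=> mf fK mg gK.
pose X := HB.pack_for {mfun Omega >-> pastT n} (toPast n)
  (isMeasurableFun.Build _ _ _ _ _ (@measurable_toPast n)).
pose Y := HB.pack_for {mfun Omega >-> T} (Z n)
  (isMeasurableFun.Build _ _ _ _ _ (mZ n)).
apply: (indep_Rintegral_mul (X := X) (Y := Y) _ mf fK mg gK) => A B mA mB.
exact: past_indep.
Qed.

Variables (h : T -> R) (c : nat -> R).
Hypothesis mh : measurable_fun setT h.
Hypothesis h1 : forall z, `|h z| <= 1.
Hypothesis c1 : forall n, \sum_(i < n) c i ^+ 2 <= 1.

Let xi z := h z - \int[pi]_z h z.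
Let S n w := \sum_(i < n) c i * xi (Z i w).
(** The running maximum of the partial sums, started at 0. *)
Fixpoint runmax n w :=
  if n is n'.+1 then Num.max (runmax n' w) (\sum_(i < n) c i * xi (Z i w)) else 0.

Let mxi : measurable_fun setT xi.
Proof. by apply: measurable_funB => //; exact: measurable_cst. Qed.

Let xi2 z : `|xi z| <= 2.
Proof.
apply: le_trans (ler_normB _ _) _; rewrite -[2]/(1 + 1); apply: lerD => //.
exact: norm_Rintegral_le.
Qed.

Let intxi : \int[pi]_z xi z = 0.
Proof.
rewrite RintegralB//.
- by rewrite Rintegral_cst//= probability_setT mulr1 subrr.
- exact: (bounded_integrable pi mh h1).
- exact: (bounded_integrable pi (K := `|\int[pi]_z h z|)).
Qed.

Let mS m n : (n <= m)%N -> measurable_fun setT (S n : pastT m -> R).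
Proof.
move=> nm; rewrite /S; apply: measurable_sum => i.
apply: measurable_funM; first exact: measurable_cst.
by apply: (measurableT_comp mxi); apply: Z_past; apply: leq_trans nm.
Qed.

Let mM m n : (n <= m)%N -> measurable_fun setT (runmax n : pastT m -> R).
Proof.
elim: n => [|n IHn] nm; first exact: measurable_cst.
by apply: measurable_maxr; [exact: IHn (ltnW nm)|exact: (mS nm)].
Qed.

Let toOmega m (f : Omega -> R) : measurable_fun setT (f : pastT m -> R) ->
  measurable_fun setT f.
Proof. by move=> mf; exact: (measurableT_comp mf (@measurable_toPast m)). Qed.

Let B n := \sum_(i < n) `|c i| * 2.

Let SB n w : `|S n w| <= B n.
Proof.
apply: le_trans (ler_norm_sum _ _ _) _; apply: ler_sum => i _.
by rewrite normrM ler_wpM2l.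
Qed.

Let B_nd n : B n <= B n.+1.
Proof. by rewrite /B big_ord_recr/= lerDl mulr_ge0. Qed.

Lemma runmax_ge0 n w : 0 <= runmax n w.
Proof. by elim: n => //= n IHn; rewrite le_max IHn. Qed.

Let MB n w : `|runmax n w| <= B n.
Proof.
rewrite ger0_norm ?runmax_ge0//.
elim: n => [|n IHn] /=; first by rewrite /B big_ord0.
rewrite ge_max (le_trans IHn (B_nd n))/=.
exact: le_trans (ler_norm _) (SB n.+1 w).
Qed.

(** The centred increments are orthogonal to bounded functions of the past, in
particular to the partial sums (for [S2]) and to their running maximum (for [EM]). *)
Let orth n (f : Omega -> R) (K : R) :
  measurable_fun setT (f : pastT n -> R) -> (forall w, `|f w| <= K) ->
  \int[P]_w (f w * xi (Z n w)) = 0.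
Proof. by move=> mf fK; rewrite (past_Rintegral_mul mf fK mxi xi2) intxi mulr0. Qed.

Let bint := @bounded_integrable _ Omega R P.

Let bint_sq (X : Omega -> R) K : measurable_fun setT X -> (forall w, `|X w| <= K) ->
  P.-integrable setT (EFin \o (fun w => X w ^+ 2)).
Proof.
move=> mX XK; apply: (@bint _ (K ^+ 2)) => [|w]; first exact: measurable_funX.
by rewrite normrX lerXn2r ?nnegrE// (le_trans _ (XK w)).
Qed.

Let S2 n : \int[P]_w (S n w ^+ 2) <= 4 * \sum_(i < n) c i ^+ 2.
Proof.
elim: n => [|n IHn].
  rewrite big_ord0 mulr0 /S; under eq_Rintegral do rewrite big_ord0 expr0n/=.
  by rewrite Rintegral_cst// mul0r.
have mSn := toOmega (mS (leqnn n)).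
have mxiZ : measurable_fun setT (fun w => xi (Z n w)) by exact: (measurableT_comp mxi).
have -> : \int[P]_w (S n.+1 w ^+ 2) = \int[P]_w ((S n w ^+2 + (2 * c n) * (S n w * xi (Z n w))) + c n ^+ 2 * xi (Z n w) ^+ 2).
  apply: eq_Rintegral => w _; rewrite /S big_ord_recr/=; ring.
have i1 := bint_sq mSn (SB n).
have i2 : P.-integrable setT (EFin \o (fun w => S n w * xi (Z n w))).
  apply: (@bint _ (B n * 2)) => [|w]; first exact: measurable_funM.
  by rewrite normrM ler_pM.
have i3 : P.-integrable setT (EFin \o (fun w => (2 * c n) * (S n w * xi (Z n w)))).
  by have := integrableZl measurableT (2 * c n) i2; apply: eq_integrable.
have i4 : P.-integrable setT (EFin \o (fun w => c n ^+ 2 * xi (Z n w) ^+ 2)).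
  apply: (@bint _ (c n ^+ 2 * 4)) => [|w].
    by apply: measurable_funM; [exact: measurable_cst|exact: measurable_funX].
  rewrite normrM ger0_norm ?sqr_ge0// ler_wpM2l ?sqr_ge0//.
  have -> : (4 : R) = 2 ^+ 2 by rewrite expr2; lra.
  by rewrite normrX lerXn2r ?nnegrE.
rewrite RintegralD//; last first.
  by have := integrableD measurableT i1 i3; apply: eq_integrable.
rewrite RintegralD// RintegralZl// (orth (mS (leqnn n)) (SB n)) mulr0 addr0.
rewrite big_ord_recr/= mulrDr; apply: lerD => //.
have -> : 4 * c n ^+ 2 = \int[P]_w (cst (4 * c n ^+ 2) w).
  by rewrite Rintegral_cst//= probability_setT mulr1.
apply: le_Rintegral => //.
  by apply: (@bint _ `|4 * c n ^+ 2|).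
move=> w _ /=; rewrite mulrC ler_wpM2r ?sqr_ge0//.
have -> : (4 : R) = 2 ^+ 2 by rewrite expr2; lra.
by rewrite -real_normK ?num_real// lerXn2r ?nnegrE.
Qed.

(** A pathwise form of Doob's inequality.  Writing [S] and [M] for the sums and their
running maximum, the left-hand side is the sum of [M_i (S_(i+1) - S_i)]; where the maximum
is not renewed, both sides increase by the same amount, and where it jumps from [M] to [S]
the difference is [(S - M)^2 / 2]. *)
Let pathwise n w : \sum_(i < n) c i * (runmax i w * xi (Z i w)) <=
  runmax n w * S n w - runmax n w ^+ 2 / 2.
Proof.
elim: n => [|n IHn]; first by rewrite big_ord0/= mul0r expr0n/= mul0r subr0.
rewrite big_ord_recr/=; set s := \sum_(i < n.+1) _.
have sE : S n.+1 w = s by [].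
have sn : s = S n w + c n * xi (Z n w) by rewrite /s big_ord_recr.
rewrite sE; set m := runmax n w in IHn *; set X := \sum_(i < n) _ in IHn *.
have [ms|sm] := leP m s.
  have : 0 <= (s - m) ^+ 2 by exact: sqr_ge0.
  rewrite sn in ms *; nra.
rewrite sn in sm *; nra.
Qed.

(** The stochastic integral in [pathwise] has mean 0, so that inequality and
[4 M S <= M^2 + 4 S^2] bound the second moment of the maximum by four times that of the
last sum, itself at most 4. *)
Let EM n : \int[P]_w (runmax n w ^+ 2) <= 16.
Proof.
have mSn := toOmega (mS (leqnn n)).
have mMn := toOmega (mM (leqnn n)).
have i1 := bint_sq mSn (SB n).
have i2 := bint_sq mMn (MB n).
have mt i : measurable_fun setT (fun w => c i * (runmax i w * xi (Z i w))).
  apply: measurable_funM; first exact: measurable_cst.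
  apply: measurable_funM; first exact: toOmega (mM (leqnn i)).
  exact: (measurableT_comp mxi).
have it i : P.-integrable setT (EFin \o (fun w => c i * (runmax i w * xi (Z i w)))).
  apply: (@bint _ (`|c i| * (B i * 2))) => [//|w].
  by rewrite normrM ler_wpM2l// normrM ler_pM.
have iti m : P.-integrable setT (EFin \o (fun w => \sum_(i < m) c i * (runmax i w * xi (Z i w)))).
  elim: m => [|m IHm].
    have -> : (fun w => \sum_(i < 0) c i * (runmax i w * xi (Z i w))) = cst 0.
      by apply/funext => w; rewrite big_ord0.
    by apply: (@bint _ 0) => // w; rewrite /= normr0.
  have := integrableD measurableT IHm (it m); apply: eq_integrable => // w _.
  by rewrite /= big_ord_recr.
have I0 m : \int[P]_w (\sum_(i < m) c i * (runmax i w * xi (Z i w))) = 0.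
  elim: m => [|m IHm].
    under eq_Rintegral do rewrite big_ord0.
    by rewrite Rintegral_cst// mul0r.
  have -> : \int[P]_w (\sum_(i < m.+1) c i * (runmax i w * xi (Z i w))) =
    \int[P]_w ((\sum_(i < m) c i * (runmax i w * xi (Z i w))) + c m * (runmax m w * xi (Z m w))).
    by apply: eq_Rintegral => w _; rewrite big_ord_recr.
  rewrite RintegralD// [X in X + _]IHm add0r RintegralZl//.
    by rewrite (orth (mM (leqnn m)) (MB m)) mulr0.
  apply: (@bint _ (B m * 2)) => [|w]; last by rewrite normrM ler_pM.
  apply: measurable_funM; first exact: toOmega (mM (leqnn m)).
  exact: (measurableT_comp mxi).
have : \int[P]_w (runmax n w ^+ 2) <= \int[P]_w (4 * S n w ^+ 2 - 4 * \sum_(i < n) c i * (runmax i w * xi (Z i w))).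
  apply: le_Rintegral => //.
    have := integrableB measurableT (integrableZl measurableT 4 i1) (integrableZl measurableT 4 (iti n)).
    by apply: eq_integrable.
  move=> w _; have := pathwise n w.
  set s := S n w; set m := runmax n w; set X := \sum_(i < n) _.
  have : 0 <= (2 * s - m) ^+ 2 by exact: sqr_ge0.
  nra.
rewrite RintegralB//; last 2 first.
- by have := integrableZl measurableT 4 i1; apply: eq_integrable.
- by have := integrableZl measurableT 4 (iti n); apply: eq_integrable.
rewrite !RintegralZl// I0 mulr0 subr0 => /le_trans; apply.
have := S2 n; have := c1 n; set a := \int[P]_w _; set b := \sum_(i < n) _; lra.
Qed.

(** The limit of the running maxima dominates all partial sums; its mean is at most
[1/2 + 16/2] by [2 M <= 1 + M^2] and monotone convergence. *)
Lemma one_sided_maximal : exists Y : Omega -> \bar R,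
  [/\ measurable_fun setT Y, (forall w, (0 <= Y w)%E),
      (\int[P]_w Y w <= 9%:E)%E &
      forall n w, ((\sum_(i < n) c i * (h (Z i w) - \int[pi]_z h z))%:E <= Y w)%E].
Proof.
pose M n w := (runmax n w)%:E.
have ndM w : {homo M ^~ w : n m / (n <= m)%N >-> (n <= m)%E}.
  apply: homo_leq => [//|y x z|n]; first exact: le_trans.
  by rewrite lee_fin/= le_max lexx.
have mMn n : measurable_fun setT (M n).
  by apply/measurable_EFinP; exact: toOmega (mM (leqnn n)).
have M0 n w : (0 <= M n w)%E by rewrite lee_fin runmax_ge0.
have cM w : M ^~ w @ \oo --> limn (M ^~ w).
  by apply: ereal_nondecreasing_is_cvgn => n m; exact: ndM.
exists (fun w => limn (M ^~ w)); split.
- by apply: (emeasurable_fun_cvg M) => // w _; exact: cM.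
- by move=> w; apply: lime_ge; [exact: cM|exact: nearW].
- rewrite (monotone_convergence P measurableT mMn) => [|n w _|w _]; last 2 first.
    exact: M0.
    exact: ndM.
  apply: lime_le.
    apply: ereal_nondecreasing_is_cvgn => m n mn.
    apply: ge0_le_integral => //.
    by move=> w _; exact: ndM.
  apply: nearW => n.
  have i1 : P.-integrable setT (M n).
    by apply: (@bint (runmax n) (B n)) => //; exact: toOmega (mM (leqnn n)).
  rewrite -[X in (X <= _)%E]fineK ?integrable_fin_num// lee_fin.
  have i2 := bint_sq (toOmega (mM (leqnn n))) (MB n).
  have i3 : P.-integrable setT (EFin \o (fun w => 2^-1 * runmax n w ^+2)).
    by have := integrableZl measurableT (2^-1) i2; apply: eq_integrable.
  have i4 : P.-integrable setT (EFin \o (cst (2^-1 : R))).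
    by apply: (@bint _ (`|2^-1|)).
  have : \int[P]_w (runmax n w) <= \int[P]_w (cst 2^-1 w + 2^-1 * runmax n w ^+ 2).
    apply: le_Rintegral => //.
      by have := integrableD measurableT i4 i3; apply: eq_integrable.
    move=> w _ /=; have : 0 <= (runmax n w - 1) ^+ 2 by exact: sqr_ge0.
    set m := runmax n w; nra.
  rewrite RintegralD// RintegralZl// Rintegral_cst//= probability_setT mulr1.
  have := EM n; rewrite /Rintegral; set a := fine _; set b := fine _; lra.
- move=> n w; apply: (@le_trans _ _ (M n w)).
    rewrite lee_fin; case: n => [|n]; first by rewrite big_ord0.
    by rewrite /= le_max lexx orbT.
  apply: lime_ge; first exact: cM.
  near=> k; apply: ndM; near: k; exact: nbhs_infty_ge.
Unshelve. all: by end_near. Qed.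

End maximal.

(** The signed sums are dominated on each side, the lower side by changing the sign of
the weights; the two dominating variables are added. *)
Lemma kolmogorov_maximal (R : realType) d dT (Omega : measurableType d)
  (T : measurableType dT) (P : probability Omega R) (pi : probability T R)
  (Z : nat -> Omega -> T) (mZ : forall n, measurable_fun setT (Z n))
  (iidZ : iid_with_law P pi Z) (h : T -> R) (c : nat -> R) :
  measurable_fun setT h -> (forall z, `|h z| <= 1) ->
  (forall n, \sum_(i < n) c i ^+ 2 <= 1) ->
  exists Y : Omega -> \bar R,
  [/\ measurable_fun setT Y, (forall w, (0 <= Y w)%E),
      (\int[P]_w Y w <= 18%:E)%E &
      forall n w, ((`|\sum_(i < n) c i * (h (Z i w) - \int[pi]_z h z)|)%:E <= Y w)%E].
Proof.
move=> mh h1 c1.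
have [Y1 [mY1 Y10 iY1 SY1]] := one_sided_maximal mZ iidZ mh h1 c1.
have c1' n : \sum_(i < n) (- c i) ^+ 2 <= 1.
  by under eq_bigr do rewrite sqrrN; exact: c1.
have [Y2 [mY2 Y20 iY2 SY2]] := one_sided_maximal (c := fun i => - c i) mZ iidZ mh h1 c1'.
exists (fun w => Y1 w + Y2 w)%E; split.
- exact: emeasurable_funD.
- by move=> w; exact: adde_ge0.
- rewrite ge0_integralD//.
  apply: le_trans (leeD iY1 iY2) _; rewrite -EFinD lee_fin; lra.
- move=> n w; set s := \sum_(i < n) _.
  have [s0|s0] := ger0P s.
    by apply: le_trans (SY1 n w) _; rewrite leeDl.
  have := SY2 n w; have -> : \sum_(i < n) - c i * (h (Z i w) - \int[pi]_z h z) = - s.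
    by rewrite /s -sumrN; apply: eq_bigr => i _; rewrite mulNr.
  by move=> /le_trans; apply; rewrite leeDr.
Qed.

(** * Noise that is small uniformly in the parameter *)

Lemma coord_le_norm (R : realType) (n : nat) (s : 'rV[R]_n) j : `|s 0 j| <= `|s|.
Proof.
by rewrite [leRHS]/Num.Def.normr /= mx_normrE; apply/bigmax_geP; right => /=; exists (0, j).
Qed.

Lemma norm_le_coord (R : realType) (n : nat) (s : 'rV[R]_n) (K : R) : 0 <= K ->
  (forall j, `|s 0 j| <= K) -> `|s| <= K.
Proof.
move=> K0 sK; rewrite [leLHS]/Num.Def.normr /= mx_normrE; apply/bigmax_leP; split=> // -[i j] _ /=.
by rewrite ord1.
Qed.

Lemma compact_normball (R : realType) (n : nat) (c : R) :
  compact [set t : 'rV[R]_n | `|t| <= c].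
Proof.
apply: bounded_closed_compact.
  exists c; split; first exact: num_real.
  by move=> x xr t /= /le_trans; apply; exact: ltW.
have -> : [set t : 'rV[R]_n | `|t| <= c] = (fun t : 'rV[R]_n => `|t|) @^-1` [set x | x <= c] by [].
by apply: closed_comp => [t _|]; [exact: norm_continuous|exact: closed_le].
Qed.

Lemma cvg_norm_le (R : realType) (u : nat -> R) (l y : R) :
  u @ \oo --> l -> (forall n, `|u n| <= y) -> `|l| <= y.
Proof.
move=> ul uy; rewrite -(cvg_lim _ (cvg_norm ul))//; apply: limr_le.
  by apply: is_cvg_norm; apply/cvg_ex; exists l.
exact: nearW.
Qed.

(** Dominated convergence with a constant as the dominating function. *)
Lemma Rintegral_bounded_cvg d (T : measurableType d) (R : realType)
  (P : probability T R) (u : nat -> T -> R) (f : T -> R) (K : R) :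
  (forall n, measurable_fun setT (u n)) -> (forall n x, `|u n x| <= K) ->
  (forall x, u ^~ x @ \oo --> f x) ->
  (\int[P]_x u n x) @[n --> \oo] --> \int[P]_x f x.
Proof.
move=> mu uK uf.
have mf : measurable_fun setT f.
  by apply: (measurable_fun_cvg (h := u)) => // x _; exact: uf.
have fK x : `|f x| <= K by exact: (cvg_norm_le (uf x)).
apply: fine_cvg.
rewrite fineK; last by apply: integrable_fin_num => //; exact: (bounded_integrable P mf fK).
have [|||||_ _] := @dominated_convergence _ T R P setT measurableT
  (fun n => EFin \o u n) (EFin \o f) (cst K%:E).
- by move=> n; exact/measurable_EFinP.
- exact/measurable_EFinP.
- by apply: aeW => x _; apply: cvg_EFin; [exact: nearW|exact: uf].
- by apply: (bounded_integrable P (f := cst K) (K := `|K|)).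
- by apply: aeW => x n _; rewrite lee_fin.
- by apply.
Qed.

Section noise_class.
Context (R : realType) (n : nat) d dT (Omega : measurableType d)
  (T : measurableType dT) (P : probability Omega R) (pi : probability T R)
  (Z : nat -> Omega -> T).
Hypothesis mZ : forall n, measurable_fun setT (Z n).
Hypothesis iidZ : iid_with_law P pi Z.

Notation Theta := 'rV[R]_n.
Implicit Types (F B : Theta -> T -> R) (g : T -> R) (c : nat -> R) (t : Theta) (C eta : R).

(** The extra factor [g], a function of the sample alone, makes [noise_bound] stable under
multiplication of [F] by such functions: they are absorbed in [g]. *)
Definition nsum g F c k w t : R :=
  \sum_(i < k) c i * (g (Z i w) * F t (Z i w) - \int[pi]_z (g z * F t z)).

(** The sup norm and the Lipschitz seminorm scaled by [delta], with a common bound.  With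
this scaling the norm of [t 0 j - t0 0 j] on the ball of radius [delta] is of order
[delta], see [mult_coord]. *)
Definition tame (U : set Theta) (delta C : R) (h : Theta -> R) :=
  (forall t, U t -> `|h t| <= C) /\
  (forall t t', U t -> U t' -> delta * `|h t - h t'| <= C * `|t - t'|).

(** One integrable variable dominates the noise sums of all lengths, at all parameters of
[U], for each choice of weights of square sum at most 1.  Only its mean is controlled by
[C], uniformly in the weights; this is what survives sums and series. *)
Definition noise_bound (U : set Theta) delta F C :=
  forall g c, measurable_fun setT g -> (forall z, `|g z| <= 1) ->
  (forall k, \sum_(i < k) c i ^+ 2 <= 1) ->
  exists Y : Omega -> \bar R,
  [/\ measurable_fun setT Y, (forall w, (0 <= Y w)%E), (\int[P]_w Y w <= C%:E)%E &
    forall w k y, Y w = y%:E -> tame U delta y (nsum g F c k w)].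

Definition good (U : set Theta) delta F C :=
  [/\ 0 <= C, (forall t, U t -> measurable_fun setT (F t)),
      (forall z, tame U delta C (F ^~ z)) & noise_bound U delta F C].

(** A bound [eta] for the norm of multiplication by [B] on [good].  The noise of a product
is not controlled by the noises of its factors, so [good] is not closed under products;
multiplication operators compose, hence have a submultiplicative norm, and power series of
them can be summed. *)
Definition mult (U : set Theta) delta B (eta : R) :=
  [/\ 0 <= eta, (forall t, U t -> forall z, `|B t z| <= eta) &
   forall F C, good U delta F C -> good U delta (fun t z => B t z * F t z) (eta * C)].

Section fixed_domain.
Variables (U : set Theta) (delta : R).
Hypothesis delta_gt0 : 0 < delta.

Lemma tame_le C C' h : C <= C' -> tame U delta C h -> tame U delta C' h.
Proof.
move=> CC' [h1 h2]; split=> [t Ut|t t' Ut Ut']; first exact: le_trans (h1 t Ut) CC'.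
by apply: le_trans (h2 _ _ Ut Ut') _; rewrite ler_wpM2r.
Qed.

Lemma tame_add C C' h h' : tame U delta C h -> tame U delta C' h' ->
  tame U delta (C + C') (fun t => h t + h' t).
Proof.
move=> [h1 h2] [k1 k2]; split=> [t Ut|t t' Ut Ut'].
  by apply: le_trans (ler_normD _ _) _; apply: lerD; [exact: h1|exact: k1].
rewrite opprD addrACA mulrDl.
apply: le_trans (_ : delta * (`|h t - h t'| + `|h' t - h' t'|) <= _).
  by rewrite ler_wpM2l ?ler_normD// ltW.
by rewrite mulrDr lerD// ?h2// k2.
Qed.

Lemma tame_scale K C h : tame U delta C h -> tame U delta (`|K| * C) (fun t => K * h t).
Proof.
move=> [h1 h2]; split=> [t Ut|t t' Ut Ut'].
  by rewrite normrM ler_wpM2l// h1.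
by rewrite -mulrBr normrM mulrCA -mulrA ler_wpM2l// h2.
Qed.

(** Both bounds are closed conditions at finitely many points. *)
Lemma tame_cvg C (u : nat -> Theta -> R) h :
  (forall t, U t -> u ^~ t @ \oo --> h t) -> (forall N, tame U delta C (u N)) ->
  tame U delta C h.
Proof.
move=> uh tu; split=> [t Ut|t t' Ut Ut'].
  by apply: (cvg_norm_le (uh t Ut)) => N; exact: (tu N).1.
rewrite mulrC -ler_pdivlMr//.
apply: (@cvg_norm_le R (fun N => u N t - u N t')).
  by apply: cvgB; exact: uh.
by move=> N; rewrite ler_pdivlMr// mulrC; exact: (tu N).2.
Qed.

Lemma tame_eq C h h' : (forall t, U t -> h t = h' t) ->
  tame U delta C h -> tame U delta C h'.
Proof.
move=> hh' [h1 h2]; split=> [t Ut|t t' Ut Ut']; first by rewrite -hh'// h1.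
by rewrite -!hh'// h2.
Qed.

Let gF_meas g F t : measurable_fun setT g -> measurable_fun setT (F t) ->
  measurable_fun setT (fun z => g z * F t z).
Proof. by move=> mg mF; exact: measurable_funM. Qed.

Let gF_bound g F C t : (forall z, `|g z| <= 1) -> (forall z, `|F t z| <= C) ->
  forall z, `|g z * F t z| <= C.
Proof. by move=> g1 FC z; rewrite normrM -[C]mul1r ler_pM. Qed.

Let gF_int g F C t : U t -> good U delta F C -> measurable_fun setT g ->
  (forall z, `|g z| <= 1) -> pi.-integrable setT (EFin \o (fun z => g z * F t z)).
Proof.
move=> Ut [_ mF tF _] mg g1; apply: (bounded_integrable pi (K := C)).
  exact: gF_meas (mF t Ut).
by apply: gF_bound => // z; exact: (tF z).1.
Qed.

Lemma good_eq F F' C : (forall t, U t -> F t = F' t) -> good U delta F C ->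
  good U delta F' C.
Proof.
move=> FF' [C0 mF tF nF]; split=> //.
- by move=> t Ut; rewrite -FF'//; exact: mF.
- by move=> z; apply: tame_eq (tF z) => t Ut; rewrite FF'.
- move=> g c mg g1 c1; have [Y [mY Y0 iY bY]] := nF g c mg g1 c1.
  exists Y; split=> // w k y Yy; apply: tame_eq (bY w k y Yy) => t Ut.
  by rewrite /nsum FF'.
Qed.

Lemma good_le F C C' : C <= C' -> good U delta F C -> good U delta F C'.
Proof.
move=> CC' [C0 mF tF nF]; split=> //.
- exact: le_trans CC'.
- by move=> z; exact: tame_le (tF z).
- move=> g c mg g1 c1; have [Y [mY Y0 iY bY]] := nF g c mg g1 c1.
  by exists Y; split=> //; apply: le_trans iY _; rewrite lee_fin.
Qed.

Lemma good_one : good U delta (fun _ _ => 1) 18.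
Proof.
split=> //.
- by move=> z; split=> [t _|t t' _ _]; rewrite ?normr1 ?subrr ?normr0 ?mulr0 ?mulr_ge0 ?ler1n.
- move=> g c mg g1 c1.
  have [Y [mY Y0 iY bY]] := kolmogorov_maximal mZ iidZ mg g1 c1.
  exists Y; split=> // w k y Yy.
  have E t : nsum g (fun _ _ => 1) c k w t =
             \sum_(i < k) c i * (g (Z i w) - \int[pi]_z g z).
    apply: eq_bigr => i _; rewrite mulr1; congr (_ * (_ - _)).
    by apply: eq_Rintegral => z _; rewrite mulr1.
  split=> [t _|t t' _ _]; first by rewrite E -lee_fin -Yy.
  rewrite !E subrr normr0 mulr0 mulr_ge0//.
  by have := Y0 w; rewrite Yy lee_fin.
Qed.

Lemma good_zero : good U delta (fun _ _ => 0) 0.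
Proof.
split=> //.
- by move=> z; split=> [t _|t t' _ _]; rewrite ?subr0 ?normr0 ?mulr0 ?mul0r.
- move=> g c mg g1 c1; exists (cst 0%E); split=> //.
    by rewrite integral0.
  move=> w k _ [<-].
  have E t : nsum g (fun _ _ => 0) c k w t = 0.
    rewrite /nsum big1// => i _; under eq_Rintegral do rewrite mulr0.
    by rewrite Rintegral_cst// mul0r mulr0 subr0 mulr0.
  by split=> [t _|t t' _ _]; rewrite !E ?subr0 normr0 ?mulr0 ?mul0r.
Qed.

Lemma nsum_add g F F' C C' c k w t : U t -> measurable_fun setT g ->
  (forall z, `|g z| <= 1) -> good U delta F C -> good U delta F' C' ->
  nsum g (fun t z => F t z + F' t z) c k w t = nsum g F c k w t + nsum g F' c k w t.
Proof.
move=> Ut mg g1 gF gF'; rewrite /nsum -big_split/=; apply: eq_bigr => i _.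
under eq_Rintegral do rewrite mulrDr.
rewrite RintegralD//; [ring|exact: gF_int gF mg g1|exact: gF_int gF' mg g1].
Qed.

Lemma good_add F F' C C' : good U delta F C -> good U delta F' C' ->
  good U delta (fun t z => F t z + F' t z) (C + C').
Proof.
move=> gF gF'; have [C0 mF tF nF] := gF; have [C'0 mF' tF' nF'] := gF'; split.
- exact: addr_ge0.
- by move=> t Ut; apply: measurable_funD; [exact: mF|exact: mF'].
- by move=> z; exact: tame_add.
- move=> g c mg g1 c1; have [Y [mY Y0 iY bY]] := nF g c mg g1 c1.
  have [Y' [mY' Y'0 iY' bY']] := nF' g c mg g1 c1.
  exists (fun w => Y w + Y' w)%E; split.
  + exact: emeasurable_funD.
  + by move=> w; exact: adde_ge0.
  + by rewrite ge0_integralD// EFinD; exact: leeD.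
  + move=> w k y; have := Y0 w; have := Y'0 w.
    case E : (Y w) => [a| |]; case E' : (Y' w) => [b| |]//= _ _ [<-].
    apply: tame_eq (tame_add (bY w k a E) (bY' w k b E')) => t Ut.
    by rewrite (nsum_add _ _ _ Ut mg g1 gF gF').
Qed.

(** The variables that dominate the terms are summed; the sum has mean at most [C] by
monotone convergence, and where it is finite the noise sums of the partial sums converge
to that of [F], the integrals by dominated convergence. *)
Lemma good_series (F_ : nat -> Theta -> T -> R) (C_ : nat -> R) F C :
  (forall m, good U delta (F_ m) (C_ m)) ->
  (forall N, \sum_(m < N) C_ m <= C) ->
  (forall t z, U t -> (\sum_(m < N) F_ m t z) @[N --> \oo] --> F t z) ->
  good U delta F C.
Proof.
move=> gF CC FF.
pose G N t z := \sum_(m < N) F_ m t z.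
have gG N : good U delta (G N) (\sum_(m < N) C_ m).
  elim: N => [|N IHN].
    by rewrite big_ord0; apply: good_eq good_zero => t _; apply/funext => z; rewrite /G big_ord0.
  rewrite big_ord_recr/=; apply: good_eq (good_add IHN (gF N)) => t _.
  by apply/funext => z; rewrite /G big_ord_recr.
have gGC N := good_le (CC N) (gG N).
split.
- by have := CC 0%N; rewrite big_ord0.
- move=> t Ut; apply: (measurable_fun_cvg (h := fun N => G N t)).
    by move=> N; have [_ mG _ _] := gG N; exact: mG.
  by move=> z _; exact: FF.
- move=> z; apply: (tame_cvg (u := fun N t => G N t z)) => [t Ut|N]; first exact: FF.
  by have [_ _ tG _] := gGC N; exact: tG.
- move=> g c mg g1 c1.
  have /choice[Y_ YP] : forall m, exists Y : Omega -> \bar R,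
    [/\ measurable_fun setT Y, (forall w, (0 <= Y w)%E), (\int[P]_w Y w <= (C_ m)%:E)%E &
    forall w k y, Y w = y%:E -> tame U delta y (nsum g (F_ m) c k w)].
    by move=> m; have [_ _ _ nF] := gF m; exact: nF.
  have mY m : measurable_fun setT (Y_ m) by have [] := YP m.
  have Y0 m w : (0 <= Y_ m w)%E by have [_ Y0 _ _] := YP m; exact: Y0.
  have iY m : (\int[P]_w Y_ m w <= (C_ m)%:E)%E by have [] := YP m.
  have bY m w k y : Y_ m w = y%:E -> tame U delta y (nsum g (F_ m) c k w).
    by have [_ _ _ bY] := YP m; exact: bY.
  exists (fun w => \sum_(m <oo) Y_ m w)%E; split.
  + by apply: ge0_emeasurable_sum => // m w _ _; exact: Y0.
  + by move=> w; apply: nneseries_ge0 => m _ _; exact: Y0.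
  + rewrite integral_nneseries//; apply: lime_le.
      by apply: is_cvg_nneseries => m _ _; apply: integral_ge0.
    apply: nearW => N; apply: le_trans (_ : (\sum_(0 <= m < N) (C_ m)%:E <= _)%E).
      by apply: lee_sum => m _.
    by rewrite sumEFin lee_fin big_mkord.
  + move=> w k y Yy.
    have Ym m : (Y_ m w <= y%:E)%E.
      rewrite -Yy; apply: le_trans (nneseries_lim_ge m.+1 _) => //.
      rewrite big_nat_recr//= leeDr//; apply: sume_ge0 => i _; exact: Y0.
    have Yfin m : Y_ m w = (fine (Y_ m w))%:E.
      rewrite fineK// fin_numElt (lt_le_trans (ltNyr 0) (Y0 m w))/=.
      exact: le_lt_trans (Ym m) (ltry y).
    have bG N : tame U delta (\sum_(m < N) fine (Y_ m w)) (nsum g (G N) c k w).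
      elim: N => [|N IHN].
        rewrite big_ord0; have E s : nsum g (G 0%N) c k w s = 0.
          rewrite /nsum big1// => i _.
          have -> : \int[pi]_z (g z * G 0%N s z) = 0.
            under eq_Rintegral do rewrite /G big_ord0 mulr0.
            by rewrite Rintegral_cst// mul0r.
          by rewrite /G big_ord0 mulr0 subr0 mulr0.
        by split=> [t _|t t' _ _]; rewrite !E ?subr0 normr0 ?mulr0 ?mul0r.
      rewrite big_ord_recr/=; apply: tame_eq (tame_add IHN (bY N w k _ (Yfin N))) => t Ut.
      rewrite -(nsum_add _ _ _ Ut mg g1 (gG N) (gF N)); congr nsum.
      by apply/funext => s; apply/funext => z; rewrite /G big_ord_recr.
    apply: (tame_cvg (u := fun N => nsum g (G N) c k w)) => [t Ut|N].
      rewrite /nsum; apply: cvg_big => [|i _]; first exact: add_continuous.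
      apply: cvgMr; apply: cvgB.
        by apply: cvgMr; exact: FF.
      apply: (Rintegral_bounded_cvg (K := C)).
      * by move=> N; apply: measurable_funM => //; have [_ mG _ _] := gG N; exact: mG.
      * move=> N; apply: gF_bound => // z; have [_ _ tG _] := gGC N.
        exact: (tG z).1.
      * by move=> z; apply: cvgMr; exact: FF.
    apply: tame_le (bG N); rewrite -lee_fin -sumEFin -Yy.
    rewrite (eq_bigr (fun m : 'I_N => Y_ m w)); last by move=> m _; rewrite -Yfin.
    by rewrite -(big_mkord predT (fun m => Y_ m w)); apply: nneseries_lim_ge.
Qed.

Lemma mult_le B eta eta' : eta <= eta' -> mult U delta B eta -> mult U delta B eta'.
Proof.
move=> ee' [e0 Be mB]; split=> [|t Ut z|F C gF]; first exact: le_trans ee'.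
  exact: le_trans (Be t Ut z) ee'.
have [C0 _ _ _] := gF.
by apply: good_le (mB F C gF); rewrite ler_wpM2r.
Qed.

Lemma mult_eq B B' eta : (forall t, U t -> B t = B' t) -> mult U delta B eta ->
  mult U delta B' eta.
Proof.
move=> BB' [e0 Be mB]; split=> // [t Ut z|F C gF]; first by rewrite -BB'// Be.
by apply: good_eq (mB F C gF) => t Ut; rewrite BB'.
Qed.

(** The factor [b / K], of absolute value at most 1, joins the factor [g] of the noise
sums, and [K] scales the dominating variable. *)
Lemma mult_fun (b : T -> R) K : measurable_fun setT b -> (forall z, `|b z| <= K) ->
  mult U delta (fun _ z => b z) K.
Proof.
move=> mb bK; have K0 : 0 <= K by apply: le_trans (bK point).
split=> // F C gF; have [C0 mF tF nF] := gF.
have [KE|Kn0] := eqVneq K 0.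
  rewrite KE mul0r; apply: good_eq good_zero => t Ut; apply/funext => z.
  by have := bK z; rewrite KE normr_le0 => /eqP ->; rewrite mul0r.
have Kgt0 : 0 < K by rewrite lt_neqAle eq_sym Kn0.
split.
- exact: mulr_ge0.
- by move=> t Ut; apply: measurable_funM => //; exact: mF.
- by move=> z; apply: tame_le (tame_scale (b z) (tF z)); rewrite ler_wpM2r.
- move=> g c mg g1 c1.
  have mg' : measurable_fun setT (fun z => g z * (b z * K^-1)).
    by apply: measurable_funM => //; apply: measurable_funM.
  have g1' z : `|g z * (b z * K^-1)| <= 1.
    rewrite normrM -[1]mulr1 ler_pM// normrM [X in _ * X]ger0_norm ?invr_ge0//.
    by rewrite ler_pdivrMr// mul1r.
  have [Y [mY Y0 iY bY]] := nF _ c mg' g1' c1.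
  exists (fun w => K%:E * Y w)%E; split.
  + exact: measurable_funeM.
  + by move=> w; rewrite mule_ge0// lee_fin.
  + rewrite ge0_integralZl//; rewrite EFinM.
    by apply: lee_wpmul2l => //; rewrite lee_fin.
  + move=> w k y; have := Y0 w; case E : (Y w) => [a| |]//=; last first.
      by rewrite mulry gtr0_sg// mul1e.
    move=> a0 [<-].
    have := tame_scale K (bY w k a E); rewrite ger0_norm//.
    apply: tame_eq => t Ut; rewrite /nsum mulr_sumr; apply: eq_bigr => i _.
    rewrite mulrCA; congr (_ * _); rewrite mulrBr -RintegralZl//; last first.
      exact: gF_int gF mg' g1'.
    congr (_ - _); first by field.
    by apply: eq_Rintegral => z _; field.
Qed.

Lemma mult_cst (K : R) : mult U delta (fun _ _ => K) `|K|.
Proof. exact: (mult_fun (b := cst K)). Qed.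

Lemma mult_add B B' eta eta' : mult U delta B eta -> mult U delta B' eta' ->
  mult U delta (fun t z => B t z + B' t z) (eta + eta').
Proof.
move=> [e0 Be mB] [e0' Be' mB']; split.
- exact: addr_ge0.
- move=> t Ut z; apply: le_trans (ler_normD _ _) _.
  by apply: lerD; [exact: Be|exact: Be'].
- move=> F C gF; rewrite mulrDl.
  apply: good_eq (good_add (mB F C gF) (mB' F C gF)) => t Ut.
  by apply/funext => z; rewrite mulrDl.
Qed.

Lemma mult_mul B B' eta eta' : mult U delta B eta -> mult U delta B' eta' ->
  mult U delta (fun t z => B t z * B' t z) (eta * eta').
Proof.
move=> [e0 Be mB] [e0' Be' mB']; split.
- exact: mulr_ge0.
- move=> t Ut z; rewrite normrM ler_pM//; [exact: Be|exact: Be'].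
- move=> F C gF; rewrite -mulrA.
  apply: good_eq (mB _ _ (mB' F C gF)) => t Ut.
  by apply/funext => z; rewrite mulrA.
Qed.

Lemma mult_series (B_ : nat -> Theta -> T -> R) (e_ : nat -> R) B eta :
  (forall m, mult U delta (B_ m) (e_ m)) ->
  (forall N, \sum_(m < N) e_ m <= eta) ->
  (forall t z, U t -> (\sum_(m < N) B_ m t z) @[N --> \oo] --> B t z) ->
  mult U delta B eta.
Proof.
move=> mB ee BB; split.
- by have := ee 0%N; rewrite big_ord0.
- move=> t Ut z; apply: (cvg_norm_le (BB t z Ut)) => N.
  apply: le_trans (ler_norm_sum _ _ _) (le_trans _ (ee N)).
  by apply: ler_sum => i _; have [_ h _] := mB i; exact: h.
- move=> F C gF; have [C0 _ _ _] := gF.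
  apply: (good_series (F_ := fun m t z => B_ m t z * F t z) (C_ := fun m => e_ m * C)).
  + by move=> m; have [_ _ h] := mB m; exact: h.
  + by move=> N; rewrite -mulr_suml ler_wpM2r.
  + move=> t z Ut; under eq_fun do rewrite -mulr_suml.
    by apply: cvgMl; exact: BB.
Qed.

End fixed_domain.

(** The factor comes out of the noise sums, since it depends on [t] only, and the product
rule for [tame] applies: its sup is at most [delta] and its Lipschitz constant 1, each of
which contributes [delta]. *)
Lemma mult_coord (t0 : Theta) (delta : R) (j : 'I_n) : 0 < delta ->
  mult (ball t0 delta) delta (fun t _ => t 0 j - t0 0 j) (2 * delta).
Proof.
move=> d0.
have ball1 t : ball t0 delta t -> `|t 0 j - t0 0 j| <= delta.
  rewrite -ball_normE/= => h; apply: ltW; apply: le_lt_trans h.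
  by rewrite distrC; have := coord_le_norm (t0 - t) j; rewrite !mxE.
have bt t t' : `|(t 0 j - t0 0 j) - (t' 0 j - t0 0 j)| <= `|t - t'|.
  have -> : (t 0 j - t0 0 j) - (t' 0 j - t0 0 j) = t 0 j - t' 0 j by ring.
  by have := coord_le_norm (t - t') j; rewrite !mxE.
have prod h y : tame (ball t0 delta) delta y h -> 0 <= y ->
  tame (ball t0 delta) delta (2 * delta * y) (fun t => (t 0 j - t0 0 j) * h t).
  move=> [h1 h2] y0; split=> [t Ut|t t' Ut Ut'].
    rewrite normrM; have := ball1 t Ut; have := h1 t Ut.
    move=> ? ?; apply: le_trans (_ : delta * y <= _); first by rewrite ler_pM.
    by nra.
  have -> : (t 0 j - t0 0 j) * h t - (t' 0 j - t0 0 j) * h t' =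
     (t 0 j - t0 0 j) * (h t - h t') + ((t 0 j - t0 0 j) - (t' 0 j - t0 0 j)) * h t' by ring.
  apply: le_trans (_ : delta * (delta * `|h t - h t'| + `|t - t'| * y) <= _).
    rewrite ler_wpM2l ?(ltW d0)//; apply: le_trans (ler_normD _ _) _.
    apply: lerD; rewrite normrM.
      by rewrite ler_wpM2r//; exact: ball1.
    by rewrite ler_pM//; exact: h1.
  have := h2 _ _ Ut Ut'; set x := delta * `|h t - h t'|; set v := `|t - t'| => xv.
  have -> : 2 * delta * y * v = delta * (y * v + v * y) by ring.
  by rewrite ler_wpM2l ?(ltW d0)// lerD2r.
split=> [|t Ut _|F C gF].
- by rewrite mulr_ge0// ltW.
- by apply: le_trans (ball1 t Ut) _; nra.
- have [C0 mF tF nF] := gF; split.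
  + by rewrite mulr_ge0// mulr_ge0// ltW.
  + by move=> t Ut; apply: measurable_funM => //; exact: mF.
  + by move=> z; exact: prod.
  + move=> g c mg g1 c1; have [Y [mY Y0 iY bY]] := nF g c mg g1 c1.
    have D0 : 0 < 2 * delta by rewrite mulr_gt0.
    exists (fun w => (2 * delta)%:E * Y w)%E; split.
    * exact: measurable_funeM.
    * by move=> w; rewrite mule_ge0// lee_fin ltW.
    * rewrite ge0_integralZl//; last by rewrite lee_fin ltW.
      by rewrite [leRHS]EFinM; apply: lee_wpmul2l => //; rewrite lee_fin ltW.
    * move=> w k y; have := Y0 w; case E : (Y w) => [a| |]//=; last first.
        by move=> _; rewrite mulry gtr0_sg// mul1e.
      rewrite lee_fin => a0 [<-]; have := prod _ _ (bY w k a E) a0.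
      apply: tame_eq => t Ut; rewrite /nsum mulr_sumr; apply: eq_bigr => i _.
      rewrite mulrCA; congr (_ * _); rewrite mulrBr -RintegralZl//; last first.
        apply: (bounded_integrable pi (K := C)).
          by apply: measurable_funM => //; exact: mF.
        by move=> z; rewrite normrM -[C]mul1r ler_pM//; exact: (tF z).1.
      congr (_ - _); first by ring.
      by apply: eq_Rintegral => z _; ring.
Qed.

End noise_class.

(** * Real-analytic functions of one variable *)

Section analytic.
Context (R : realType).
Implicit Types (a : nat -> R) (q M s x y : R) (phi : R -> R).

Lemma geom_half_sum N : \sum_(m < N) (2^-1 : R) ^+ m <= 2.
Proof.
suff -> : \sum_(m < N) (2^-1 : R) ^+ m = 2 - 2 * 2^-1 ^+ N.
  by rewrite lerBlDr lerDl mulr_ge0// exprn_ge0// invr_ge0.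
elim: N => [|N IHN]; first by rewrite big_ord0 expr0; ring.
rewrite big_ord_recr/= IHN exprS; lra.
Qed.

Lemma geom_sum_le a q M N : (forall m, `|a m| * q ^+ m <= M) ->
  \sum_(m < N) `|a m| * (q / 2) ^+ m <= 2 * M.
Proof.
move=> aM; have M0 : 0 <= M by apply: le_trans (aM 0%N); rewrite expr0 mulr1.
apply: le_trans (_ : \sum_(m < N) M * (2^-1) ^+ m <= _).
  by apply: ler_sum => m _; rewrite exprMn mulrA ler_wpM2r// exprn_ge0// invr_ge0.
by rewrite -mulr_sumr mulrC ler_wpM2r// geom_half_sum.
Qed.

Lemma geom_cvg a q M x : 0 < q -> (forall m, `|a m| * q ^+ m <= M) -> `|x| <= q / 2 ->
  cvgn (pseries a x).
Proof.
move=> q0 aM xq; apply: normed_cvg.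
apply: nondecreasing_is_cvgn.
  by apply/nondecreasing_seqP => m; rewrite /normed_series_of /series/= big_nat_recr//= lerDl.
exists (2 * M) => _ [N _ <-]; rewrite /normed_series_of /series/= big_mkord.
apply: le_trans (geom_sum_le N aM); apply: ler_sum => m _.
rewrite normrM normrX ler_wpM2l// lerXn2r ?nnegrE//.
by rewrite divr_ge0 ?ltW.
Qed.

Lemma geom_diffs a q M : 0 < q -> (forall m, `|a m| * q ^+ m <= M) ->
  forall m, `|pseries_diffs a m| * (q / 2) ^+ m <= 2 * M / q.
Proof.
move=> q0 aM m; rewrite /pseries_diffs normrM normr_nat ler_pdivlMr//.
have M0 : 0 <= M by apply: le_trans (aM 0%N); rewrite expr0 mulr1.
have -> : m.+1%:R * `|a m.+1| * (q / 2) ^+ m * q = (`|a m.+1| * q ^+ m.+1) * (m.+1%:R / 2 ^+ m).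
  by rewrite exprMn exprVn exprS; ring.
rewrite mulrC; apply: ler_pM => //.
- by rewrite mulr_ge0// exprn_ge0// ltW.
- rewrite ler_pdivrMr ?exprn_gt0// -exprS -natrX ler_nat.
  exact: ltnW (ltn_expl _ _).
Qed.

(** The terms of the power series at half the radius of the neighbourhood are bounded,
since they tend to 0.  This Cauchy estimate is the form in which analyticity is used. *)
Lemma analytic_bounds phi s : analytic_at phi s -> exists a q M,
  [/\ 0 < q, (forall m, `|a m| * q ^+ m <= M) &
   forall y, `|y - s| < q -> pseries a (y - s) @ \oo --> phi y].
Proof.
move=> [a /nbhs_ballP[e /= e0 he]].
exists a, (e / 2).
have ball_e y : `|y - s| < e -> pseries a (y - s) @ \oo --> phi y.
  by move=> ye; apply: he; rewrite -ball_normE/= distrC.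
have e2 : 0 < e / 2 by rewrite divr_gt0.
have c1 : cvgn (pseries a (e / 2)).
  apply/cvg_ex; exists (phi (s + e / 2)).
  have := ball_e (s + e / 2); rewrite addrC addKr; apply.
  by rewrite gtr0_norm// ltr_pdivrMr// ltr_pMr// ltr1n.
have := cvg_series_cvg_0 c1 => /cvgP/cvg_seq_bounded[M [_ HM]].
exists (M + 1); split=> // [m|y ye].
  have := HM (M + 1); rewrite ltrDl => /(_ ltr01) /(_ m I) /=.
  by rewrite normrM normrX [`|e / 2|]gtr0_norm.
apply: ball_e; apply: lt_trans ye _.
by rewrite ltr_pdivrMr// ltr_pMr// ltr1n.
Qed.

(** Termwise differentiation: three successive halvings of the radius give room for the
convergence of the series and of its first two termwise derivatives. *)
Lemma analytic_derive phi s : analytic_at phi s ->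
  derivable phi s 1 /\ analytic_at (derive1 phi) s.
Proof.
move=> /analytic_bounds[a [q [M [q0 aM pa]]]].
have q2 : 0 < q / 2 by rewrite divr_gt0.
have q8 : 0 < q / 2 / 2 / 2 by rewrite !divr_gt0.
have d1 := geom_diffs q0 aM.
have d2 := geom_diffs q2 d1.
pose K := q / 2 / 2 / 2.
have NK : `|K| <= q / 2 / 2 / 2 by rewrite gtr0_norm.
have NK2 : `|K| <= q / 2 / 2 by apply: le_trans NK _; rewrite /K; lra.
have NK3 : `|K| <= q / 2 by apply: le_trans NK2 _; lra.
have D y : `|y - s| < K -> is_derive y (1 : R) phi (limn (pseries (pseries_diffs a) (y - s))).
  move=> yK.
  have D0 := @pseries_snd_diffs R a K (y - s) (geom_cvg q0 aM NK3)
    (geom_cvg q2 d1 NK2) (geom_cvg (divr_gt0 q2 (ltr0n _ 2)) d2 NK).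
  have {}D0 := D0 (lt_le_trans yK (ler_norm K)).
  have sh : is_derive y (1 : R) (fun u : R => u - s) 1.
    by apply: is_derive_eq; rewrite subr0.
  have := @is_derive1_comp R (fun x => limn (pseries a x)) (fun u => u - s) y _ _ D0 sh.
  rewrite mulr1; apply: near_eq_is_derive.
  have qK : 0 < q - K by rewrite subr_gt0 /K; lra.
  have := nbhsx_ballx y _ qK; apply: filterS => u.
  rewrite -ball_normE/= distrC => yu; apply: cvg_lim => //; apply: pa.
  rewrite -(subrK y u) -addrA (le_lt_trans (ler_normD _ _))//.
  by rewrite -(subrK K q) ltrD.
have sK : `|s - s| < K by rewrite subrr normr0.
split; first by have := D s sK; case.
exists (pseries_diffs a).
have := nbhsx_ballx s _ q8; apply: filterS => y; rewrite -ball_normE/= distrC => ys.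
have -> : (derive1 phi) y = limn (pseries (pseries_diffs a) (y - s)).
  by rewrite derive1E; exact: (@derive_val _ _ _ _ _ _ _ (D y ys)).
apply: (geom_cvg q2 d1).
by apply: ltW; apply: lt_le_trans ys _; rewrite /K; lra.
Qed.

End analytic.

(** * Composition of germs with analytic functions *)

(** Compactness as an induction principle.  The property [Q] will be an estimate on an open
set, with constants that degrade under unions. *)
Lemma compact_open_ind (T : ptopologicalType) (A : set T) (Q : set T -> Prop) :
  compact A -> Q set0 ->
  (forall U V, open U -> open V -> Q U -> Q V -> Q (U `|` V)) ->
  (forall s, A s -> exists U, [/\ open U, U s & Q U]) ->
  exists U, [/\ open U, A `<=` U & Q U].
Proof.
move=> cA Q0 QU QA.
have {}cA : cover_compact A by rewrite -compact_cover.
have [D' D'Q sub] : finite_subset_cover [set U : set T | open U /\ Q U] id A.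
  apply: cA; first by move=> U [].
  by move=> s As; have [U [oU Us QUs]] := QA s As; exists U.
have key (r : seq (set T)) : (forall U, U \in r -> open U /\ Q U) ->
    open (\bigcup_(U in [set` r]) U) /\ Q (\bigcup_(U in [set` r]) U).
  rewrite bigcup_seq; elim: r => [|V r IHr] rQ.
    by rewrite big_nil; split=> //; exact: open0.
  rewrite big_cons; have [oV QV] := rQ V (mem_head _ _).
  have [oW QW] := IHr (fun U Ur => rQ U (@mem_behead _ (V :: r) U Ur)).
  by split; [exact: openU|exact: QU].
have [oU QU'] := key (finmap.enum_fset D') (fun U UD => set_mem (D'Q U UD)).
by exists (\bigcup_(U in [set` (finmap.enum_fset D' : seq (set T))]) U).
Qed.

Section germs.
Context (R : realType) (n : nat) d dT (Omega : measurableType d)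
  (T : measurableType dT) (P : probability Omega R) (pi : probability T R)
  (Z : nat -> Omega -> T).
Hypothesis mZ : forall n, measurable_fun setT (Z n).
Hypothesis iidZ : iid_with_law P pi Z.

Notation Theta := 'rV[R]_n.
Implicit Types (F B : Theta -> T -> R) (t : Theta) (delta eps : R).

Notation mult := (mult P pi Z).
Notation good := (good P pi Z).

(** The multiplier norm of [B] on the ball of radius [delta] around [t0] tends to 0 with
[delta]. *)
Definition vanishing (t0 : Theta) B := forall eps : R, 0 < eps ->
  exists2 d0 : R, 0 < d0 & forall delta, 0 < delta -> delta <= d0 ->
  mult (ball t0 delta) delta B eps.

(** A bounded function of the sample plus a family of vanishing norm at [t0].  The word
refers to the dependence on small balls only. *)
Definition germ (t0 : Theta) B :=
  [/\ measurable_fun setT (B t0), (exists K : R, forall z, `|B t0 z| <= K) &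
     vanishing t0 (fun t z => B t z - B t0 z)].

Section at_point.
Variable t0 : Theta.

Lemma vanishing_eq B B' : (forall t z, B t z = B' t z) -> vanishing t0 B -> vanishing t0 B'.
Proof.
move=> BB' vB eps eps0; have [d0 d00 hd] := vB eps eps0; exists d0 => // delta D0 Dd.
by apply: mult_eq (hd delta D0 Dd) => t _; apply/funext => z.
Qed.

Lemma vanishing0 : vanishing t0 (fun _ _ => 0).
Proof.
move=> eps eps0; exists 1 => // delta D0 _.
by apply: mult_le (mult_cst P pi Z _ _ 0); rewrite ?normr0 ltW.
Qed.

Lemma vanishing_add B B' : vanishing t0 B -> vanishing t0 B' ->
  vanishing t0 (fun t z => B t z + B' t z).
Proof.
move=> vB vB' eps eps0; have e2 : 0 < eps / 2 by rewrite divr_gt0.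
have [d1 d10 h1] := vB _ e2; have [d2 d20 h2] := vB' _ e2.
exists (Num.min d1 d2) => [|delta D0]; first by rewrite lt_min d10.
rewrite le_min => /andP[D1 D2]; rewrite (splitr eps).
by apply: mult_add => //; [exact: h1|exact: h2].
Qed.

Lemma vanishing_mul_bounded B (b : T -> R) (K : R) : vanishing t0 B ->
  measurable_fun setT b -> (forall z, `|b z| <= K) ->
  vanishing t0 (fun t z => B t z * b z).
Proof.
move=> vB mb bK eps eps0; have K0 : 0 <= K by apply: le_trans (bK point).
have e2 : 0 < eps / (K + 1) by rewrite divr_gt0// ltr_wpDl.
have [d0 d00 hd] := vB _ e2; exists d0 => // delta D0 Dd.
apply: mult_le (mult_mul (hd delta D0 Dd) (mult_fun P pi Z _ _ mb bK)).
by rewrite mulrAC ler_pdivrMr ?ltr_wpDl// ler_wpM2l ?(ltW eps0)// lerDl.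
Qed.

Lemma vanishing_mul B B' : vanishing t0 B -> vanishing t0 B' ->
  vanishing t0 (fun t z => B t z * B' t z).
Proof.
move=> vB vB' eps eps0.
have [d1 d10 h1] := vB _ eps0; have [d2 d20 h2] := vB' _ ltr01.
exists (Num.min d1 d2) => [|delta D0]; first by rewrite lt_min d10.
rewrite le_min => /andP[D1 D2]; rewrite -(mulr1 eps).
by apply: mult_mul; [exact: h1|exact: h2].
Qed.

Lemma germ_eq B B' : (forall t z, B t z = B' t z) -> germ t0 B -> germ t0 B'.
Proof. by move=> BB'; have -> : B' = B by apply/funext => t; apply/funext => z. Qed.

Lemma germ_fun (b : T -> R) (K : R) : measurable_fun setT b -> (forall z, `|b z| <= K) ->
  germ t0 (fun _ z => b z).
Proof.
move=> mb bK; split=> //; first by exists K.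
by apply: vanishing_eq vanishing0 => t z; rewrite subrr.
Qed.

Lemma germ_coord j : germ t0 (fun t _ => t 0 j).
Proof.
split=> //; first by exists `|t0 0 j|.
move=> eps eps0; exists (eps / 2) => [|delta D0 De]; first by rewrite divr_gt0.
apply: mult_le (mult_coord P pi Z t0 j D0).
by rewrite mulrC -ler_pdivlMr.
Qed.

Lemma germ_add B B' : germ t0 B -> germ t0 B' -> germ t0 (fun t z => B t z + B' t z).
Proof.
move=> [mB [K BK] vB] [mB' [K' BK'] vB']; split.
- exact: measurable_funD.
- exists (K + K') => z; apply: le_trans (ler_normD _ _) _; exact: lerD.
- apply: vanishing_eq (vanishing_add vB vB') => t z; ring.
Qed.

(** With [b = B t0] and [b' = B' t0], the variation of the product is
[(B - b)(B' - b') + (B - b) b' + (B' - b') b]. *)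
Lemma germ_mul B B' : germ t0 B -> germ t0 B' -> germ t0 (fun t z => B t z * B' t z).
Proof.
move=> [mB [K BK] vB] [mB' [K' BK'] vB']; split.
- exact: measurable_funM.
- by exists (K * K') => z; rewrite normrM ler_pM.
- have v1 := vanishing_mul vB vB'.
  have v2 := vanishing_mul_bounded vB mB' BK'.
  have v3 := vanishing_mul_bounded vB' mB BK.
  apply: vanishing_eq (vanishing_add v1 (vanishing_add v2 v3)) => t z; ring.
Qed.

Lemma germ_sum (I : Type) (r : seq I) (B : I -> Theta -> T -> R) :
  (forall i, germ t0 (B i)) -> germ t0 (fun t z => \sum_(i <- r) B i t z).
Proof.
move=> gB; elim: r => [|i r IHr].
  apply: (@germ_eq (fun _ _ => 0)) => [t z|]; first by rewrite big_nil.
  by apply: (@germ_fun (cst 0) 0) => // z; rewrite normr0.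
by apply: germ_eq (germ_add (gB i) IHr) => t z; rewrite big_cons.
Qed.

Section composition.
Variables (phi : R -> R) (B : Theta -> T -> R).
Hypothesis aphi : forall s, analytic_at phi s.
Hypothesis gB : germ t0 B.

Let increment (E : set T) t z := \1_E z * (phi (B t z) - phi (B t0 z)).

(** On a set [E] of samples where [B t0] stays within [rho] of [s], both [B t - s]
and [B t0 - s], multiplied by the indicator of [E], have multiplier norm at most half of
a number whose powers are summable against the coefficients of [phi] at [s].  Hence the
difference of their m-th powers has norm at most [m] times the (m-1)-st power of that bound
times the norm of [B t - B t0], and summing the power series bounds the norm of
[phi (B t) - phi (B t0)] on [E] by a constant times the norm of [B t - B t0], which is as
small as desired. *)
Lemma vanishing_cell s : exists2 rho : R, 0 < rho & forall E : set T, measurable E ->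
  (forall z, E z -> `|B t0 z - s| <= rho) -> vanishing t0 (increment E).
Proof.
have [a [q [M [q0 aM pa]]]] := analytic_bounds (aphi s).
have [mB [K BK] vB] := gB.
pose rho := q / 2.
have r0 : 0 < rho by rewrite divr_gt0.
exists (rho / 4) => [|E mE Es eps eps0]; first by rewrite divr_gt0.
pose A := 2 * M.
have sumA N : \sum_(m < N) `|a m| * rho ^+ m <= A by exact: geom_sum_le.
have A0 : 0 <= A by have := sumA 0%N; rewrite big_ord0.
(* the first bound keeps [qf] in the range of the expansion, the second makes the sum of
   the series at most [eps] *)
pose e1 := Num.min (rho / 4) (eps * rho / (2 * (A + 1))).
have A1 : 0 < 2 * (A + 1) by rewrite mulr_gt0// ltr_wpDl.
have e10 : 0 < e1 by rewrite lt_min !divr_gt0// mulr_gt0.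
have [d0 d00 hd] := vB _ e10; exists d0 => // delta D0 Dd.
have mu := hd delta D0 Dd.
have mind : measurable_fun setT (\1_E : T -> R) by exact: measurable_indic.
have ind1 z : `|(\1_E z : R)| <= 1.
  by rewrite indicE; case: (_ \in _); rewrite ?normr1 ?normr0.
have mE1 := mult_fun P pi Z (ball t0 delta) delta mind ind1.
pose D (t : Theta) z := \1_E z * (B t z - B t0 z).
have mD : mult (ball t0 delta) delta D e1 by rewrite -[e1]mul1r; exact: mult_mul.
pose q0f z : R := \1_E z * (B t0 z - s).
have mq0f : measurable_fun setT q0f.
  by apply: measurable_funM => //; apply: measurable_funB => //; exact: measurable_cst.
have q0b z : `|q0f z| <= rho / 4.
  rewrite /q0f indicE; case: (boolP (z \in E)) => [/set_mem Ez|_].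
    by rewrite mul1r Es.
  by rewrite mul0r normr0 divr_ge0// ltW.
have mq0 := mult_fun P pi Z (ball t0 delta) delta mq0f q0b.
pose qf t z := D t z + q0f z.
have e1r : e1 <= rho / 4 by rewrite ge_min lexx.
have mq : mult (ball t0 delta) delta qf (rho / 2).
  apply: mult_le (mult_add D0 mD mq0); move: e1r; lra.
have mq0' : mult (ball t0 delta) delta (fun _ z => q0f z) (rho / 2).
  apply: mult_le mq0; move: r0; lra.
have mpow m : mult (ball t0 delta) delta (fun _ z => q0f z ^+ m) ((rho / 2) ^+ m).
  elim: m => [|m IHm].
    rewrite expr0; apply: mult_le (mult_cst P pi Z _ _ 1); first by rewrite normr1.
  rewrite exprS; apply: mult_eq (mult_mul mq0' IHm) => t _.
  by apply/funext => z; rewrite exprS.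
pose e2 := 2 / rho * e1.
have mdiff m : mult (ball t0 delta) delta (fun t z => qf t z ^+ m - q0f z ^+ m)
    (m%:R * (rho / 2) ^+ m * e2).
  elim: m => [|m IHm].
    rewrite !mul0r; apply: mult_le (_ : mult _ _ _ `|0|); first by rewrite normr0.
    apply: mult_eq (mult_cst P pi Z (ball t0 delta) delta 0) => t _.
    by apply/funext => z; rewrite !expr0 subrr.
  have := mult_add D0 (mult_mul mq IHm) (mult_mul mD (mpow m)).
  have -> : rho / 2 * (m%:R * (rho / 2) ^+ m * e2) + e1 * (rho / 2) ^+ m =
            m.+1%:R * (rho / 2) ^+ m.+1 * e2.
    rewrite -[m.+1]addn1 natrD addn1 exprS /e2; set x := _ ^+ m; field.
    by rewrite gt_eqF.
  apply: mult_eq => t _; apply/funext => z.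
  by rewrite !exprS /qf; ring.
have mterm m : mult (ball t0 delta) delta (fun t z => a m * (qf t z ^+ m - q0f z ^+ m))
    (`|a m| * rho ^+ m * e2).
  rewrite -mulrA; apply: mult_mul; first exact: mult_cst.
  apply: mult_le (mdiff m); rewrite ler_wpM2r//.
    by rewrite mulr_ge0 ?divr_ge0 ?ltW.
  rewrite exprMn mulrCA -[leRHS]mulr1 ler_wpM2l ?exprn_ge0 ?(ltW r0)//.
  by rewrite exprVn ler_pdivrMr ?exprn_gt0// mul1r -natrX ler_nat ltnW// ltn_expl.
apply: (mult_series D0 mterm).
- move=> N; rewrite -mulr_suml.
  apply: le_trans (_ : A * e2 <= _).
    by rewrite ler_wpM2r// mulr_ge0 ?divr_ge0 ?ltW.
  have : e1 <= eps * rho / (2 * (A + 1)) by rewrite ge_min lexx orbT.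
  rewrite ler_pdivlMr// => h.
  have -> : A * e2 = A * (2 * e1) / rho by rewrite /e2; ring.
  rewrite ler_pdivrMr//; move: h e10; nra.
- move=> t z Ut; rewrite /increment indicE; case: (boolP (z \in E)) => Ez.
    have qfE : qf t z = B t z - s by rewrite /qf /D /q0f indicE Ez !mul1r; ring.
    have q0E : q0f z = B t0 z - s by rewrite /q0f indicE Ez mul1r.
    have : pseries a (B t z - s) @ \oo --> phi (B t z).
      apply: pa; rewrite -qfE; have [_ h _] := mq.
      apply: le_lt_trans (h t Ut z) _; rewrite /rho; move: q0; lra.
    have : pseries a (B t0 z - s) @ \oo --> phi (B t0 z).
      apply: pa; rewrite -q0E.
      apply: le_lt_trans (q0b z) _; rewrite /rho; move: q0; lra.
    move=> c2 c1; rewrite mul1r.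
    rewrite (_ : (fun N => _) = (fun N => pseries a (B t z - s) N - pseries a (B t0 z - s) N)).
      exact: cvgB.
    apply/funext => N; rewrite /pseries /series /= !big_mkord -sumrB.
    by apply: eq_bigr => m _; rewrite qfE q0E mulrBr.
  have qf0 : qf t z = 0 by rewrite /qf /D /q0f indicE (negbTE Ez) !mul0r addr0.
  have q00 : q0f z = 0 by rewrite /q0f indicE (negbTE Ez) !mul0r.
  rewrite mul0r qf0 q00; under eq_fun do under eq_bigr do rewrite subrr mulr0.
  by under eq_fun do rewrite big1//; exact: cvg_cst.
Qed.

(** The values of [B t0] fill part of a compact interval, which finitely many intervals
of [vanishing_cell] cover; the samples are split into finitely many cells accordingly. *)
Lemma germ_comp : germ t0 (fun t z => phi (B t z)).
Proof.
have [mB [K BK] vB] := gB.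
have cphi : continuous phi.
  move=> s; apply: differentiable_continuous; apply/derivable1_diffP.
  exact: (analytic_derive (aphi s)).1.
(* the cells are arbitrary measurable sets of samples that [B t0] maps into [I], so that
   cells of a union can be cut into disjoint ones *)
pose Q (I : set R) := forall E : set T, measurable E ->
  (forall z, E z -> I (B t0 z)) -> vanishing t0 (increment E).
have [U [oU KU QU]] : exists U, [/\ open U, `[- K, K]%classic `<=` U & Q U].
  apply: compact_open_ind.
  - exact: segment_compact.
  - move=> E mE E0; apply: vanishing_eq vanishing0 => t z.
    rewrite /increment indicE; case: (boolP (z \in E)) => [/set_mem /E0//|_].
    by rewrite mul0r.
  - move=> U V oU oV QU QV E mE EUV.
    have mU : measurable (B t0 @^-1` U).
      by rewrite -[X in measurable X]setTI; apply: mB => //; exact: open_measurable.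
    have m1 : measurable (E `&` B t0 @^-1` U) by exact: measurableI.
    have m2 : measurable (E `\` B t0 @^-1` U) by exact: measurableD.
    have v1 := QU _ m1 (fun z h => h.2).
    have v2 : vanishing t0 (increment (E `\` B t0 @^-1` U)).
      by apply: QV => // z [/EUV[]].
    apply: vanishing_eq (vanishing_add v1 v2) => t z.
    rewrite /increment -mulrDl; congr (_ * _).
    rewrite !indicE in_setI in_setD.
    by case: (_ \in E); case: (_ \in _ @^-1` _) => /=; rewrite ?addr0 ?add0r.
  - move=> s _; have [rho rho0 h] := vanishing_cell s.
    exists (ball s rho); split; [exact: ball_open|exact: ballxx|].
    move=> E mE Es; apply: h => // z Ez.
    by have := Es z Ez; rewrite -ball_normE/= distrC => /ltW.
have BK' z : `[- K, K]%classic (B t0 z) by rewrite /= in_itv/= -ler_norml.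
split.
- apply: (measurableT_comp _ mB); exact: continuous_measurable_fun.
- have [M [_ HM]] : bounded_set (phi @` `[- K, K]%classic).
    apply: compact_bounded; apply: continuous_compact; last exact: segment_compact.
    exact: continuous_subspaceT.
  exists (M + 1) => z; apply: HM; first by rewrite ltrDl.
  by exists (B t0 z).
- have := QU setT measurableT (fun z _ => KU _ (BK' z)).
  apply: vanishing_eq => t z; rewrite /increment indicE.
  by rewrite mem_set// mul1r.
Qed.

End composition.

(** A germ multiplies the constant family 1, whose noise is that of
[kolmogorov_maximal]. *)
Lemma germ_good B : germ t0 B -> exists delta C : R, 0 < delta /\ good (ball t0 delta) delta B C.
Proof.
move=> [mB [K BK] vB]; have [d0 d00 hd] := vB 1 ltr01.
have m1 := hd d0 d00 (lexx _).
have [_ _ m2] := mult_add d00 m1 (mult_fun P pi Z (ball t0 d0) d0 mB BK).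
have g1 := m2 _ _ (good_one mZ iidZ (ball t0 d0) d0).
exists d0, ((1 + K) * 18); split=> //.
apply: good_eq g1 => t _; apply/funext => z; rewrite mulr1; ring.
Qed.

End at_point.
End germs.

(** * From germs to compact sets *)

Lemma tail_small (R : realType) (u : nat -> R) (e : R) : (forall i, 0 <= u i) ->
  (\sum_(0 <= i <oo) (u i)%:E < +oo)%E -> 0 < e ->
  exists m, forall k, \sum_(m <= i < k) u i <= e.
Proof.
move=> u0 su e0.
have c : cvgn (series u).
  apply: nondecreasing_is_cvgn.
    by apply/nondecreasing_seqP => k; rewrite /series/= big_nat_recr//= lerDl.
  exists (fine (\sum_(0 <= i <oo) (u i)%:E)%E) => _ [k _ <-].
  rewrite -lee_fin fineK; last first.
    by rewrite ge0_fin_numE//; apply: nneseries_ge0 => i _ _; rewrite lee_fin.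
  rewrite /series/= -sumEFin; apply: nneseries_lim_ge => i _ _; by rewrite lee_fin.
have nd : nondecreasing_seq (series u).
  by apply/nondecreasing_seqP => k; rewrite /series/= big_nat_recr//= lerDl.
have /cvgrPdist_le/(_ _ e0)[m _ hm] := c.
exists m => k; have [km|mk] := leqP k m; first by rewrite big_geq// ltW.
have := nondecreasing_cvgn_le nd c k.
have := le_trans (ler_norm _) (hm m (leqnn m)).
rewrite /series/= (big_cat_nat (leq0n m) (ltnW mk))//=; set l := limn _; lra.
Qed.

Section gluing.
Context (R : realType) (n : nat) d dT (Omega : measurableType d)
  (T : measurableType dT) (P : probability Omega R) (pi : probability T R)
  (Z : nat -> Omega -> T).
Hypothesis mZ : forall n, measurable_fun setT (Z n).
Hypothesis iidZ : iid_with_law P pi Z.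

Notation Theta := 'rV[R]_n.
Implicit Types (F : Theta -> T -> R) (t : Theta) (delta lambda C y : R).

(** Unlike [tame], this condition compares [t] in [U] with any [t'] within [lambda], which
need not be in [U]; in this form it passes to unions. *)
Definition locally_tame (U : set Theta) lambda C (h : Theta -> R) :=
  (forall t, U t -> `|h t| <= C) /\
  (forall t t', U t -> `|t - t'| < lambda -> lambda * `|h t - h t'| <= C * `|t - t'|).

Lemma locally_tame_ball t0 delta C h : 0 < delta ->
  tame (ball t0 delta) delta C h -> locally_tame (ball t0 (delta / 2)) (delta / 2) C h.
Proof.
move=> d0 [h1 h2]; have d2 : delta / 2 <= delta by lra.
split=> [t Ut|t t' Ut tt']; first by apply: h1; exact: le_ball Ut.
apply: le_trans (h2 t t' _ _).
- by rewrite ler_wpM2r.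
- exact: le_ball Ut.
- rewrite (splitr delta); apply: ball_triangle Ut _.
  by rewrite -ball_normE.
Qed.

Lemma locally_tameU U V l1 l2 C1 C2 h : 0 <= C1 -> 0 <= C2 ->
  locally_tame U l1 C1 h -> locally_tame V l2 C2 h ->
  locally_tame (U `|` V) (Num.min l1 l2) (C1 + C2) h.
Proof.
move=> C10 C20 [h1 h2] [k1 k2]; split=> [t [Ut|Vt]|t t' + ].
- by apply: le_trans (h1 t Ut) _; rewrite lerDl.
- by apply: le_trans (k1 t Vt) _; rewrite lerDr.
- rewrite lt_min => UV /andP[t1 t2]; case: UV => [Ut|Vt].
    apply: le_trans (le_trans (h2 t t' Ut t1) _); last by rewrite ler_wpM2r// lerDl.
    by rewrite ler_wpM2r// ge_min lexx.
  apply: le_trans (le_trans (k2 t t' Vt t2) _); last by rewrite ler_wpM2r// lerDr.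
  by rewrite ler_wpM2r// ge_min lexx orbT.
Qed.

(** At distance at least [lambda], the sup bound gives the Lipschitz bound. *)
Lemma locally_tame_tame U Q lambda C h : 0 < lambda -> Q `<=` U ->
  locally_tame U lambda C h -> tame Q (lambda / 2) C h.
Proof.
move=> l0 QU [h1 h2]; split=> [t /QU Ut|t t' /QU Ut /QU Ut']; first exact: h1.
have C0 : 0 <= C by apply: le_trans (h1 t Ut).
have [far|near] := leP lambda `|t - t'|.
  apply: le_trans (_ : C * lambda <= _); last by rewrite ler_wpM2l.
  have hh : `|h t - h t'| <= 2 * C.
    apply: le_trans (ler_normB _ _) _.
    by have := h1 _ Ut; have := h1 _ Ut'; lra.
  have -> : C * lambda = lambda / 2 * (2 * C) by field.
  by rewrite ler_wpM2l// divr_ge0// ltW.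
apply: le_trans (h2 _ _ Ut near).
by rewrite ler_wpM2r//; lra.
Qed.

(** The bounds on the balls of a finite cover are combined by adding the constants and the
dominating variables, the Lipschitz estimates being stated locally meanwhile. *)
Lemma good_compact (Q : set Theta) F : compact Q ->
  (forall t0, Q t0 -> germ P pi Z t0 F) ->
  exists delta C, 0 < delta /\ good P pi Z Q delta F C.
Proof.
move=> cQ gF.
pose lg (U : set Theta) := exists (lambda C : R), [/\ 0 < lambda, 0 <= C,
  (forall t, U t -> measurable_fun setT (F t)),
  (forall z, locally_tame U lambda C (F ^~ z)) &
  forall (g : T -> R) (c : nat -> R), measurable_fun setT g -> (forall z, `|g z| <= 1) ->
  (forall k, \sum_(i < k) c i ^+ 2 <= 1) ->
  exists Y : Omega -> \bar R,
  [/\ measurable_fun setT Y, (forall w, (0 <= Y w)%E), (\int[P]_w Y w <= C%:E)%E &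
    forall w k y, Y w = y%:E -> locally_tame U lambda y (nsum pi Z g F c k w)]].
have [U [oU QU]] : exists U, [/\ open U, Q `<=` U & lg U].
  apply: compact_open_ind cQ _ _ _.
  - exists 1, 0; split=> // g c _ _ _; exists (cst 0%E); split=> //.
    by rewrite integral0.
  - move=> U V oU oV [l1 [C1 [l10 C10 m1 t1 n1]]] [l2 [C2 [l20 C20 m2 t2 n2]]].
    exists (Num.min l1 l2), (C1 + C2); split.
    + by rewrite lt_min l10.
    + exact: addr_ge0.
    + by move=> t [Ut|Vt]; [exact: m1|exact: m2].
    + by move=> z; exact: locally_tameU.
    + move=> g c mg g1 c1.
      have [Y1 [mY1 Y10 iY1 b1]] := n1 g c mg g1 c1.
      have [Y2 [mY2 Y20 iY2 b2]] := n2 g c mg g1 c1.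
      exists (fun w => Y1 w + Y2 w)%E; split.
      * exact: emeasurable_funD.
      * by move=> w; exact: adde_ge0.
      * by rewrite ge0_integralD// EFinD; exact: leeD.
      * move=> w k y; have := Y10 w; have := Y20 w.
        case E1 : (Y1 w) => [y1| |]//; case E2 : (Y2 w) => [y2| |]//=.
        rewrite !lee_fin => y20 y10 [<-].
        by apply: locally_tameU => //; [exact: b1|exact: b2].
  - move=> t0 Qt0; have [delta [C [d0 gd]]] := germ_good mZ iidZ (gF t0 Qt0).
    have d2 : 0 < delta / 2 by rewrite divr_gt0.
    have dd : delta / 2 <= delta by lra.
    exists (ball t0 (delta / 2)); split; [exact: ball_open|exact: ballxx|].
    have [C0 mF tF nF] := gd.
    exists (delta / 2), C; split=> //.
    + by move=> t Ut; apply: mF; exact: le_ball Ut.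
    + by move=> z; apply: locally_tame_ball.
    + move=> g c mg g1 c1; have [Y [mY Y0 iY bY]] := nF g c mg g1 c1.
      exists Y; split=> // w k y Yy; apply: locally_tame_ball => //; exact: bY.
move=> [l [C [l0 C0 mF tF nF]]]; exists (l / 2), C; split; first by rewrite divr_gt0.
split=> //.
- by move=> t /QU; exact: mF.
- by move=> z; exact: locally_tame_tame l0 QU (tF z).
- move=> g c mg g1 c1; have [Y [mY Y0 iY bY]] := nF g c mg g1 c1.
  by exists Y; split=> // w k y Yy; exact: locally_tame_tame l0 QU (bY w k y Yy).
Qed.

(** * Almost sure decay of the noise along a moving parameter *)

Definition noise F (w : Omega) (i : nat) t : R := F t (Z i w) - \int[pi]_z F t z.

(** Choose [N j] such that the squares of [c] beyond [N j] sum to at most [16^-j].  The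
weights [4^j c], cut off below [N j], have square sum at most 1, so their noise sums are
dominated by [Y j] of mean at most [C].  The sum [W] of the [2^-j Y j] is integrable,
hence almost surely finite, and [Y j <= 2^j W]; undoing the weights, blocks beyond [N j]
are of size at most [2 * 4^-j * 2^j W], which tends to 0. *)
Lemma uniform_noise (Q : set Theta) F (c : nat -> R) :
  compact Q -> (forall t0, Q t0 -> germ P pi Z t0 F) ->
  (\sum_(0 <= i <oo) (c i ^+ 2)%:E < +oo)%E ->
  {ae P, forall w, forall e : R, 0 < e -> exists n0, forall m k, (n0 <= m)%N ->
     tame Q 1 e (fun t => \sum_(m <= i < k) c i * noise F w i t)}.
Proof.
move=> cQ gF sc.
have [delta [C [d0 [C0 mF tF nF]]]] := good_compact cQ gF.
have /choice[N hN] : forall j : nat, exists N, forall k,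
    \sum_(N <= i < k) c i ^+ 2 <= (4^-1 ^+ j) ^+ 2.
  move=> j; apply: (tail_small _ sc) => [i|]; first exact: sqr_ge0.
  by do 2 apply: exprn_gt0; rewrite invr_gt0.
pose cj j i := if (N j <= i)%N then 4 ^+ j * c i else 0.
have cj1 j k : \sum_(i < k) cj j i ^+ 2 <= 1.
  rewrite -(big_mkord predT (fun i => cj j i ^+ 2)).
  have [kN|Nk] := leqP k (N j).
    rewrite big_nat_cond big1// => i /andP[/andP[_ ik] _]; rewrite /cj leqNgt (leq_trans ik kN)/=.
    by rewrite expr0n.
  rewrite (big_cat_nat (leq0n (N j)) (ltnW Nk))/= big_nat_cond big1 ?add0r; last first.
    move=> i /andP[/andP[_ ik] _]; rewrite /cj leqNgt ik/=.
    by rewrite expr0n.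
  rewrite (eq_big_nat _ _ (F2 := fun i => (4 ^+ j) ^+ 2 * c i ^+ 2)); last first.
    by move=> i /andP[Ni _]; rewrite /cj Ni exprMn.
  rewrite -mulr_sumr; apply: le_trans (ler_wpM2l _ (hN j k)) _.
    by rewrite sqr_ge0.
  by rewrite -exprMn -exprMn divff// !expr1n.
have /choice[Y YP] : forall j, exists Y : Omega -> \bar R,
  [/\ measurable_fun setT Y, (forall w, (0 <= Y w)%E), (\int[P]_w Y w <= C%:E)%E &
    forall w k y, Y w = y%:E -> tame Q delta y (nsum pi Z (cst 1) F (cj j) k w)].
  move=> j; apply: nF => [|z|k]; last exact: cj1.
    exact: measurable_cst.
  by rewrite normr1.
pose V j w := ((2^-1 ^+ j)%:E * Y j w)%E.
have mV j : measurable_fun setT (V j).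
  by apply: measurable_funeM; have [] := YP j.
have V0 j w : (0 <= V j w)%E.
  by rewrite mule_ge0 ?lee_fin ?exprn_ge0 ?invr_ge0//; have [_ h _ _] := YP j; exact: h.
pose W w := (\sum_(0 <= j <oo) V j w)%E.
have mW : measurable_fun setT W.
  by apply: ge0_emeasurable_sum => // j w _ _; exact: V0.
have W0 w : (0 <= W w)%E by apply: nneseries_ge0 => j _ _.
have iW : P.-integrable setT W.
  apply/integrableP; split=> //.
  under eq_integral do rewrite gee0_abs//.
  apply: (@le_lt_trans _ _ (2 * C)%:E); last by rewrite ltry.
  rewrite integral_nneseries//; apply: lime_le.
    by apply: is_cvg_nneseries => j _ _; apply: integral_ge0.
  apply: nearW => k.
  apply: (@le_trans _ _ (\sum_(0 <= j < k) (2^-1 ^+ j * C)%:E)%E).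
    apply: lee_sum => j _; have [mYj Y0 iY _] := YP j.
    have p0 : (0 <= (2^-1 ^+ j)%:E :> \bar R)%E by rewrite lee_fin exprn_ge0// invr_ge0.
    rewrite /V ge0_integralZl//.
    by rewrite [leRHS]EFinM; apply: lee_wpmul2l.
  rewrite sumEFin lee_fin big_mkord -mulr_suml ler_wpM2r//; exact: geom_half_sum.
have := integrable_ae measurableT iW.
apply: filterS => w /(_ I) Wfin e e0.
pose W' := fine (W w).
have W'0 : 0 <= W' by rewrite fine_ge0.
have Vj j : (V j w <= W'%:E)%E.
  rewrite fineK//; apply: le_trans (nneseries_lim_ge j.+1 _) => //.
  by rewrite big_nat_recr//= leeDr//; apply: sume_ge0.
have Yj j : exists2 y, Y j w = y%:E & 0 <= y /\ y <= 2 ^+ j * W'.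
  have [_ Y0 _ _] := YP j; have := Vj j; have := Y0 w; rewrite /V.
  case: (Y j w) => [y| |]//=; last first.
    by rewrite mulry gtr0_sg ?exprn_gt0 ?invr_gt0// mul1e leye_eq.
  rewrite -EFinM !lee_fin => y0 yW; exists y => //; split=> //.
  by move: yW; rewrite exprVn mulrC ler_pdivrMr ?exprn_gt0// mulrC.
(* [D] converts the Lipschitz seminorm scaled by [delta] into the unscaled one *)
pose D := 1 + delta^-1.
have D0 : 0 < D by rewrite addr_gt0// invr_gt0.
have [j hj] : exists j, 2 * W' * D * 2^-1 ^+ j <= e.
  have := cvg_geometric (2 * W' * D) (_ : `|2^-1 : R| < 1).
  rewrite gtr0_norm ?invr_gt0// invf_lt1// ltr1n => /(_ isT).
  move=> /cvgr0_norm_le /(_ _ e0)[j _ /(_ j (leqnn j))] /=.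
  by move=> h; exists j; apply: le_trans (ler_norm _) h.
exists (N j) => m k Nm.
have [y Yy [y0 yW]] := Yj j.
have [_ _ _ /(_ w _ _ Yy) tY] := YP j.
have key : tame Q delta (2 * 4^-1 ^+ j * y) (fun t => \sum_(m <= i < k) c i * noise F w i t).
  have [km|mk] := leqP k m.
    split=> [t Qt|t t' _ _]; rewrite !big_geq// ?subrr ?normr0 ?mulr0 !mulr_ge0//;
      by rewrite exprn_ge0 ?invr_ge0.
  have t1 := tame_scale (4^-1 ^+ j) (tY k).
  have t2 := tame_scale (- 4^-1 ^+ j) (tY m).
  have := tame_add d0 t1 t2.
  rewrite normrN [`|4^-1 ^+ j|]ger0_norm ?exprn_ge0 ?invr_ge0//.
  have -> : 4^-1 ^+ j * y + 4^-1 ^+ j * y = 2 * 4^-1 ^+ j * y by ring.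
  apply: tame_eq => t Qt; rewrite /nsum.
  rewrite mulNr -mulrBr.
  rewrite -2!(big_mkord predT (fun i => cj j i * (cst 1 (Z i w) * F t (Z i w) - \int[pi]_z (cst 1 z * F t z)))).
  rewrite (big_cat_nat (leq0n m) (ltnW mk))/= [X in _ * (X - _)]addrC addrK.
  rewrite mulr_sumr; apply: eq_big_nat => i /andP[mi ik].
  rewrite /cj (leq_trans Nm mi) mul1r.
  have -> : \int[pi]_z (1 * F t z) = \int[pi]_z F t z by apply: eq_Rintegral => z _; rewrite mul1r.
  rewrite mulrA mulrA -exprMn mulVf// expr1n mul1r//.
have yb : 2 * 4^-1 ^+ j * y <= 2 * W' * 2^-1 ^+ j.
  apply: le_trans (_ : 2 * 4^-1 ^+ j * (2 ^+ j * W') <= _).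
    by rewrite ler_wpM2l// mulr_ge0// exprn_ge0// invr_ge0.
  have -> : 2 * 4^-1 ^+ j * (2 ^+ j * W') = 2 * W' * (4^-1 * 2) ^+ j by rewrite exprMn; ring.
  by have -> : 4^-1 * 2 = 2^-1 :> R by field.
have [k1 k2] := key; split=> [t Qt|t t' Qt Qt'].
  apply: le_trans (k1 t Qt) (le_trans yb (le_trans _ hj)).
  rewrite [leRHS]mulrAC -[leLHS]mulr1.
  apply: ler_wpM2l; first by rewrite !mulr_ge0// exprn_ge0// invr_ge0.
  by rewrite /D lerDl invr_ge0 ltW.
rewrite mul1r -(ler_pM2l d0); apply: le_trans (k2 t t' Qt Qt') _.
rewrite mulrA ler_wpM2r//; apply: le_trans yb _.
apply: le_trans (ler_wpM2l (ltW d0) hj).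
rewrite [leRHS](_ : _ = (2 * W' * 2^-1 ^+ j) * (delta * D)); last by ring.
rewrite -[leLHS]mulr1.
apply: ler_wpM2l; first by rewrite !mulr_ge0// exprn_ge0// invr_ge0.
by rewrite /D mulrDr mulr1 mulfV ?gt_eqF// lerDr ltW.
Qed.

End gluing.

(** Summation by parts: the differences of the nonincreasing weights sum to
[b m - b k], and the boundary term costs [b k]. *)
Lemma abel_nonincr (R : realFieldType) (a b : nat -> R) (E : R) (m : nat) :
  (forall i, (m <= i)%N -> b i.+1 <= b i) -> (forall i, (m <= i)%N -> 0 <= b i) ->
  forall k, (m <= k)%N -> 
  (forall j, (m <= j <= k)%N -> `|\sum_(m <= i < j) a i| <= E) ->
  `|\sum_(m <= i < k) b i * a i| <= E * b m.
Proof.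
move=> bnd b0.
suff key k : (m <= k)%N -> (forall j, (m <= j <= k)%N -> `|\sum_(m <= i < j) a i| <= E) ->
    `|\sum_(m <= i < k) b i * a i - b k * \sum_(m <= i < k) a i| <= E * (b m - b k).
  move=> k mk aE; have := key k mk aE.
  have : `|b k * \sum_(m <= i < k) a i| <= b k * E.
    by rewrite normrM ger0_norm ?b0// ler_wpM2l ?b0// aE// mk leqnn.
  set X := \sum_(m <= i < k) b i * a i; set Y := b k * _ => hY hX.
  rewrite -(subrK Y X); apply: le_trans (ler_normD _ _) _; lra.
elim: k => [|k IHk].
  by rewrite leqn0 => /eqP -> _; rewrite !big_geq// mulr0 !subrr normr0 mulr0.
rewrite leq_eqVlt => /predU1P[->|mk] aE.
  by rewrite !big_geq// mulr0 !subrr normr0 mulr0.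
rewrite !big_nat_recr//=; set X := \sum_(m <= i < k) b i * a i.
set S := \sum_(m <= i < k) a i.
have {}IHk : `|X - b k * S| <= E * (b m - b k).
  by apply: IHk => // j /andP[mj jk]; apply: aE; rewrite mj leqW.
have aS : `|S + a k| <= E.
  by have := aE k.+1; rewrite big_nat_recr//= leqnn andbT; apply; exact: leqW.
have -> : X + b k * a k - b k.+1 * (S + a k) = (X - b k * S) + (b k - b k.+1) * (S + a k) by ring.
apply: le_trans (ler_normD _ _) _.
rewrite normrM [`|b k - _|]ger0_norm ?subr_ge0 ?bnd//.
have : (b k - b k.+1) * `|S + a k| <= (b k - b k.+1) * E.
  by rewrite ler_wpM2l// subr_ge0 bnd.
lra.
Qed.

(** Replace [th i] by the starting point one step at a time, from the end of the block:
moving the parameter of the tail from [th p] to [th p.+1] costs the Lipschitz constant [e]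
of that tail times [K * al p]. *)
Lemma moving_sum_le (R : realType) (n : nat) (Q : set 'rV[R]_n) (e K : R)
  (X : nat -> 'rV[R]_n -> R) (th : nat -> 'rV[R]_n) (al : nat -> R) (m k : nat) :
  (m <= k)%N -> 0 <= e -> 0 <= K -> (forall i, 0 <= al i) ->
  (forall i, Q (th i)) ->
  (forall i, (m <= i)%N -> `|th i.+1 - th i| <= K * al i) ->
  (forall j, (m <= j <= k)%N -> tame Q 1 e (fun t => \sum_(j <= i < k) X i t)) ->
  `|\sum_(m <= i < k) X i (th i)| <= e * (1 + K * \sum_(m <= i < k) al i).
Proof.
move=> mk e0 K0 al0 Qth dth tX.
suff key j : (m + j <= k)%N ->
   `|\sum_(k - j <= i < k) X i (th i) - \sum_(k - j <= i < k) X i (th (k - j)%N)|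
     <= e * K * \sum_(k - j <= i < k) al i.
  have := key (k - m)%N; rewrite subnKC// subKn// => /(_ (leqnn _)).
  have := (tX m _).1 (th m) (Qth m); rewrite leqnn mk => /(_ isT).
  set A := \sum_(m <= i < k) X i (th i); set B := \sum_(m <= i < k) X i (th m) => hB hA.
  rewrite -(subrK B A); apply: le_trans (ler_normD _ _) _; lra.
elim: j => [|j IHj].
  by rewrite addn0 subn0 => _; rewrite !big_geq// subrr normr0 mulr0.
rewrite addnS => mjk; have {}IHj := IHj (ltnW mjk).
have jk : (j < k)%N by apply: leq_ltn_trans mjk; exact: leq_addl.
set p := (k - j.+1)%N; have pE : (k - j)%N = p.+1 by rewrite /p subnSK.
have mp : (m <= p)%N by rewrite /p leq_subRL// addSn addnC.
have pk : (p < k)%N by rewrite -pE leq_subr.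
rewrite pE in IHj; rewrite ![\sum_(p <= i < k) _]big_ltn//.
have := (tX p.+1 _).2 (th p.+1) (th p) (Qth _) (Qth _).
rewrite pk (leq_trans mp (leqnSn p)) mul1r => /(_ isT).
have := ler_wpM2l e0 (dth p mp).
move: IHj; set A := \sum_(p.+1 <= i < k) X i (th i).
set B := \sum_(p.+1 <= i < k) X i (th p.+1); set C := \sum_(p.+1 <= i < k) X i (th p).
set S := \sum_(p.+1 <= i < k) al i => hA h1 h2.
have -> : X p (th p) + A - (X p (th p) + C) = (A - B) + (B - C) by ring.
apply: le_trans (ler_normD _ _) _; lra.
Qed.

(** * Comparison curves for the rate of descent *)

Section powers.
Context (R : realType).
Implicit Types (x y T s t c r rho mu M b : R).

Lemma powRD_gt0 x r s : 0 < x -> x `^ (r + s) = x `^ r * x `^ s.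
Proof. by move=> x0; rewrite powRD// (gt_eqF x0) implybT. Qed.

Lemma powR_decr x y r : 0 < x -> x <= y -> 0 <= r -> y `^ (- r) <= x `^ (- r).
Proof.
move=> x0 xy r0; have y0 := lt_le_trans x0 xy.
rewrite !powRN lef_pV2 ?posrE ?powR_gt0//.
by apply: ge0_ler_powR => //; rewrite nnegrE ltW.
Qed.

Lemma powR_le_exp T r s : 1 <= T -> r <= s -> T `^ (- s) <= T `^ (- r).
Proof. by move=> T1 rs; apply: ler_powR => //; rewrite lerN2. Qed.

Lemma powR_small c r : 0 < c -> 0 < r ->
  exists2 T0, 0 < T0 & forall T, T0 <= T -> T `^ (- r) <= c.
Proof.
move=> c0 r0; exists (c `^ (- r^-1)) => [|T hT]; first exact: powR_gt0.
apply: le_trans (powR_decr _ hT (ltW r0)) _; first exact: powR_gt0.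
by rewrite -powRrM mulrNN mulVf ?gt_eqF// powRr1// ltW.
Qed.

(** Bernoulli's inequality for a negative exponent, from [1 - x <= exp (- x)] and
[ln (1 + x) <= x]. *)
Lemma powR_shift_ge T s t r : 0 < T -> 0 <= s -> s <= t -> 0 <= r ->
  T `^ (- r) * (1 - r * t / T) <= (T + s) `^ (- r).
Proof.
move=> T0 s0 st r0.
have -> : T + s = T * (1 + s / T) by rewrite mulrDr mulr1 mulrCA mulfV ?gt_eqF// mulr1.
have sT : 0 <= s / T by rewrite divr_ge0// ltW.
have y0 : 0 < 1 + s / T by rewrite ltr_pwDl.
rewrite powRM ?(ltW T0) ?(ltW y0)// ler_wpM2l ?powR_ge0//.
rewrite {1}/powR gt_eqF//.
apply: le_trans (expR_ge1Dx _).
rewrite lerD2l mulNr lerN2 -mulrA ler_wpM2l//.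
apply: (le_trans (le_ln1Dx _)); first by apply: lt_le_trans sT; rewrite ltrN10.
by rewrite ler_wpM2r// invr_ge0 ltW.
Qed.

(** Over a time at most [t], the curve [T |-> c T^(-mu rho)] loses at most a quarter of
the decrease [b (value / 2M)^(2/mu)] that the Lojasiewicz inequality forces at half its
height, and at most a quarter of its value.  The first condition compares
[T^(-mu rho - 1)] with [T^(-2 rho)], hence amounts to [rho (2 - mu) <= 1], with
large [c] in case of equality. *)
Definition admissible b M mu t c0 rho := exists2 T0, 1 <= T0 & forall c T s,
  c0 <= c -> T0 <= T -> 0 <= s -> s <= t ->
  c * T `^ (- (mu * rho)) - c * (T + s) `^ (- (mu * rho)) <=
    b / 4 * ((c * T `^ (- (mu * rho))) / (2 * M)) `^ (2 / mu) /\
  3 / 4 * T `^ (- (mu * rho)) <= (T + s) `^ (- (mu * rho)).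

Section admissibility.
Variables (b M mu t rho : R).
Hypotheses (b0 : 0 < b) (M0 : 0 < M) (mu1 : 1 < mu) (mu2 : mu <= 2)
  (t0 : 0 < t) (rho0 : 0 < rho).

Let mu0 : 0 < mu. Proof. exact: lt_trans ltr01 mu1. Qed.
Let mr0 : 0 < mu * rho. Proof. exact: mulr_gt0. Qed.
Let e0 : 0 <= 2 / mu - 1.
Proof. by rewrite subr_ge0 ler_pdivlMr// mul1r. Qed.

Let kappa := 1 - rho * (2 - mu).
Let threshold c0 := b / 4 / (2 * M) * (c0 / (2 * M)) `^ (2 / mu - 1).

Let admissible_of c0 T1 : 0 < c0 ->
  (forall T, T1 <= T -> mu * rho * t * T `^ (- kappa) <= threshold c0) ->
  admissible b M mu t c0 rho.
Proof.
move=> c00 hT1; exists (Num.max 1 (Num.max T1 (4 * (mu * rho * t)))).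
  by rewrite le_max lexx.
move=> c T s cc; rewrite !ge_max => /andP[T1' /andP[TT1 T4]] s0 st.
have T0 : 0 < T by apply: lt_le_trans T1'.
have c0' : 0 < c by apply: lt_le_trans cc.
have sh := powR_shift_ge T0 s0 st (ltW mr0).
set X := T `^ (- (mu * rho)) in sh *; set X' := (T + s) `^ _ in sh *.
have X0 : 0 < X by exact: powR_gt0.
have M20 : 0 < 2 * M by rewrite mulr_gt0.
split; last first.
  apply: le_trans sh; rewrite mulrC ler_wpM2l ?(ltW X0)//.
  have : mu * rho * t / T <= 1 / 4 by rewrite ler_pdivrMr//; move: T4; lra.
  lra.
have E : (c * X / (2 * M)) `^ (2 / mu) = (c / (2 * M)) `^ (2 / mu) * T `^ (- (2 * rho)).
  have -> : c * X / (2 * M) = (c / (2 * M)) * X by ring.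
  rewrite powRM ?divr_ge0 ?ltW//; congr (_ * _).
  rewrite /X -powRrM; congr powR; field; by rewrite gt_eqF.
rewrite E.
have E2 : X / T = T `^ (- (2 * rho)) * T `^ (- kappa).
  rewrite -powRD_gt0// -[T^-1]powR_inv1 ?(ltW T0)// /X -powRD_gt0//.
  by congr powR; rewrite /kappa; ring.
have E3 : (c / (2 * M)) `^ (2 / mu) = (c / (2 * M)) * (c / (2 * M)) `^ (2 / mu - 1).
  have cM : 0 < c / (2 * M) by rewrite divr_gt0.
  by rewrite -{2}(powRr1 (ltW cM)) -powRD_gt0// addrC subrK.
have mono : (c0 / (2 * M)) `^ (2 / mu - 1) <= (c / (2 * M)) `^ (2 / mu - 1).
  apply: ge0_ler_powR => //.
  - by rewrite nnegrE ltW// divr_gt0.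
  - by rewrite nnegrE ltW// divr_gt0.
  - by apply: ler_wpM2r => //; rewrite invr_ge0 ltW.
apply: le_trans (_ : c * (mu * rho * t) * (X / T) <= _).
  have := ler_wpM2l (ltW c0') sh; set a := mu * rho * t => h.
  have -> : c * a * (X / T) = c * X - c * (X * (1 - a / T)) by ring.
  lra.
rewrite E2.
have hT := hT1 T TT1.
have Y0 : 0 <= T `^ (- (2 * rho)) by exact: powR_ge0.
have -> : c * (mu * rho * t) * (T `^ (- (2 * rho)) * T `^ (- kappa)) =
  c * T `^ (- (2 * rho)) * (mu * rho * t * T `^ (- kappa)) by ring.
have cY : 0 <= c * T `^ (- (2 * rho)) by rewrite mulr_ge0// ltW.
apply: le_trans (ler_wpM2l cY hT) _.
rewrite E3 /threshold.
set p1 := (c0 / _) `^ _ in mono *; set p2 := (c / _) `^ _ in mono *.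
have -> : c * T `^ (- (2 * rho)) * (b / 4 / (2 * M) * p1) =
   (b / 4 * (c / (2 * M)) * T `^ (- (2 * rho))) * p1 by ring.
have -> : b / 4 * (c / (2 * M) * p2 * T `^ (- (2 * rho))) =
   (b / 4 * (c / (2 * M)) * T `^ (- (2 * rho))) * p2 by ring.
apply: ler_wpM2l => //; apply: mulr_ge0 => //; apply: ltW.
by rewrite mulr_gt0// !divr_gt0.
Qed.

Lemma admissible_lt c0 : 0 < c0 -> rho * (2 - mu) < 1 -> admissible b M mu t c0 rho.
Proof.
move=> c00 k0; have M20 : 0 < 2 * M by rewrite mulr_gt0.
have th : 0 < threshold c0 by rewrite mulr_gt0// ?powR_gt0// !divr_gt0.
have mrt : 0 < mu * rho * t by rewrite mulr_gt0.
have k1 : 0 < kappa by rewrite /kappa subr_gt0.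
have [T1 _ hT1] := powR_small (divr_gt0 th mrt) k1.
apply: (admissible_of (T1 := T1)) => // T TT.
by have := hT1 T TT; rewrite ler_pdivlMr// mulrC.
Qed.

Lemma admissible_eq : rho * (2 - mu) = 1 -> exists2 c0, 0 < c0 & admissible b M mu t c0 rho.
Proof.
move=> k0; have M20 : 0 < 2 * M by rewrite mulr_gt0.
have mrt : 0 < mu * rho * t by rewrite mulr_gt0.
have mult2 : mu < 2.
  rewrite lt_neqAle mu2 andbT; apply/eqP => m2; move: k0.
  by rewrite m2 subrr mulr0 => /esym/eqP; rewrite oner_eq0.
have e1 : 0 < 2 / mu - 1 by rewrite subr_gt0 ltr_pdivlMr// mul1r.
pose w := mu * rho * t / (b / 4 / (2 * M)).
have w0 : 0 < w by rewrite !divr_gt0.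
exists (2 * M * w `^ (2 / mu - 1)^-1); first by rewrite mulr_gt0// powR_gt0.
apply: (admissible_of (T1 := 0)) => [|T _]; first by rewrite mulr_gt0// powR_gt0.
rewrite /kappa k0 subrr oppr0 powRr0 mulr1 /threshold.
rewrite [2 * M * _ / _]mulrAC mulfV ?gt_eqF// mul1r -powRrM mulVf ?gt_eqF//.
rewrite powRr1 ?(ltW w0)// /w mulrCA mulfV ?mulr1// gt_eqF//.
by rewrite !divr_gt0.
Qed.

End admissibility.
End powers.

(** * Rates for a scalar descent recursion with noise *)

(** [u m] stands for [f (theta_m) - fhat], [G m] for the norm of the gradient at
[theta_m], [gam] for the time scale and [nxt m] for the end of the window that starts at
[m].  Along a chain of windows [u] decreases by [b G^2] up to the noise, and it is
controlled between the ends of each window. *)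
Section rates.
Context (R : realType).
Variables (gam u G : nat -> R) (nxt : nat -> nat) (b t M mu r delta : R).
Hypotheses (b0 : 0 < b) (tb : t = 3 * b) (M1 : 1 <= M) (mu1 : 1 < mu) (mu2 : mu <= 2)
  (r0 : 0 < r) (delta0 : 0 < delta).
Hypothesis gam_nd : forall i j, (i <= j)%N -> gam i <= gam j.
Hypothesis gam_oo : forall x, \forall m \near \oo, x <= gam m.
Hypothesis G0 : forall m, 0 <= G m.
Hypothesis nxtP : \forall m \near \oo, (m < nxt m)%N /\ gam (nxt m) <= gam m + t.
Let window m nz := u (nxt m) <= u m - b * G m ^+ 2 + nz /\
  forall k, (m <= k <= nxt m)%N -> u k <= u m + t * G m ^+ 2 + nz.
Hypothesis step : forall e : R, 0 < e -> \forall m \near \oo,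
  window m (e * gam m `^ (- (2 * r))).
Hypothesis u_linf : forall e : R, 0 < e -> \forall m \near \oo, - e <= u m.
Hypothesis u_freq : forall (e : R) m0, 0 < e -> exists2 m, (m0 <= m)%N & u m <= e.
Hypothesis loj : \forall m \near \oo, `|u m| <= delta -> `|u m| <= M * G m `^ mu.

Let t0 : 0 < t. Proof. by rewrite tb mulr_gt0. Qed.
Let M0 : 0 < M. Proof. exact: lt_le_trans M1. Qed.
Let mu0 : 0 < mu. Proof. exact: lt_trans ltr01 mu1. Qed.

(** Every index lies in one of the windows of the chain [m0, nxt m0, nxt (nxt m0), ...];
an invariant of the chain holds at the start of that window. *)
Lemma chain_ind (Q : nat -> Prop) m0 : (forall m, (m0 <= m)%N -> (m < nxt m)%N) ->
  (forall m, (m0 <= m)%N -> Q m -> Q (nxt m)) -> Q m0 ->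
  forall k, (m0 <= k)%N -> exists m, [/\ (m0 <= m)%N, (m <= k <= nxt m)%N & Q m].
Proof.
move=> nx Qn Q0; elim=> [|k IHk].
  rewrite leqn0 => /eqP m00; exists 0%N; rewrite -m00; split=> //.
  by rewrite leqnn ltnW// nx.
rewrite leq_eqVlt => /predU1P[<-|mk].
  by exists m0; split=> //; rewrite leqnn ltnW// nx.
have [m [m0m /andP[mk' km] Qm]] := IHk mk.
move: km; rewrite leq_eqVlt => /predU1P[kE|km].
  have m0n : (m0 <= nxt m)%N by rewrite -kE.
  exists (nxt m); split=> //; last exact: Qn.
  by rewrite -kE leqnSn kE nx.
by exists m; split=> //; rewrite km leqW.
Qed.

Let small_noise e : 0 < e -> \forall m \near \oo,
  window m e.
Proof.
move=> e0; near=> m.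
have T1 : 1 <= gam m by near: m; exact: gam_oo.
have P1 : e * gam m `^ (- (2 * r)) <= e.
  rewrite -[leRHS]mulr1 ler_wpM2l ?(ltW e0)// -[leRHS](powRr0 (gam m)).
  by apply: ler_powR => //; rewrite oppr_le0 mulr_ge0// ltW.
have [s1 s2] : window m (e * gam m `^ (- (2 * r))).
  by near: m; exact: step.
split=> [|k mk]; first by apply: le_trans s1 _; rewrite lerD2l.
by apply: le_trans (s2 k mk) _; rewrite lerD2l.
Unshelve. all: by end_near. Qed.

Let nxt_near (Q : nat -> Prop) : (\forall m \near \oo, Q m) -> \forall m \near \oo, Q (nxt m).
Proof.
move=> [N _ hN]; near=> m; apply: hN => /=.
have [mn _] : (m < nxt m)%N /\ gam (nxt m) <= gam m + t by near: m; exact: nxtP.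
apply: leq_trans (ltnW mn); near: m; exact: nbhs_infty_ge.
Unshelve. all: by end_near. Qed.

(** Either the gradient is large and the decrease beats the noise, or it is small and the
Lojasiewicz inequality puts [u] below half the level. *)
Let descent_keeps d : 0 < d -> d <= delta -> \forall m \near \oo, u m <= d -> u (nxt m) <= d.
Proof.
move=> d0 dd.
pose g0 := Num.min 1 (d / (2 * M)).
have g00 : 0 < g0 by rewrite lt_min ltr01 divr_gt0// mulr_gt0.
pose e := Num.min (d / 2) (b * g0 ^+ 2).
have e0 : 0 < e by rewrite lt_min divr_gt0//= mulr_gt0// exprn_gt0.
near=> m => um.
have [s1 _] : window m e.
  by near: m; exact: small_noise.
have lj : `|u m| <= delta -> `|u m| <= M * G m `^ mu by near: m; exact: loj.
have lo : - delta <= u m by near: m; exact: u_linf.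
have [big|small] := leP g0 (G m).
  have : b * g0 ^+ 2 <= b * G m ^+ 2.
    by rewrite ler_wpM2l ?(ltW b0)// lerXn2r ?nnegrE ?(ltW g00).
  have : e <= b * g0 ^+ 2 by rewrite ge_min lexx orbT.
  lra.
have ud : `|u m| <= delta by rewrite ler_norml lo (le_trans um dd).
have := le_trans (ler_norm _) (lj ud).
have G1 : G m <= 1 by apply: ltW; apply: lt_le_trans small _; rewrite ge_min lexx.
have : M * G m `^ mu <= d / 2.
  have [->|Gn0] := eqVneq (G m) 0.
    by rewrite powR0 ?gt_eqF// mulr0 divr_ge0// ltW.
  have Gp : 0 < G m by rewrite lt_neqAle eq_sym Gn0 G0.
  have : G m `^ mu <= G m `^ 1 by apply: ger_powR; [rewrite Gp G1|exact: ltW].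
  rewrite powRr1// => h1.
  have : G m <= d / (2 * M) by apply: ltW; apply: lt_le_trans small _; rewrite ge_min lexx orbT.
  rewrite ler_pdivlMr ?mulr_gt0// => h2.
  by have := ler_wpM2l (ltW M0) h1; lra.
have : e <= d / 2 by rewrite ge_min lexx.
have : 0 <= b * G m ^+ 2 by rewrite mulr_ge0 ?(ltW b0)// sqr_ge0.
lra.
Unshelve. all: by end_near. Qed.

(** Values below any level occur infinitely often, and the chain of windows started at
one of them stays there; inside a window [u] exceeds its value at the start by at most
[t G^2 = 3 b G^2], which is at most 3 times the decrease plus noise. *)
Lemma u_limsup d : 0 < d -> \forall m \near \oo, u m <= d.
Proof.
move=> d0; pose d' := Num.min (d / 11) delta.
have d'0 : 0 < d' by rewrite lt_min divr_gt0.
have dd : d' <= delta by rewrite ge_min lexx orbT.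
have [N _ hN] : \forall m \near \oo,
  [/\ (m < nxt m)%N, u m <= d' -> u (nxt m) <= d', - d' <= u (nxt m),
   u (nxt m) <= u m - b * G m ^+ 2 + d' &
   forall k, (m <= k <= nxt m)%N -> u k <= u m + t * G m ^+ 2 + d'].
  near=> m.
  have [? _] : (m < nxt m)%N /\ gam (nxt m) <= gam m + t by near: m; exact: nxtP.
  have [? ?] : window m d'.
    by near: m; exact: small_noise.
  split=> //.
    by near: m; exact: (descent_keeps d'0 dd).
  by near: m; apply: (nxt_near (Q := fun m => - d' <= u m)); exact: u_linf.
have [m0 Nm0 um0] := u_freq N d'0.
exists m0 => // k /= m0k.
have hN' m (h : (m0 <= m)%N) := hN m (leq_trans Nm0 h).
have [m [m0m mk um]] : exists m, [/\ (m0 <= m)%N, (m <= k <= nxt m)%N & u m <= d'].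
  apply: (chain_ind (Q := fun m => u m <= d')) => // m h.
    by have [] := hN' m h.
  by have [] := hN' m h.
have [_ _ h1 h2 h3] := hN' m m0m.
have := h3 k mk; rewrite tb.
have : d' <= d / 11 by rewrite ge_min lexx.
lra.
Unshelve. all: by end_near. Qed.

Let G_of_u m e : u (nxt m) <= u m - b * G m ^+ 2 + e -> G m ^+ 2 <= (u m - u (nxt m) + e) / b.
Proof. by move=> h; rewrite ler_pdivlMr//; lra. Qed.

Lemma G_small d : 0 < d -> \forall m \near \oo, G m ^+ 2 <= d.
Proof.
move=> d0; have d3 : 0 < b * d / 3 by rewrite divr_gt0// mulr_gt0.
near=> m.
have [s1 _] : window m (b * d / 3).
  by near: m; exact: small_noise.
apply: le_trans (G_of_u s1) _; rewrite ler_pdivrMr//.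
have : u m <= b * d / 3 by near: m; exact: u_limsup.
have : - (b * d / 3) <= u (nxt m) by near: m; apply: (nxt_near (Q := fun m => - (b * d / 3) <= u m)); exact: u_linf.
lra.
Unshelve. all: by end_near. Qed.

Let loj_near : \forall m \near \oo, `|u m| <= M * G m `^ mu.
Proof.
near=> m.
have lj : `|u m| <= delta -> `|u m| <= M * G m `^ mu by near: m; exact: loj.
apply: lj; rewrite ler_norml; apply/andP; split.
  by near: m; exact: u_linf.
by near: m; exact: u_limsup.
Unshelve. all: by end_near. Qed.

(** The Lojasiewicz inequality read backwards: [u] away from 0 forces a large gradient. *)
Let G_ge (um Gm x : R) : 0 <= Gm -> `|um| <= M * Gm `^ mu -> 0 <= x -> x <= `|um| / M ->
  x `^ (2 / mu) <= Gm ^+ 2.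
Proof.
move=> Gm0 lj x0 xu.
have xG : x <= Gm `^ mu by apply: le_trans xu _; rewrite ler_pdivrMr// mulrC.
have : x `^ (2 / mu) <= (Gm `^ mu) `^ (2 / mu).
  by apply: ge0_ler_powR => //; rewrite ?nnegrE ?powR_ge0// divr_ge0// ltW.
rewrite -powRrM mulrCA mulfV ?gt_eqF// mulr1.
by rewrite -(powR_mulrn 2 Gm0).
Qed.

(** Below the negative of the curve, the Lojasiewicz inequality forces over every window a
decrease that compensates the noise, so [u] would remain below a fixed negative number,
against its lower limit being nonnegative. *)
Lemma u_lower A rho : 0 < A -> 0 < rho -> rho <= r ->
  \forall m \near \oo, - (A * gam m `^ (- (mu * rho))) <= u m.
Proof.
move=> A0 rho0 rhor.
pose e := b * (A / M) `^ (2 / mu).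
have e0 : 0 < e by rewrite mulr_gt0// powR_gt0// divr_gt0.
have [N _ hN] : \forall m \near \oo, [/\ (m < nxt m)%N, 1 <= gam m, `|u m| <= M * G m `^ mu &
  u (nxt m) <= u m - b * G m ^+ 2 + e * gam m `^ (- (2 * r))].
  near=> m.
  have [? _] : (m < nxt m)%N /\ gam (nxt m) <= gam m + t by near: m; exact: nxtP.
  have [? ?] : window m (e * gam m `^ (- (2 * r))).
    by near: m; exact: step.
  split=> //; first by near: m; exact: gam_oo.
  by near: m; exact: loj_near.
exists N => // m0 /= Nm0; rewrite leNgt; apply/negP => um0.
have hN' m (h : (m0 <= m)%N) := hN m (leq_trans Nm0 h).
have [_ T1 _ _] := hN' m0 (leqnn _).
have T0 : 0 < gam m0 by apply: lt_le_trans T1.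
set beta := A * gam m0 `^ (- (mu * rho)) in um0.
have be0 : 0 < beta by rewrite mulr_gt0// powR_gt0.
have keep m : (m0 <= m)%N -> u m <= - beta -> u (nxt m) <= - beta.
  move=> m0m um; have [_ Tm lj s1] := hN' m m0m.
  have uneg : u m <= 0 by apply: le_trans um _; rewrite oppr_le0 ltW.
  have bM : beta / M <= `|u m| / M.
    by rewrite ler_pM2r ?invr_gt0// ler0_norm// lerNr.
  have bM0 : 0 <= beta / M by rewrite divr_ge0 ?ltW.
  have := G_ge (G0 m) lj bM0 bM.
  have -> : beta / M = (A / M) * gam m0 `^ (- (mu * rho)) by rewrite /beta; ring.
  have AM0 : 0 <= A / M by rewrite divr_ge0 ?ltW.
  rewrite powRM ?powR_ge0//.
  have -> : (gam m0 `^ (- (mu * rho))) `^ (2 / mu) = gam m0 `^ (- (2 * rho)).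
    by rewrite -powRrM; congr powR; field; rewrite gt_eqF.
  move=> hG.
  have : gam m `^ (- (2 * r)) <= gam m0 `^ (- (2 * rho)).
    apply: le_trans (_ : gam m0 `^ (- (2 * r)) <= _).
      by apply: powR_decr => //; [exact: gam_nd|rewrite mulr_ge0// ltW].
    by apply: powR_le_exp => //; rewrite ler_pM2l.
  move=> /(ler_wpM2l (ltW e0)); have := ler_wpM2l (ltW b0) hG; rewrite /e.
  have := s1; rewrite /e; lra.
have hb : 0 < beta / 2 by rewrite divr_gt0.
have [N2 _ hN2] := u_linf hb.
have [m [m0m /andP[_ km] um]] := @chain_ind (fun m => u m <= - beta) m0
  (fun m h => let: And4 h1 _ _ _ := hN' m h in h1) keep (ltW um0) (maxn m0 N2) (leq_maxl _ _).
have := hN2 (nxt m) (leq_trans (leq_maxr _ _) km).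
have := keep m m0m um; lra.
Unshelve. all: by end_near. Qed.

Let tau_sum (x y : R) : 0 <= x -> 0 <= y ->
  ((x / (2 * M)) `^ (2 / mu) + (y / (2 * M)) `^ (2 / mu)) / 2 <=
  ((x + y) / (2 * M)) `^ (2 / mu).
Proof.
move=> x0 y0; have M20 : 0 <= (2 * M)^-1 by rewrite invr_ge0 mulr_ge0// ltW.
have h z : 0 <= z -> z <= x + y -> (z / (2 * M)) `^ (2 / mu) <= ((x + y) / (2 * M)) `^ (2 / mu).
  move=> z0 zxy; apply: ge0_ler_powR.
  - by rewrite divr_ge0// ltW.
  - by rewrite nnegrE mulr_ge0.
  - by rewrite nnegrE mulr_ge0// addr_ge0.
  - exact: ler_wpM2r.
have := h x x0; rewrite lerDl => /(_ y0).
have := h y y0; rewrite lerDr => /(_ x0).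
set a := (x / _) `^ _; set c := (y / _) `^ _; set d := (_ / _) `^ _; lra.
Qed.

(** The sum of two admissible curves, of values [a], [c] now and [a'], [c'] at the end of
the window, stays above [u].  Below half the height, the noise [nz] and the loss of the
curves fit in the other half.  Above it, [G_ge] gives a decrease of at least
[b/2] times the two terms of [tau_sum]; each curve loses at most [b/4] times its term, and
the noise is at most [b/4] times the first. *)
Let supersolution_step (um un Gm nz a c a' c' : R) : 0 <= Gm ->
  `|um| <= M * Gm `^ mu -> un <= um - b * Gm ^+ 2 + nz -> 0 < a -> 0 < c ->
  a - a' <= b / 4 * (a / (2 * M)) `^ (2 / mu) ->
  c - c' <= b / 4 * (c / (2 * M)) `^ (2 / mu) ->
  3 / 4 * a <= a' -> 3 / 4 * c <= c' ->
  nz <= a / 4 -> nz <= b / 4 * (a / (2 * M)) `^ (2 / mu) ->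
  um <= a + c -> un <= a' + c'.
Proof.
move=> Gm0 lj un_le a0 c0 xa xc a34 c34 n1 n2 um_le.
have G20 : 0 <= b * Gm ^+ 2 by rewrite mulr_ge0 ?sqr_ge0// ltW.
have [sm|bg] := leP um ((a + c) / 2); first by lra.
have B0 : 0 <= (a + c) / 2 by rewrite divr_ge0// addr_ge0// ltW.
have uB : (a + c) / (2 * M) <= `|um| / M.
  have -> : (a + c) / (2 * M) = ((a + c) / 2) / M by field; rewrite gt_eqF.
  rewrite ler_pM2r ?invr_gt0// (le_trans (ltW bg))//; exact: ler_norm.
have BM0 : 0 <= (a + c) / (2 * M).
  by rewrite divr_ge0 ?mulr_ge0 ?addr_ge0 ?ltW.
have := ler_wpM2l (ltW b0) (le_trans (tau_sum (ltW a0) (ltW c0)) (G_ge Gm0 lj BM0 uB)).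
move: xa xc n2; set tx := (a / _) `^ _; set ty := (c / _) `^ _.
have : 0 <= b * tx by rewrite mulr_ge0 ?powR_ge0// ltW.
have : 0 <= b * ty by rewrite mulr_ge0 ?powR_ge0// ltW.
lra.
Qed.

Section upper.
Variables (c1 c2 rho1 rho2 : R).
Hypotheses (c10 : 0 < c1) (c20 : 0 < c2) (rho10 : 0 < rho1)
  (rho1r : rho1 <= r).
Hypothesis adm1 : admissible b M mu t c1 rho1.
Hypothesis adm2 : admissible b M mu t c2 rho2.

Let X m := c1 * gam m `^ (- (mu * rho1)).
Let Y D m := D * gam m `^ (- (mu * rho2)).

(** The first curve has the prescribed constant [c1] and absorbs the noise, the second one
is raised by [D] above the initial value; in the application of [rate_little_o] it is of
higher order, so that no constant remains from the start.  At an index inside a window that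
starts at [m], [u] is at most [4 u_m + 3 X_m + 4 noise <= 8 X_m + 4 Y_m], and the curves
drop by at most a quarter within the window, whence the factor 11.  The gradient is
estimated by the decrease over the window that starts at [k]. *)
Lemma u_upper : exists D, 0 < D /\ \forall k \near \oo,
  u k <= 11 * (X k + Y D k) /\ u k + G k ^+ 2 * b <= 24 * (X k + Y D k).
Proof.
have [T1 T11 a1] := adm1; have [T2 T21 a2] := adm2.
pose e := Num.min (c1 / 4) (b / 4 * (c1 / (2 * M)) `^ (2 / mu)).
have e0 : 0 < e.
  by rewrite lt_min !divr_gt0//= mulr_gt0// ?divr_gt0// powR_gt0// divr_gt0// mulr_gt0.
have [N _ hN] : \forall m \near \oo, [/\ (m < nxt m)%N /\ gam (nxt m) <= gam m + t,
  T1 <= gam m /\ T2 <= gam m, `|u m| <= M * G m `^ mu,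
  - X m <= u m /\ - X (nxt m) <= u (nxt m) &
  window m (e * gam m `^ (- (2 * r)))].
  near=> m; split.
  - by near: m; exact: nxtP.
  - by split; near: m; exact: gam_oo.
  - by near: m; exact: loj_near.
  - split; near: m; first exact: u_lower.
    by apply: (nxt_near (Q := fun m => - X m <= u m)); exact: u_lower.
  - by near: m; exact: step.
have nN m : (N <= m)%N -> gam m <= gam (nxt m) <= gam m + t.
  by move=> h; have [[h1 ->] _ _ _ _] := hN m h; rewrite gam_nd// ltnW.
have gm0 m : (N <= m)%N -> 0 < gam m.
  by move=> h; have [_ [hT _] _ _ _] := hN m h; apply: lt_le_trans hT; exact: lt_le_trans T11.
have noise1 m : (N <= m)%N -> e * gam m `^ (- (2 * r)) <= X m / 4.
  move=> h; have [_ [hT _] _ _ _] := hN m h.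
  have T1' : 1 <= gam m by apply: le_trans hT.
  have -> : X m / 4 = c1 / 4 * gam m `^ (- (mu * rho1)) by rewrite /X; ring.
  apply: ler_pM; rewrite ?powR_ge0 ?(ltW e0)//; first by rewrite ge_min lexx.
  apply: powR_le_exp => //; apply: ler_pM => //; exact: ltW.
have noise2 m : (N <= m)%N -> e * gam m `^ (- (2 * r)) <= b / 4 * (X m / (2 * M)) `^ (2 / mu).
  move=> h; have [_ [hT _] _ _ _] := hN m h.
  have T1' : 1 <= gam m by apply: le_trans hT.
  have -> : X m / (2 * M) = c1 / (2 * M) * gam m `^ (- (mu * rho1)) by rewrite /X; ring.
  have cM0 : 0 <= c1 / (2 * M) by rewrite divr_ge0 ?mulr_ge0 ?ltW.
  rewrite powRM ?powR_ge0//.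
  have -> : (gam m `^ (- (mu * rho1))) `^ (2 / mu) = gam m `^ (- (2 * rho1)).
    by rewrite -powRrM; congr powR; field; rewrite gt_eqF.
  rewrite mulrA; apply: ler_pM; rewrite ?powR_ge0 ?(ltW e0)//.
    by rewrite ge_min lexx orbT.
  by apply: powR_le_exp => //; rewrite ler_pM2l.
pose D := Num.max c2 (u N * gam N `^ (mu * rho2)).
have c2D : c2 <= D by rewrite le_max lexx.
have D0 : 0 < D by apply: lt_le_trans c2D.
exists D; split=> //.
pose B m := X m + Y D m.
have X0 m : (N <= m)%N -> 0 < X m by move=> h; rewrite mulr_gt0// powR_gt0// gm0.
have Y0 m : (N <= m)%N -> 0 < Y D m by move=> h; rewrite mulr_gt0// powR_gt0// gm0.
have slow m s : (N <= m)%N -> 0 <= s -> s <= t ->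
  [/\ X m - c1 * (gam m + s) `^ (- (mu * rho1)) <= b / 4 * (X m / (2 * M)) `^ (2 / mu),
     Y D m - D * (gam m + s) `^ (- (mu * rho2)) <= b / 4 * (Y D m / (2 * M)) `^ (2 / mu),
     3 / 4 * X m <= c1 * (gam m + s) `^ (- (mu * rho1)) &
     3 / 4 * Y D m <= D * (gam m + s) `^ (- (mu * rho2))].
  move=> h s0 st; have [_ [hT1 hT2] _ _ _] := hN m h.
  have [x1 x2] := a1 c1 _ _ (lexx _) hT1 s0 st.
  have [y1 y2] := a2 D _ _ c2D hT2 s0 st.
  split; [exact: x1|exact: y1|..].
    by rewrite /X mulrCA ler_wpM2l// ltW.
  by rewrite /Y mulrCA ler_wpM2l// ltW.
have slow' m k : (N <= m)%N -> (m <= k <= nxt m)%N ->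
  [/\ X m - X k <= b / 4 * (X m / (2 * M)) `^ (2 / mu),
     Y D m - Y D k <= b / 4 * (Y D m / (2 * M)) `^ (2 / mu),
     3 / 4 * X m <= X k & 3 / 4 * Y D m <= Y D k].
  move=> h /andP[mk kn]; have /andP[_ n2] := nN m h.
  have s0 : 0 <= gam k - gam m by rewrite subr_ge0 gam_nd.
  have st : gam k - gam m <= t.
    by rewrite lerBlDl; apply: le_trans n2; exact: gam_nd.
  have E : gam m + (gam k - gam m) = gam k by rewrite addrC subrK.
  by have := slow m _ h s0 st; rewrite E.
have keep m : (N <= m)%N -> u m <= B m -> u (nxt m) <= B (nxt m).
  move=> h um; have [[mn _] _ lj _ [s1 _]] := hN m h.
  have mnn : (m <= nxt m <= nxt m)%N by rewrite leqnn ltnW.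
  have [x1 y1 x2 y2] := slow' m (nxt m) h mnn.
  exact: (supersolution_step (G0 m) lj s1 (X0 m h) (Y0 m h) x1 y1 x2 y2
    (noise1 m h) (noise2 m h) um).
have start : u N <= B N.
  have gN := gm0 N (leqnn _).
  rewrite /B -[leLHS]add0r; apply: lerD; first exact: ltW (X0 _ (leqnn _)).
  rewrite /Y powRN ler_pdivlMr ?powR_gt0//.
  by rewrite /D le_max lexx orbT.
exists N => // k /= Nk.
have chain k' : (N <= k')%N -> u k' <= 11 * (X k' + Y D k').
  move=> {}Nk.
  have [m [Nm mk um]] := @chain_ind (fun m => u m <= B m) N
    (fun m h => let: And5 h1 _ _ _ _ := hN m h in h1.1) keep start k' Nk.
  have [[mn _] _ _ [_ lo] [s1 s2]] := hN m Nm.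
  have mnn : (m <= nxt m <= nxt m)%N by rewrite leqnn ltnW.
  have := s2 k' mk; have := noise1 m Nm.
  have [_ _ xk yk] := slow' m k' Nm mk.
  have : X (nxt m) <= X m.
    rewrite /X ler_wpM2l ?(ltW c10)//; apply: powR_decr; first exact: gm0.
      by apply: gam_nd; exact: ltnW.
    by rewrite mulr_ge0// ltW.
  have := X0 m Nm; have := Y0 m Nm; rewrite /B in um; rewrite tb.
  move: um lo s1; set nz := e * _; lra.
split; first exact: chain.
have [[mn _] _ _ [lk lo] [s1 s2]] := hN k Nk.
have := chain k Nk; have := noise1 k Nk.
have : X (nxt k) <= X k.
  rewrite /X ler_wpM2l ?(ltW c10)//; apply: powR_decr; first exact: gm0.
    by apply: gam_nd; exact: ltnW.
  by rewrite mulr_ge0// ltW.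
have := X0 k Nk; have := Y0 k Nk.
move: lo s1; set nz := e * _; lra.
Unshelve. all: by end_near. Qed.

End upper.

(** Both curves have the exponent [mu / (2 - mu)] of the noiseless recursion, critical in
[admissible_eq], so the constant cannot be made small. *)
Lemma rate_big_O : 1 <= r * (2 - mu) -> exists A, \forall k \near \oo,
  `|u k| <= A * gam k `^ (- (mu * (2 - mu)^-1)) /\
  G k ^+ 2 <= A * gam k `^ (- (mu * (2 - mu)^-1)).
Proof.
move=> r2; have mu_lt2 : 0 < 2 - mu.
  rewrite lt_neqAle subr_ge0 mu2 andbT; apply/eqP => h; move: r2.
  by rewrite -h mulr0 ler10.
pose rho := (2 - mu)^-1.
have rho0 : 0 < rho by rewrite invr_gt0.
have rhor : rho <= r by rewrite -[leLHS]mul1r ler_pdivrMr.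
have rho1 : rho * (2 - mu) = 1 by rewrite mulVf// gt_eqF.
have [c c0 adm] := admissible_eq b0 M0 mu1 mu2 t0 rho0 rho1.
have [D [D0 up]] := u_upper c0 c0 rho0 rhor adm adm.
have low := u_lower c0 rho0 rhor.
exists (Num.max (24 * (c + D)) (25 * (c + D) / b)).
near=> k; rewrite -/rho; set p := gam k `^ _.
have p0 : 0 <= p by exact: powR_ge0.
have : - (c * p) <= u k by rewrite /p; near: k; exact: low.
have [] : u k <= 11 * (c * p + D * p) /\ u k + G k ^+ 2 * b <= 24 * (c * p + D * p).
  by rewrite ?/p; near: k; exact: up.
have cp : 0 <= c * p by rewrite mulr_ge0// ltW.
have Dp : 0 <= D * p by rewrite mulr_ge0// ltW.
move=> h1 h2 h3; split.
  apply: le_trans (_ : 24 * (c + D) * p <= _); last by rewrite ler_wpM2r// le_max lexx.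
  rewrite ler_norml; apply/andP; split; lra.
apply: le_trans (_ : 25 * (c + D) / b * p <= _); last by rewrite ler_wpM2r// le_max lexx orbT.
have -> : 25 * (c + D) / b * p = 25 * (c + D) * p / b by ring.
rewrite ler_pdivlMr//; lra.
Unshelve. all: by end_near. Qed.

(** The exponent [mu r] is dictated by the noise and is not critical, so the constant of
the first curve is arbitrary; the second curve has exponent [mu (r + s)] with [s > 0] small
enough for [(r + s) (2 - mu) < 1]. *)
Lemma rate_little_o : r * (2 - mu) < 1 -> forall A, 0 < A -> \forall k \near \oo,
  `|u k| <= A * gam k `^ (- (mu * r)) /\ G k ^+ 2 <= A * gam k `^ (- (mu * r)).
Proof.
move=> r2 A A0.
pose s := (1 - r * (2 - mu)) / 2.
have s0 : 0 < s by rewrite divr_gt0// subr_gt0.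
have rs0 : 0 < r + s by rewrite addr_gt0.
have rs : (r + s) * (2 - mu) < 1.
  have h : s * (2 - mu) <= s * 1 by apply: ler_wpM2l; [exact: ltW|have := ltW mu1; rewrite lerBlDr; lra].
  have s2 : s * 2 = 1 - r * (2 - mu) by rewrite /s divfK.
  rewrite mulrDl; move: h s2 s0; lra.
pose c := Num.min A (b * A) / 50.
have c0 : 0 < c by rewrite divr_gt0// lt_min A0 mulr_gt0.
have cA : c * 50 <= A by rewrite /c divfK// ge_min lexx.
have cbA : c * 50 <= b * A by rewrite /c divfK// ge_min lexx orbT.
have adm1 := admissible_lt b0 M0 mu1 mu2 t0 r0 c0 r2.
have adm2 := admissible_lt b0 M0 mu1 mu2 t0 rs0 ltr01 rs.
have [D [D0 up]] := u_upper c0 ltr01 r0 (lexx r) adm1 adm2.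
have low := u_lower c0 r0 (lexx r).
have ms0 : 0 < mu * s by rewrite mulr_gt0.
have [T0 T00 small] := powR_small (divr_gt0 c0 D0) ms0.
near=> k; set p := gam k `^ _.
have p0 : 0 <= p by exact: powR_ge0.
have gT : T0 <= gam k by near: k; exact: gam_oo.
have g0 : 0 < gam k by apply: lt_le_trans gT.
have Yk : D * gam k `^ (- (mu * (r + s))) <= c * p.
  have -> : - (mu * (r + s)) = - (mu * s) + - (mu * r) by ring.
  rewrite powRD_gt0// mulrA ler_wpM2r//.
  by have := small _ gT; rewrite ler_pdivlMr// mulrC.
have : - (c * p) <= u k by rewrite /p; near: k; exact: low.
have [] : u k <= 11 * (c * p + D * gam k `^ (- (mu * (r + s)))) /\
  u k + G k ^+ 2 * b <= 24 * (c * p + D * gam k `^ (- (mu * (r + s)))).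
  by rewrite ?/p; near: k; exact: up.
have cp : 0 <= c * p by rewrite mulr_ge0// ltW.
have := ler_wpM2r p0 cA; have := ler_wpM2r p0 cbA.
move=> e1 e2 h1 h2 h3; split.
  by rewrite ler_norml; apply/andP; split; lra.
rewrite -(ler_pM2l b0); lra.
Unshelve. all: by end_near. Qed.

End rates.

(** * Euclidean norm and descent over one window *)

Section euclidean.
Context (R : realType) (n : nat).
Implicit Types (u v w : 'rV[R]_n) (a : R).

Definition ip u v : R := \sum_(i < n) u 0 i * v 0 i.

Lemma enorm_ge0 u : 0 <= enorm u. Proof. exact: sqrtr_ge0. Qed.

Lemma enorm_sq u : enorm u ^+ 2 = ip u u.
Proof. by rewrite sqr_sqrtr//; apply: sumr_ge0 => i _; exact: sqr_ge0. Qed.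

Lemma ipDr u v w : ip u (v + w) = ip u v + ip u w.
Proof. by rewrite -big_split; apply: eq_bigr => i _; rewrite mxE mulrDr. Qed.

Lemma ipZr u a v : ip u (a *: v) = a * ip u v.
Proof. by rewrite mulr_sumr; apply: eq_bigr => i _; rewrite mxE mulrCA. Qed.

Lemma ipC u v : ip u v = ip v u.
Proof. by apply: eq_bigr => i _; rewrite mulrC. Qed.

Lemma enorm0 : enorm (0 : 'rV[R]_n) = 0.
Proof. by rewrite /enorm big1 ?sqrtr0// => i _; rewrite mxE expr0n. Qed.

Lemma enormZ a u : enorm (a *: u) = `|a| * enorm u.
Proof.
rewrite /enorm -sqrtr_sqr -sqrtrM ?sqr_ge0//; congr Num.sqrt.
by rewrite mulr_sumr; apply: eq_bigr => i _; rewrite mxE exprMn.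
Qed.

Lemma enormN u : enorm (- u) = enorm u.
Proof. by rewrite -scaleN1r enormZ normrN1 mul1r. Qed.

Lemma cauchy_schwarz u v : ip u v <= enorm u * enorm v.
Proof.
have [u0|u0] := eqVneq (enorm u) 0.
  have : ip u u = 0 by rewrite -enorm_sq u0 expr0n.
  move=> /eqP; rewrite psumr_eq0 => [/allP uz|i _]; last by rewrite -expr2 sqr_ge0.
  rewrite u0 mul0r /ip big1// => i _.
  have := uz i; rewrite mem_index_enum mulf_eq0 orbb => /(_ isT)/eqP ->.
  by rewrite mul0r.
have ug : 0 < enorm u by rewrite lt_neqAle eq_sym u0 enorm_ge0.
set x := enorm u in ug *; pose c := ip u v / x.
have cE : ip u v = c * x by rewrite /c divfK// gt_eqF.
have : 0 <= enorm (x *: v + (- c) *: u) ^+ 2 by exact: sqr_ge0.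
rewrite enorm_sq ipDr !(ipC (_ + _)) !ipDr !ipZr !(ipC (_ *: _)) !ipZr.
rewrite (ipC v u) -!enorm_sq -/x cE => h.
have h2 : c ^+ 2 <= enorm v ^+ 2.
  rewrite -(ler_pM2l (exprn_gt0 2 ug)); move: h; set y := enorm v; lra.
have := enorm_ge0 v => y0.
rewrite mulrC ler_wpM2l ?(ltW ug)//.
have [c0|c0] := leP 0 c; last by apply: le_trans (ltW c0) y0.
by rewrite -ler_sqr.
Qed.

Lemma enormD u v : enorm (u + v) <= enorm u + enorm v.
Proof.
rewrite -ler_sqr ?nnegrE ?addr_ge0 ?enorm_ge0//.
rewrite enorm_sq ipDr !(ipC (u + v)) !ipDr -!enorm_sq (ipC v u).
by have := cauchy_schwarz u v; nra.
Qed.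

Lemma enormB_le u v : enorm u <= enorm (u - v) + enorm v.
Proof. by have := enormD (u - v) v; rewrite subrK. Qed.

Lemma enorm_sum (I : Type) (r : seq I) (F : I -> 'rV[R]_n) :
  enorm (\sum_(i <- r) F i) <= \sum_(i <- r) enorm (F i).
Proof.
elim: r => [|i r IHr]; first by rewrite !big_nil enorm0.
by rewrite !big_cons (le_trans (enormD _ _))// lerD2l.
Qed.

Lemma coord_le_enorm u i : `|u 0 i| <= enorm u.
Proof.
rewrite -sqrtr_sqr /enorm ler_wsqrtr// (bigD1 i)//= lerDl.
by apply: sumr_ge0 => j _; exact: sqr_ge0.
Qed.

Lemma enorm_le_sum u : enorm u <= \sum_(i < n) `|u 0 i|.
Proof.
have {1}-> : u = \sum_(i < n) u 0 i *: delta_mx 0 i by exact: row_sum_delta.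
apply: le_trans (enorm_sum _ _) _; apply: ler_sum => i _.
rewrite enormZ -[leRHS]mulr1 ler_wpM2l// /enorm (bigD1 i)//= big1 ?addr0.
  by rewrite mxE !eqxx expr1n sqrtr1.
by move=> j ji; rewrite mxE eqxx/= (negbTE ji) expr0n.
Qed.

Lemma enorm_le_norm u : enorm u <= n%:R * `|u|.
Proof.
apply: le_trans (enorm_le_sum _) _.
apply: le_trans (_ : \sum_(i < n) `|u| <= _).
  by apply: ler_sum => i _; exact: coord_le_norm.
by rewrite sumr_const card_ord -[leLHS]mulr_natl.
Qed.

Lemma norm_le_enorm u : `|u| <= enorm u.
Proof. by apply: norm_le_coord; [exact: enorm_ge0|exact: coord_le_enorm]. Qed.

(** Lipschitz gradient and quadratic Taylor remainder with a common constant, [g] playing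
the role of the gradient of [f]. *)
Definition smooth_on (f : 'rV[R]_n -> R) (g : 'rV[R]_n -> 'rV[R]_n) (B : set 'rV[R]_n)
    (C : R) :=
  (forall x y, B x -> B y -> enorm (g x - g y) <= C * enorm (x - y)) /\
  (forall x y, B x -> B y -> `|f y - f x - ip (g x) (y - x)| <= C * enorm (y - x) ^+ 2).

Definition smooth_on_balls f g :=
  forall rad : R, exists2 C : R, 1 <= C & smooth_on f g [set t | `|t| <= rad] C.

End euclidean.

Section window.
Context (R : realType) (n : nat).
Notation V := 'rV[R]_n.
Variables (f : V -> R) (g : V -> V) (B : set V) (C : R) (al : nat -> R)
  (th e : nat -> V).
Hypotheses (C1 : 1 <= C)
  (smooth : smooth_on f g B C)
  (al0 : forall i, 0 <= al i)
  (thB : forall i, B (th i))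
  (algo : forall i, th i.+1 = th i - al i *: g (th i) + al i *: e i).

Let t := (96 * C)^-1.

(** By strong induction the trajectory stays within [X = 2 (t G + eta)] of its start: the
gradient changes by at most [C X], whose contribution over the window is [C t X = X / 96].
Then Taylor's formula at the start of the window, with displacement
[- (sum of al) grad + E] and [|E| <= eta + X / 96], leaves products of [G] and [eta],
split by Young's inequality.  The smallness of [C t] is what makes the coefficient of
[G^2] as small as [t / 6]. *)
Lemma window_descent m k (eta : R) : 0 <= eta -> (m <= k)%N ->
  (\sum_(m <= i < k) al i <= t) ->
  (forall j, (m <= j <= k)%N -> enorm (\sum_(m <= i < j) al i *: e i) <= eta) ->
  f (th k) <= f (th m) - (\sum_(m <= i < k) al i) * enorm (g (th m)) ^+ 2
    + t / 6 * enorm (g (th m)) ^+ 2 + 8 ^+ 3 * C * eta ^+ 2.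
Proof.
move=> eta0 mk st noise.
have C0 : 0 < C by apply: lt_le_trans C1.
have t0 : 0 < t by rewrite invr_gt0 mulr_gt0.
have Ct : C * t = 96^-1 by rewrite /t; field; rewrite gt_eqF.
set Gm := enorm (g (th m)).
have Gm0 : 0 <= Gm by exact: enorm_ge0.
pose X := 2 * (t * Gm + eta).
have X0 : 0 <= X by rewrite mulr_ge0// addr_ge0// mulr_ge0// ltW.
have sal j : (m <= j <= k)%N -> \sum_(m <= i < j) al i <= t.
  move=> /andP[mj jk]; apply: le_trans st.
  by rewrite (big_cat_nat mj jk)/= lerDl; apply: sumr_ge0.
have tele j : (m <= j)%N -> th j - th m = - (\sum_(m <= i < j) al i) *: g (th m) +
   ((\sum_(m <= i < j) al i *: e i) - \sum_(m <= i < j) al i *: (g (th i) - g (th m))).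
  move=> mj; rewrite -(telescope_sumr _ mj) scaleNr scaler_suml addrA.
  rewrite -sumrN -!big_split/= -sumrB; apply: eq_bigr => i _.
  rewrite algo scalerBr opprB; apply/rowP => l; rewrite !mxE; ring.
have err j : (m <= j <= k)%N -> (forall i, (m <= i < j)%N -> enorm (th i - th m) <= X) ->
    enorm ((\sum_(m <= i < j) al i *: e i) - \sum_(m <= i < j) al i *: (g (th i) - g (th m)))
    <= eta + t * (C * X).
  move=> mjk hX; apply: le_trans (enormD _ _) _; rewrite enormN; apply: lerD.
    exact: noise.
  apply: le_trans (enorm_sum _ _) _.
  apply: le_trans (_ : \sum_(m <= i < j) al i * (C * X) <= _).
    rewrite !big_nat; apply: ler_sum => i mij.
    rewrite enormZ ger0_norm// ler_wpM2l//.
    apply: le_trans (smooth.1 _ _ (thB i) (thB m)) _.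
    by rewrite ler_wpM2l ?(ltW C0)// hX.
  by rewrite -mulr_suml ler_wpM2r ?sal// mulr_ge0// ltW.
have tCX : t * (C * X) = X / 96 by rewrite mulrA (mulrC t) Ct mulrC.
have Xb j : (m <= j <= k)%N -> enorm (th j - th m) <= X.
  elim/ltn_ind: j => j IH mjk; have /andP[mj jk] := mjk.
  rewrite tele//; apply: le_trans (enormD _ _) _.
  rewrite enormZ normrN ger0_norm; last by apply: sumr_ge0.
  have h1 := ler_wpM2r Gm0 (sal j mjk).
  have h2 : enorm ((\sum_(m <= i < j) al i *: e i) - \sum_(m <= i < j) al i *: (g (th i) - g (th m)))
    <= eta + t * (C * X).
    apply: err => // i /andP[mi ij]; apply: IH => //.
    by rewrite mi (leq_trans (ltnW ij) jk).
  have := lerD h1 h2; rewrite tCX -/Gm /X.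
  set a := _ + _; set Z := t * Gm; have : 0 <= t * Gm by rewrite mulr_ge0// ltW.
  rewrite -/Z; lra.
have mkk : (m <= k <= k)%N by rewrite mk leqnn.
have := smooth.2 _ _ (thB m) (thB k); have Xk := Xb k mkk.
rewrite ler_norml => /andP[_].
rewrite {1}tele// ipDr ipZr -enorm_sq -/Gm.
set s := \sum_(m <= i < k) al i; set E := _ - \sum_(m <= i < k) _.
have Ek : enorm E <= eta + X / 96.
  rewrite -tCX; apply: err => // i /andP[mi ik]; apply: Xb.
  by rewrite mi ltnW.
have cs := cauchy_schwarz (g (th m)) E.
have cs' : - ip (g (th m)) E <= Gm * enorm E.
  have := cauchy_schwarz (g (th m)) (- E).
  by rewrite -scaleN1r ipZr mulN1r scaleN1r enormN.
have h3 := ler_wpM2l Gm0 Ek.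
have h4 : C * enorm (th k - th m) ^+ 2 <= C * X ^+ 2.
  by rewrite ler_wpM2l ?(ltW C0)// lerXn2r// nnegrE// enorm_ge0.
move=> h5.
have h6 : f (th k) <= f (th m) - s * Gm ^+ 2 + Gm * (eta + X / 96) + C * X ^+ 2.
  move: h3 h4 h5 cs; rewrite mulNr -/Gm; lra.
apply: le_trans h6 _.
rewrite -!addrA !lerD2l /X.
have -> : C * (2 * (t * Gm + eta)) ^+ 2 = 4 * (C * t) * t * Gm ^+ 2 + 8 * (C * t) * Gm * eta + 4 * C * eta ^+ 2 by ring.
rewrite Ct.
have tinv : 96 * C * t = 1 by rewrite -mulrA Ct; field.
have young : Gm * eta <= t / 12 * Gm ^+ 2 + 288 * C * eta ^+ 2.
  have : 0 <= t * (Gm - 6 * (96 * C) * eta) ^+ 2 by rewrite mulr_ge0 ?sqr_ge0// ltW.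
  have -> : t * (Gm - 6 * (96 * C) * eta) ^+ 2 =
    t * Gm ^+ 2 - 12 * (96 * C * t) * (Gm * eta) + 36 * (96 * C) * (96 * C * t) * eta ^+ 2 by ring.
  rewrite tinv; lra.
have tG0 : 0 <= t * Gm ^+ 2 by rewrite mulr_ge0 ?sqr_ge0// ltW.
have Ce0 : 0 <= C * eta ^+ 2 by rewrite mulr_ge0 ?sqr_ge0// ltW.
move: young tG0 Ce0; lra.
Qed.

End window.

(** * Rates along a trajectory *)

Section stepsizes.
Context (R : realType) (al : nat -> R).
Hypotheses (al_gt0 : forall i, 0 < al i) (al_cvg0 : al n @[n --> \oo] --> 0)
  (al_sum : (\sum_(0 <= n <oo) (al n)%:E = +oo)%E).
Local Notation gam := (gamma al).

Lemma gamma_sub m k : (m <= k)%N -> gam k - gam m = \sum_(m <= i < k) al i.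
Proof. by move=> mk; rewrite /gamma (big_cat_nat (leq0n m) mk)/= [X in X - _]addrC addrK. Qed.

Lemma gamma_nd i j : (i <= j)%N -> gam i <= gam j.
Proof.
move=> ij; rewrite -subr_ge0 gamma_sub//; apply: sumr_ge0 => k _; exact: ltW.
Qed.

Lemma gamma_oo x : \forall m \near \oo, x <= gam m.
Proof.
have [[m xm]|no] := pselect (exists m, x <= gam m).
  by exists m => // k /= mk; apply: le_trans xm _; exact: gamma_nd.
exfalso; have : (\sum_(0 <= n <oo) (al n)%:E <= x%:E)%E.
  apply: lime_le; first by apply: is_cvg_nneseries => n _ _; rewrite lee_fin ltW.
  apply: nearW => m; rewrite sumEFin lee_fin leNgt; apply/negP => xm.
  by apply: no; exists m; exact: ltW.
by rewrite al_sum leye_eq.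
Qed.

(** The first index at which the time scale has advanced by [t / 2]; it overshoots by one
step size, eventually less than [t / 2]. *)
Lemma next_exists t : 0 < t -> \forall m \near \oo, exists k,
  (m < k)%N /\ t / 2 <= gam k - gam m <= t.
Proof.
move=> t0; have t2 : 0 < t / 2 by rewrite divr_gt0.
have /cvgr0_norm_le/(_ _ t2)[N _ hN] := al_cvg0.
exists N => // m /= Nm.
have ex : exists k, gam m + t / 2 <= gam k.
  by have [k _ hk] := gamma_oo (gam m + t / 2); exists k; apply: hk => /=.
case: (ex_minnP ex) => k hk kmin.
have mk : (m < k)%N.
  rewrite ltnNge; apply/negP => /gamma_nd km; move: hk.
  by rewrite leNgt (le_lt_trans km)// ltrDl.
exists k; split=> //; apply/andP; split; first by rewrite lerBrDl.
case: k mk hk kmin => // k; rewrite ltnS => mk _ kmin.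
have gk : gam k < gam m + t / 2.
  by rewrite ltNge; apply/negP => /kmin; rewrite ltnn.
have -> : gam k.+1 = gam k + al k by rewrite /gamma big_nat_recr.
have := le_trans (ler_norm _) (hN k (leq_trans Nm mk)); lra.
Qed.

End stepsizes.

Section trajectory.
Context (R : realType) (n : nat).
Notation V := 'rV[R]_n.
Variables (f : V -> R) (g : V -> V) (B : set V) (C : R) (al : nat -> R)
  (th e : nat -> V).
Local Notation gam := (gamma al).
Hypotheses (C1 : 1 <= C)
  (smooth : smooth_on f g B C)
  (al_gt0 : forall i, 0 < al i) (al_cvg0 : al n @[n --> \oo] --> 0)
  (al_sum : (\sum_(0 <= n <oo) (al n)%:E = +oo)%E)
  (thB : forall i, B (th i))
  (algo : forall i, th i.+1 = th i - al i *: g (th i) + al i *: e i).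
Variables (r mu M delta fh : R).
Hypotheses (r0 : 0 < r) (mu1 : 1 < mu) (mu2 : mu <= 2) (M1 : 1 <= M) (delta0 : 0 < delta).
Hypothesis noise : forall eps, 0 < eps -> \forall m \near \oo, forall k, (m <= k)%N ->
  gam k - gam m <= 1 -> enorm (\sum_(m <= i < k) al i *: e i) <= eps * gam m `^ (- r).
Hypothesis u_linf : forall x, 0 < x -> \forall m \near \oo, - x <= f (th m) - fh.
Hypothesis u_freq : forall x m0, 0 < x -> exists2 m, (m0 <= m)%N & f (th m) - fh <= x.
Hypothesis loj : \forall m \near \oo, `|f (th m) - fh| <= delta ->
   `|f (th m) - fh| <= M * enorm (g (th m)) `^ mu.

Let t := (96 * C)^-1.
Let t0 : 0 < t. Proof. by rewrite invr_gt0 mulr_gt0// (lt_le_trans _ C1). Qed.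
Let t1 : t <= 1.
Proof. rewrite invf_le1 ?mulr_gt0 ?(lt_le_trans _ C1)//; move: C1; lra. Qed.
Let b := t / 3.
Let b0 : 0 < b. Proof. by rewrite divr_gt0. Qed.
Let tb : t = 3 * b. Proof. by rewrite /b mulrC divfK. Qed.

Let u m := f (th m) - fh.
Let G m := enorm (g (th m)).

Let next_ex : exists nxt : nat -> nat, \forall m \near \oo,
  (m < nxt m)%N /\ t / 2 <= gam (nxt m) - gam m <= t.
Proof.
pose Q m k := (m < k)%N /\ t / 2 <= gam k - gam m <= t.
have : forall m, exists k, (exists k', Q m k') -> Q m k.
  by move=> m; have [[k Qk]|no] := pselect (exists k', Q m k'); [exists k|exists 0%N].
move=> /choice [nxt hn]; exists nxt.
have := next_exists al_gt0 al_cvg0 al_sum t0; apply: filterS => m; exact: hn.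
Qed.

Let nxt := projT1 (cid next_ex).

Let nxt_spec : \forall m \near \oo, (m < nxt m)%N /\ t / 2 <= gam (nxt m) - gam m <= t.
Proof. exact: projT2 (cid next_ex). Qed.

Let nxtP : \forall m \near \oo, (m < nxt m)%N /\ gam (nxt m) <= gam m + t.
Proof. by apply: filterS nxt_spec => m [-> /andP[_ h]]; split=> //; rewrite -lerBlDl. Qed.

(** The end of a window is at time at least [t / 2], so the decrease is at least
[t/2 - t/6 = t/3] times the squared gradient. *)
Let step x : 0 < x -> \forall m \near \oo,
  u (nxt m) <= u m - b * G m ^+ 2 + x * gam m `^ (- (2 * r)) /\
  forall k, (m <= k <= nxt m)%N -> u k <= u m + t * G m ^+ 2 + x * gam m `^ (- (2 * r)).
Proof.
move=> x0; have C0 : 0 < C by apply: lt_le_trans C1.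
pose K := 8 ^+ 3 * C.
have K0 : 0 < K by rewrite mulr_gt0// exprn_gt0.
(* the noise enters squared, with the constant [K] of [window_descent] *)
pose eps := Num.sqrt (x / K).
have eps0 : 0 < eps by rewrite sqrtr_gt0 divr_gt0.
near=> m.
have [mn /andP[n1 n2]] : (m < nxt m)%N /\ t / 2 <= gam (nxt m) - gam m <= t.
  by near: m; exact: nxt_spec.
have gm0 : 0 < gam m by apply: (lt_le_trans ltr01); near: m; exact: gamma_oo.
have nz : forall k, (m <= k)%N ->
  gam k - gam m <= 1 -> enorm (\sum_(m <= i < k) al i *: e i) <= eps * gam m `^ (- r).
  by near: m; exact: noise.
have eE : K * (eps * gam m `^ (- r)) ^+ 2 = x * gam m `^ (- (2 * r)).
  rewrite exprMn sqr_sqrtr; last by rewrite ltW// divr_gt0.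
  rewrite -powR_mulrn ?powR_ge0// -powRrM mulrA mulrCA mulfV ?gt_eqF// mulr1.
  by congr (_ * powR _ _); ring.
have W k : (m <= k)%N -> (k <= nxt m)%N -> u k <= u m - (gam k - gam m) * G m ^+ 2
    + t / 6 * G m ^+ 2 + x * gam m `^ (- (2 * r)).
  move=> mk kn; have st j : (m <= j)%N -> (j <= k)%N -> gam j - gam m <= t.
    move=> mj jk; apply: le_trans n2; rewrite lerD2r; apply: gamma_nd => //.
    exact: leq_trans kn.
  rewrite -eE gamma_sub// /u.
  have := @window_descent _ _ f g B C al th e C1 smooth (fun i => ltW (al_gt0 i)) thB algo
    m k (eps * gam m `^ (- r)).
  rewrite mulr_ge0 ?powR_ge0 ?(ltW eps0)// => /(_ isT mk).
  rewrite -gamma_sub// st// => /(_ isT) h.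
  have {}h := h (fun j hj => nz j (andP hj).1 (le_trans (st j (andP hj).1 (andP hj).2) t1)).
  by rewrite /G /K; move: h; rewrite -/t; lra.
have G20 : 0 <= G m ^+ 2 by exact: sqr_ge0.
split.
  have := W _ (ltnW mn) (leqnn _); have := ler_wpM2r G20 n1; rewrite /b; lra.
move=> k /andP[mk kn]; have := W k mk kn.
have s0 : 0 <= gam k - gam m by rewrite subr_ge0 gamma_nd.
have := mulr_ge0 s0 G20; have := mulr_ge0 (ltW t0) G20; lra.
Unshelve. all: by end_near. Qed.

Let G0 m : 0 <= G m. Proof. exact: enorm_ge0. Qed.
Let gnd := gamma_nd al_gt0.
Let goo := gamma_oo al_gt0 al_sum.

Lemma descent_rates :
  [/\ forall x, 0 < x -> \forall k \near \oo, G k ^+ 2 <= x,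
   1 <= r * (2 - mu) -> exists A, \forall k \near \oo,
    `|u k| <= A * gam k `^ (- (mu * (2 - mu)^-1)) /\
    G k ^+ 2 <= A * gam k `^ (- (mu * (2 - mu)^-1)) &
   r * (2 - mu) < 1 -> forall A, 0 < A -> \forall k \near \oo,
    `|u k| <= A * gam k `^ (- (mu * r)) /\ G k ^+ 2 <= A * gam k `^ (- (mu * r))].
Proof.
split.
- exact: (G_small b0 tb M1 mu1 r0 delta0 goo G0 nxtP step u_linf u_freq loj).
- exact: (rate_big_O b0 tb M1 mu1 mu2 r0 delta0 gnd goo G0 nxtP step u_linf u_freq loj).
- exact: (rate_little_o b0 tb M1 mu1 mu2 r0 delta0 gnd goo G0 nxtP step u_linf u_freq loj).
Qed.

End trajectory.

(** * The network, its risk and its gradient *)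

Lemma derive_line (R : realType) (n : nat) (f : 'rV[R]_n -> R) (t v : 'rV[R]_n) (c : R) :
  is_derive (0 : R) (1 : R) (fun h => f (t + h *: v)) c -> 'D_v f t = c.
Proof.
move=> D; rewrite -(@derive_val _ _ _ _ _ _ _ D) /derive.
set F := (F in lim (F @ _) = _); set F' := (F in _ = lim (F @ _)).
suff -> : F = F' by [].
apply/funext => h; rewrite /F /F' /= scale0r addr0 [h *: 1]mulr1 addr0.
by rewrite [t + _]addrC.
Qed.

(** A quadratic remainder on a neighbourhood determines the directional derivative. *)
Lemma derive_taylor (R : realType) (n : nat) (f : 'rV[R]_n -> R) (t v : 'rV[R]_n)
  (c K e : R) : 0 < e ->
  (forall h, `|h| < e -> `|f (t + h *: v) - f t - h * c| <= K * h ^+ 2) ->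
  'D_v f t = c.
Proof.
move=> e0 hf; rewrite /derive; apply/cvg_lim => //.
apply/cvgrPdist_le => eps eps0.
have K1 : 0 < `|K| + 1 by rewrite ltr_wpDl.
near=> h.
have hn0 : h != 0 by near: h; exact: nbhs_dnbhs_neq.
have hh : `|h| < Num.min e (eps / (`|K| + 1)).
  near: h; apply: dnbhs0_lt; by rewrite lt_min e0 divr_gt0.
move: hh; rewrite lt_min => /andP[he hk].
rewrite /= [h *: v + t]addrC.
have -> : c - h^-1 *: (f (t + h *: v) - f t) = - h^-1 * (f (t + h *: v) - f t - h * c).
  by rewrite mulrBr mulNr mulrA mulNr mulVf// mulN1r opprK addrC.
rewrite normrM normrN normfV -ler_pdivlMl ?invr_gt0 ?normr_gt0// invrK.
apply: le_trans (hf h he) _.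
rewrite -[h ^+ 2]real_normK ?num_real// expr2 mulrCA ler_wpM2l//.
move: hk; rewrite ltr_pdivlMr// => hk.
apply: le_trans (_ : (`|K| + 1) * `|h| <= _); last by rewrite mulrC ltW.
by rewrite ler_wpM2r// (le_trans (ler_norm K))// lerDl.
Unshelve. all: by end_near. Qed.

Section network.
Context (R : realType) (N1 N2 : nat) dT (T : measurableType dT).
Variables (phi1 phi2 : R -> R) (psi : 'I_N2 -> T -> R) (y : T -> R).
Notation Theta := 'rV[R]_(dtheta N1 N2).
Implicit Types (t v : Theta) (z : T).
Hypotheses (aphi1 : forall s, analytic_at phi1 s) (aphi2 : forall s, analytic_at phi2 s).

Definition unit_in t z i : R := \sum_(j < N2) inner_w t i j * psi j z.
Definition net_in t z : R := \sum_(i < N1) outer_w t i * phi2 (unit_in t z i).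
Definition net t z : R := phi1 (net_in t z).
(** The derivative of the network at [t] in the direction [v], by the chain rule. *)
Definition dnet t v z : R := derive1 phi1 (net_in t z) *
  \sum_(i < N1) (outer_w v i * phi2 (unit_in t z i) +
     outer_w t i * (derive1 phi2 (unit_in t z i) * unit_in v z i)).

Definition half_sq t z : R := 2^-1 * (y z - net t z) ^+ 2.
(** Minus the partial derivative of [half_sq], that is, the direction of the update. *)
Definition gradient_sample l t z : R := (y z - net t z) * dnet t (delta_mx 0 l) z.

Let outer_line t v h i : outer_w (t + h *: v) i = outer_w t i + h * outer_w v i.
Proof. by rewrite /outer_w !mxE. Qed.

Let inner_line t v h i j : inner_w (t + h *: v) i j = inner_w t i j + h * inner_w v i j.
Proof. by rewrite /inner_w !mxE. Qed.

Lemma unit_line t v h z i : unit_in (t + h *: v) z i = unit_in t z i + h * unit_in v z i.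
Proof.
rewrite /unit_in mulr_sumr -big_split/=; apply: eq_bigr => j _.
by rewrite inner_line; ring.
Qed.

Let is_derive_affine (a c h : R) : is_derive h (1 : R) (fun x => a + x * c) c.
Proof.
have D := is_deriveD (is_derive_cst a h (1 : R))
  (is_deriveM (is_derive_id h (1 : R)) (is_derive_cst c h (1 : R))).
apply: (is_derive_eq D).
by rewrite /= scaler0 !add0r /GRing.scale/= mulr1.
Qed.

Let is_derive_analytic (phi : R -> R) s : analytic_at phi s -> is_derive s (1 : R) phi (derive1 phi s).
Proof.
by move=> /analytic_derive[d _]; rewrite derive1E; exact: derivableP.
Qed.

Lemma net_line t v z h :
  is_derive h (1 : R) (fun x => net (t + x *: v) z) (dnet (t + h *: v) v z).
Proof.
have Du i : is_derive h (1 : R) (fun x => phi2 (unit_in (t + x *: v) z i))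
    (derive1 phi2 (unit_in (t + h *: v) z i) * unit_in v z i).
  have := @is_derive1_comp R phi2 (fun x => unit_in t z i + x * unit_in v z i) h _ _
    (is_derive_analytic (aphi2 _)) (is_derive_affine _ _ _).
  rewrite unit_line; congr is_derive.
  by apply/funext => x; rewrite /= unit_line.
have Ds : is_derive h (1 : R) (fun x => net_in (t + x *: v) z)
  (\sum_(i < N1) (outer_w v i * phi2 (unit_in (t + h *: v) z i) +
     outer_w (t + h *: v) i * (derive1 phi2 (unit_in (t + h *: v) z i) * unit_in v z i))).
  have -> : (fun x => net_in (t + x *: v) z) = \sum_(i < N1)
     ((fun x => outer_w t i + x * outer_w v i) * (fun x => phi2 (unit_in (t + x *: v) z i))).
    apply/funext => x; rewrite fct_sumE; apply: eq_bigr => i _.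
    by rewrite outer_line.
  apply: is_derive_sum => i.
  apply: (is_derive_eq (is_deriveM (is_derive_affine (outer_w t i) (outer_w v i) h) (Du i))).
  by rewrite /GRing.scale/= outer_line; ring.
have := @is_derive1_comp R phi1 (fun x => net_in (t + x *: v) z) h _ _
  (is_derive_analytic (aphi1 _)) Ds.
by [].
Qed.

Lemma dnet_linear t a v w z : dnet t (a *: v + w) z = a * dnet t v z + dnet t w z.
Proof.
rewrite /dnet mulrCA -mulrDr; congr (_ * _); rewrite mulr_sumr -big_split/=.
apply: eq_bigr => i _.
have -> : unit_in (a *: v + w) z i = a * unit_in v z i + unit_in w z i.
  rewrite /unit_in mulr_sumr -big_split/=; apply: eq_bigr => j _.
  by rewrite /inner_w !mxE; ring.
have -> : outer_w (a *: v + w) i = a * outer_w v i + outer_w w i by rewrite /outer_w !mxE.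
ring.
Qed.

Lemma dnet_sum t v z : dnet t v z = \sum_l v 0 l * dnet t (delta_mx 0 l) z.
Proof.
have d0 : dnet t 0 z = 0.
  by have := dnet_linear t (-1) 0 0 z; rewrite scaler0 addr0; lra.
rewrite {1}[v]row_sum_delta; elim/big_rec2: _ => // l x w _ <-.
by rewrite dnet_linear.
Qed.

Lemma half_sq_line t v z h : is_derive h (1 : R) (fun x => half_sq (t + x *: v) z)
  (- \sum_l v 0 l * gradient_sample l (t + h *: v) z).
Proof.
have N := net_line t v z h.
have E : is_derive h (1 : R) (fun x => y z - net (t + x *: v) z) (- dnet (t + h *: v) v z).
  have -> : (fun x => y z - net (t + x *: v) z) = cst (y z) - (fun x => net (t + x *: v) z).
    by apply/funext.
  by apply: is_derive_eq; rewrite sub0r.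
have -> : (fun x => half_sq (t + x *: v) z) =
    2^-1 \*: ((fun x => y z - net (t + x *: v) z) ^+ 2).
  by apply/funext => x.
apply: is_derive_eq; rewrite /GRing.scale/= expr1.
rewrite /gradient_sample; under eq_bigr do rewrite mulrCA.
rewrite -mulr_sumr -dnet_sum; set w := y z - _; set q := dnet _ _ _; lra.
Qed.

(** The mean value theorem along the segment, the derivative being Lipschitz on it. *)
Lemma half_sq_taylor (Q : set Theta) (K : R) t v z :
  (forall l t t', Q t -> Q t' ->
    `|gradient_sample l t z - gradient_sample l t' z| <= K * `|t - t'|) ->
  0 <= K ->
  (forall x : R, 0 <= x <= 1 -> Q (t + x *: v)) ->
  `|half_sq (t + v) z - half_sq t z + \sum_l v 0 l * gradient_sample l t z|
    <= (dtheta N1 N2)%:R * K * `|v| ^+ 2.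
Proof.
move=> lip K0 Qv.
pose F x := half_sq (t + x *: v) z.
pose dF x := - \sum_l v 0 l * gradient_sample l (t + x *: v) z.
have dFP x : is_derive x (1 : R) F (dF x) by exact: half_sq_line.
have [c c01 Fc] : exists2 c, c \in `]0, 1[%R & F 1 - F 0 = dF c * (1 - 0).
  apply: (@MVT R F dF 0 1 ltr01).
  apply: continuous_subspaceT => x; apply: differentiable_continuous.
  by apply/derivable1_diffP; have := dFP x; case.
move: c01; rewrite in_itv/= => /andP[c0 c1].
have -> : half_sq (t + v) z - half_sq t z = dF c.
  by have := Fc; rewrite /F scale1r scale0r addr0 subr0 mulr1.
rewrite /dF addrC -sumrB.
apply: le_trans (ler_norm_sum _ _ _) _.
apply: le_trans (_ : \sum_(l < dtheta N1 N2) `|v| * (K * `|v|) <= _).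
  apply: ler_sum => l _; rewrite -mulrBr normrM ler_pM//; first exact: coord_le_norm.
  have Qt : Q t by have := Qv 0; rewrite scale0r addr0 lexx ler01; apply.
  have Qtc : Q (t + c *: v) by apply: Qv; rewrite !ltW.
  apply: le_trans (lip l _ _ Qt Qtc) _.
  rewrite opprD addrA subrr sub0r normrN normrZ (gtr0_norm c0).
  by rewrite ler_wpM2l// ler_piMl// ltW.
rewrite sumr_const card_ord -mulr_natl.
by rewrite le_eqVlt; apply/orP; left; apply/eqP; ring.
Qed.

Lemma gradE_net t z : grad (fun s => net s z) t = \row_l dnet t (delta_mx 0 l) z.
Proof.
apply/rowP => l; rewrite !mxE; apply: derive_line.
by have := net_line t (delta_mx 0 l) z 0; rewrite scale0r addr0.
Qed.

Section statistics.
Context d (Omega : measurableType d) (P : probability Omega R) (pi : probability T R)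
  (Z : nat -> Omega -> T).
Hypothesis mZ : forall n, measurable_fun setT (Z n).
Hypothesis iidZ : iid_with_law P pi Z.
Variable L : R.
Hypotheses (mpsi : forall k, measurable_fun setT (psi k)) (my : measurable_fun setT y)
  (psiL : forall k z, `|psi k z| <= L) (yL : forall z, `|y z| <= L).

Notation germ := (germ P pi Z).

Let germ_cst t0 (a : R) : germ t0 (fun _ _ => a).
Proof. exact: (germ_fun P pi Z t0 (b := cst a) (K := `|a|)). Qed.

Let germ_unit t0 i : germ t0 (fun t z => unit_in t z i).
Proof.
apply: germ_sum => j; apply: germ_mul; first exact: germ_coord.
exact: (germ_fun P pi Z t0 (mpsi j) (psiL j)).
Qed.

Let germ_dunit t0 v i : germ t0 (fun _ z => unit_in v z i).
Proof.
apply: germ_sum => j; apply: germ_mul; first exact: germ_cst.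
exact: (germ_fun P pi Z t0 (mpsi j) (psiL j)).
Qed.

Let aphi1' s : analytic_at (derive1 phi1) s. Proof. exact: (analytic_derive (aphi1 s)).2. Qed.
Let aphi2' s : analytic_at (derive1 phi2) s. Proof. exact: (analytic_derive (aphi2 s)).2. Qed.

Let germ_in t0 : germ t0 net_in.
Proof.
apply: germ_sum => i; apply: germ_mul; first exact: germ_coord.
exact: (germ_comp aphi2 (germ_unit t0 i)).
Qed.

Let germ_err t0 : germ t0 (fun t z => y z - net t z).
Proof.
apply: germ_eq (germ_add (germ_fun P pi Z t0 my yL)
  (germ_mul (germ_cst t0 (-1)) (germ_comp aphi1 (germ_in t0)))) => t z.
by rewrite /net mulN1r.
Qed.

(** The sample gradient is built from coordinates of [t], bounded functions of the sample
and the analytic functions [phi1], [phi2], [phi1'], [phi2'] by sums, products and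
compositions. *)
Lemma germ_gradient_sample t0 l : germ t0 (gradient_sample l).
Proof.
apply: germ_mul; first exact: germ_err.
apply: germ_mul; first exact: (germ_comp aphi1' (germ_in t0)).
apply: germ_sum => i; apply: germ_add.
  by apply: germ_mul; [exact: germ_cst|exact: (germ_comp aphi2 (germ_unit t0 i))].
apply: germ_mul; first exact: germ_coord.
apply: germ_mul; last exact: germ_dunit.
exact: (germ_comp aphi2' (germ_unit t0 i)).
Qed.

Lemma germ_half_sq t0 : germ t0 half_sq.
Proof.
apply: germ_mul; first exact: germ_cst.
apply: germ_eq (germ_mul (germ_err t0) (germ_err t0)) => t z.
by rewrite expr2.
Qed.

Definition mean_risk t : R := \int[pi]_z half_sq t z.
Definition mean_grad t : Theta := - \row_l \int[pi]_z gradient_sample l t z.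

Let germ_int t0 B : germ t0 B -> pi.-integrable setT (EFin \o B t0).
Proof. by move=> [mB [K BK] _]; exact: (bounded_integrable pi mB BK). Qed.

Let ballc (rad : R) : set Theta := [set t | `|t| <= rad].

(** From the Lipschitz part of [good], which is uniform in the sample. *)
Lemma gradient_sample_lip rad : exists2 K : R, 1 <= K & forall l t t' z,
  `|t| <= rad -> `|t'| <= rad ->
  `|gradient_sample l t z - gradient_sample l t' z| <= K * `|t - t'|.
Proof.
have : forall l, exists K : R, 0 <= K /\ forall t t' z, ballc rad t -> ballc rad t' ->
  `|gradient_sample l t z - gradient_sample l t' z| <= K * `|t - t'|.
  move=> l; have [delta [C [d0 [C0 _ tF _]]]] := good_compact mZ iidZ
    (@compact_normball R (dtheta N1 N2) rad) (fun t0 _ => germ_gradient_sample t0 l).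
  exists (C / delta); split; first by rewrite divr_ge0// ltW.
  move=> t t' z Qt Qt'; have := (tF z).2 _ _ Qt Qt'.
  by rewrite mulrAC ler_pdivlMr// mulrC.
move=> /choice[K KP]; exists (1 + \sum_l K l).
  by rewrite lerDl; apply: sumr_ge0 => l _; have [] := KP l.
move=> l t t' z Qt Qt'; have [_ h] := KP l.
apply: le_trans (h t t' z Qt Qt') _; rewrite ler_wpM2r//.
rewrite (bigD1 l)//= addrCA lerDl addr_ge0//.
by apply: sumr_ge0 => k _; have [] := KP k.
Qed.

(** The estimates for one sample are uniform in it, hence may be integrated. *)
Lemma mean_risk_smooth : smooth_on_balls mean_risk mean_grad.
Proof.
move=> rad; have [K K1 hK] := gradient_sample_lip rad.
have K0 : 0 <= K by apply: le_trans K1.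
exists (1 + (dtheta N1 N2)%:R * K); first by rewrite lerDl mulr_ge0.
split=> t t' Qt Qt'.
  apply: le_trans (enorm_le_sum _) _.
  apply: le_trans (_ : \sum_(l < dtheta N1 N2) K * enorm (t - t') <= _).
    apply: ler_sum => l _; rewrite !mxE opprK.
    have -> : - (\int[pi]_z gradient_sample l t z) + (\int[pi]_z gradient_sample l t' z) =
       \int[pi]_z (gradient_sample l t' z - gradient_sample l t z).
      by rewrite RintegralB//; [rewrite addrC|exact: germ_int (germ_gradient_sample _ _)|exact: germ_int (germ_gradient_sample _ _)].
    apply: norm_Rintegral_le.
      have [m1 _ _] := germ_gradient_sample t l.
      have [m2 _ _] := germ_gradient_sample t' l; exact: measurable_funB.
    move=> z; rewrite distrC; apply: le_trans (hK l t t' z Qt Qt') _.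
    by rewrite ler_wpM2l// norm_le_enorm.
  rewrite sumr_const card_ord -[leLHS]mulr_natl mulrA ler_wpM2r ?enorm_ge0//.
  by rewrite lerDr.
pose v := t' - t.
have Qv x : 0 <= x <= 1 -> `|t + x *: v| <= rad.
  move=> /andP[x0 x1]; rewrite /v scalerBr addrCA -[X in _ + (X - _)]scale1r -scalerBl.
  apply: le_trans (ler_normD _ _) _; rewrite !normrZ (ger0_norm x0) ger0_norm ?subr_ge0//.
  have x1' : 0 <= 1 - x by rewrite subr_ge0.
  have := ler_wpM2l x0 Qt'; have := ler_wpM2l x1' Qt; lra.
have key z : `|half_sq t' z - half_sq t z + \sum_l v 0 l * gradient_sample l t z|
    <= (dtheta N1 N2)%:R * K * `|v| ^+ 2.
  have := @half_sq_taylor (ballc rad) K t v z _ K0 Qv.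
  have -> : t + v = t' by rewrite /v addrC subrK.
  by apply => l s s' Qs Qs'; exact: hK.
have ints l : pi.-integrable setT (EFin \o (fun z => v 0 l * gradient_sample l t z)).
  by have := integrableZl measurableT (v 0 l) (germ_int (germ_gradient_sample t l)); apply: eq_integrable.
have intsum (s : seq 'I_(dtheta N1 N2)) :
    pi.-integrable setT (EFin \o (fun z => \sum_(l <- s) v 0 l * gradient_sample l t z)) /\
    \int[pi]_z (\sum_(l <- s) v 0 l * gradient_sample l t z) =
    \sum_(l <- s) v 0 l * \int[pi]_z gradient_sample l t z.
  elim: s => [|l s [i1 i2]].
    split.
      have -> : (fun z => \sum_(l <- [::]) v 0 l * gradient_sample l t z) = cst 0.
        by apply/funext => z; rewrite big_nil.
      by apply: (bounded_integrable pi (K := 0)) => // z; rewrite normr0.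
    under eq_Rintegral do rewrite big_nil.
    by rewrite Rintegral_cst// mul0r big_nil.
  have E : (fun z => \sum_(l <- l :: s) v 0 l * gradient_sample l t z) =
    (fun z => v 0 l * gradient_sample l t z + \sum_(l <- s) v 0 l * gradient_sample l t z).
    by apply/funext => z; rewrite big_cons.
  rewrite E; split.
    by have := integrableD measurableT (ints l) i1; apply: eq_integrable.
  rewrite RintegralD// i2 RintegralZl//; last exact: germ_int (germ_gradient_sample _ _).
  by rewrite big_cons.
have [i1 i2] := intsum (index_enum _).
have ih s := germ_int (germ_half_sq s).
have i3 : pi.-integrable setT (EFin \o (fun z => half_sq t' z - half_sq t z)).
  by have := integrableB measurableT (ih t') (ih t); apply: eq_integrable.
have -> : mean_risk t' - mean_risk t - ip (mean_grad t) (t' - t) =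
   \int[pi]_z (half_sq t' z - half_sq t z + \sum_l v 0 l * gradient_sample l t z).
  rewrite RintegralD// RintegralB// i2; congr (_ + _).
  by rewrite /ip -sumrN; apply: eq_bigr => l _; rewrite !mxE; ring.
apply: le_trans (norm_Rintegral_le pi _ key) _.
  apply: measurable_funD.
    have [m1 _ _] := germ_half_sq t; have [m2 _ _] := germ_half_sq t'.
    exact: measurable_funB.
  apply: measurable_sum => l; have [m1 _ _] := germ_gradient_sample t l.
  by apply: measurable_funM => //; exact: measurable_cst.
apply: ler_pM; rewrite ?mulr_ge0 ?sqr_ge0//; first by rewrite lerDr.
by rewrite lerXn2r ?nnegrE ?enorm_ge0// norm_le_enorm.
Qed.

(** The quadratic remainder of [mean_risk_smooth] identifies the gradient, without
differentiating under the integral. *)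
Lemma grad_mean_risk t : grad mean_risk t = mean_grad t.
Proof.
have [C C1 [_ hC]] := mean_risk_smooth (`|t| + 1).
apply/rowP => l; rewrite !mxE.
apply: (@derive_taylor _ _ _ _ _ _ C 1) => // h h1.
have C0 : 0 <= C by apply: le_trans C1.
set v := delta_mx 0 l.
have v1 : enorm v = 1.
  rewrite /enorm (bigD1 l)//= big1 ?addr0; first by rewrite mxE !eqxx expr1n sqrtr1.
  by move=> j jl; rewrite mxE eqxx/= (negbTE jl) expr0n.
have v1' : `|v| <= 1.
  by apply: norm_le_coord => // j; rewrite -v1; exact: coord_le_enorm.
have := hC t (t + h *: v); rewrite /= lerDl ler01 => /(_ isT).
have -> : t + h *: v - t = h *: v by rewrite addrC addKr.
rewrite ipZr enormZ v1 mulr1 real_normK ?num_real//.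
have -> : ip (mean_grad t) v = mean_grad t 0 l.
  rewrite /ip (bigD1 l)//= big1 ?addr0; first by rewrite [v _ _]mxE !eqxx mulr1.
  by move=> j jl; rewrite [v _ _]mxE eqxx/= (negbTE jl) mulr0.
rewrite !mxE; apply; apply: le_trans (ler_normD _ _) _; rewrite lerD2l normrZ.
by rewrite -[1]mulr1 ler_pM// ltW.
Qed.

End statistics.
End network.

(** * Limit points of a bounded trajectory *)

Lemma liminf_bounded (R : realType) (v : nat -> R) (K : R) : (forall k, `|v k| <= K) ->
  let l := fine (limn_einf (fun k => (v k)%:E)) in
  (forall x, 0 < x -> \forall m \near \oo, l - x <= v m) /\
  (forall x N, 0 < x -> exists2 m, (N <= m)%N & v m <= l + x).
Proof.
move=> vK l; set V := (fun k => (v k)%:E).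
have E : limn_einf V = ereal_sup (range (einfs V)).
  by rewrite limn_einf_lim; apply/cvg_lim => //; exact: cvg_einfs_sup.
have einfs_ge n : ((- K)%:E <= einfs V n)%E.
  apply: le_ereal_inf_tmp => _ [k /= _ <-]; rewrite lee_fin.
  by have := vK k; rewrite ler_norml => /andP[].
have einfs_le n k : (n <= k)%N -> (einfs V n <= (v k)%:E)%E.
  by move=> nk; apply: ereal_inf_lbound; exists k.
have lfin : limn_einf V = l%:E.
  rewrite fineK// fin_numElt E; apply/andP; split.
    apply: (lt_le_trans (ltNyr (- K))); apply: le_trans (einfs_ge 0%N) _.
    by apply: ereal_sup_ubound; exists 0%N.
  apply: (@le_lt_trans _ _ K%:E); last by rewrite ltry.
  apply: ge_ereal_sup => _ [n _ <-]; apply: le_trans (einfs_le n n (leqnn _)) _.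
  by rewrite lee_fin; exact: le_trans (ler_norm _) (vK n).
split=> [x x0|x N x0].
  have : ((l - x)%:E < ereal_sup (range (einfs V)))%E.
    by rewrite -E lfin lte_fin ltrBlDr ltrDl.
  move=> /ereal_sup_gt[_ [n _ <-] hn]; exists n => // k /= nk.
  by rewrite -lee_fin; apply: le_trans (ltW hn) (einfs_le n k nk).
have : (einfs V N < (l + x)%:E)%E.
  apply: (@le_lt_trans _ _ l%:E); last by rewrite lte_fin ltrDl.
  by rewrite -lfin E; apply: ereal_sup_ubound; exists N.
move=> /ereal_inf_lt[_ [k /= Nk <-] hk]; exists k => //.
by rewrite -lee_fin ltW.
Qed.

Section distance.
Context (R : realType) (T : Type) (d : T -> T -> R).

Lemma dist_to_le x (A : set T) a : A a -> (dist_to d x A <= (d x a)%:E)%E.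
Proof. by move=> Aa; apply: ereal_inf_lbound; exists a. Qed.

Lemma dist_to_leP x (A : set T) (c : R) : (dist_to d x A <= c%:E)%E <->
  forall e : R, 0 < e -> exists2 a, A a & d x a < c + e.
Proof.
split=> [h e e0|h].
  have : (dist_to d x A < (c + e)%:E)%E by apply: le_lt_trans h _; rewrite lte_fin ltrDl.
  by move=> /ereal_inf_lt[_ [a Aa <-]]; rewrite lte_fin => ha; exists a.
apply/lee_addgt0Pr => e e0; have [a Aa ha] := h e e0.
by apply: le_trans (dist_to_le x Aa) _; rewrite -EFinD lee_fin ltW.
Qed.

End distance.

Section clusters.
Context (R : realType) (n : nat).
Notation V := 'rV[R]_n.
Variable th : nat -> V.

Lemma A_hat_freq a (e : R) N : A_hat th a -> 0 < e ->
  exists2 k, (N <= k)%N & `|th k - a| < e.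
Proof.
move=> Aa e0; have [] := Aa [set t | exists2 k, (N <= k)%N & t = th k] (ball a e) _ (nbhsx_ballx _ _ e0).
  by exists N => // k /= Nk; exists k.
by move=> t [[k Nk ->]]; rewrite -ball_normE/= distrC => h; exists k.
Qed.

Lemma not_A_hat a : ~ A_hat th a -> exists e N, 0 < e /\
  forall k, (N <= k)%N -> ~ ball a (e : R) (th k).
Proof.
move=> nA; apply: contrapT => no; apply: nA => A B [N _ hN] /nbhs_ballP[e /= e0 he].
apply: contrapT => AB0; apply: no; exists e, N; split=> // k Nk hk.
by apply: AB0; exists (th k); split; [exact: hN|exact: he].
Qed.

Variable rad : R.
Hypothesis thr : forall k, `|th k| <= rad.

Lemma A_hat_norm a : A_hat th a -> `|a| <= rad.
Proof.
move=> Aa; apply/ler_addgt0Pr => e e0; have [k _ hk] := A_hat_freq 0%N Aa e0.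
rewrite -(subrK (th k) a); apply: le_trans (ler_normD _ _) _.
rewrite distrC addrC; apply: lerD; [exact: thr|exact: ltW].
Qed.

Variable f : V -> R.
Hypothesis cf : continuous f.

Let fK : exists K, forall k, `|f (th k)| <= K.
Proof.
have [M [_ HM]] : bounded_set (f @` [set t : V | `|t| <= rad]).
  apply: compact_bounded; apply: continuous_compact; last exact: compact_normball.
  exact: continuous_subspaceT.
by exists (M + 1) => k; apply: HM; [rewrite ltrDl|exists (th k) => //=; exact: thr].
Qed.

Lemma f_hat_linf x : 0 < x -> \forall m \near \oo, - x <= f (th m) - f_hat f th.
Proof.
have [K hK] := fK; have [h _] := liminf_bounded hK.
by move=> /h; apply: filterS => m; rewrite /f_hat; set l := fine _; lra.
Qed.

Lemma f_hat_freq x N : 0 < x -> exists2 m, (N <= m)%N & f (th m) - f_hat f th <= x.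
Proof.
have [K hK] := fK; have [_ h] := liminf_bounded hK.
by move=> x0; have [m Nm hm] := h x N x0; exists m => //; move: hm; rewrite /f_hat; set l := fine _; lra.
Qed.

(** If [f > fhat] at every limit point, then by compactness [f (th k)] would eventually
exceed [fhat] by a fixed amount.  Thus [fhat] belongs to the image of [f] on the set of
limit points, as the Lojasiewicz inequality at the level [fhat] requires; equality holds
because limit points are limits of values at least [fhat]. *)
Lemma f_hat_attained : exists2 a, A_hat th a & f a = f_hat f th.
Proof.
set l := f_hat f th.
have [a Aa fa] : exists2 a, A_hat th a & f a <= l.
  apply: contrapT => no.
  have [U [_ BU [e [N [e0 hU]]]]] : exists U, [/\ open U, [set t : V | `|t| <= rad] `<=` U &
     exists e N, 0 < e /\ forall k, (N <= k)%N -> U (th k) -> l + e < f (th k)].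
    apply: compact_open_ind.
    - exact: compact_normball.
    - by exists 1, 0%N.
    - move=> U W _ _ [e1 [N1 [e10 h1]]] [e2 [N2 [e20 h2]]].
      exists (Num.min e1 e2), (maxn N1 N2); split; first by rewrite lt_min e10.
      move=> k; rewrite geq_max => /andP[k1 k2] [Uk|Wk].
        by apply: le_lt_trans (h1 k k1 Uk); rewrite lerD2l ge_min lexx.
      by apply: le_lt_trans (h2 k k2 Wk); rewrite lerD2l ge_min lexx orbT.
    - move=> a _; have [Aa|nAa] := pselect (A_hat th a); last first.
        have [e [N [e0 h]]] := not_A_hat nAa; exists (ball a e); split.
        + exact: ball_open.
        + exact: ballxx.
        + by exists 1, N; split=> // k Nk /(h k Nk).
      have la : l < f a by rewrite ltNge; apply/negP => h; apply: no; exists a.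
      have e0 : 0 < (f a - l) / 2 by rewrite divr_gt0// subr_gt0.
      have /cvgrPdist_lt/(_ _ e0)/nbhs_ballP[dd /= dd0 hd] : f t @[t --> a] --> f a by exact: cf.
      exists (ball a dd); split; [exact: ball_open|exact: ballxx|].
      exists ((f a - l) / 2), 0%N; split=> // k _ /hd /=.
      by rewrite ltr_norml => /andP[_]; lra.
  have [m Nm hm] := f_hat_freq N e0.
  have := hU m Nm (BU _ (thr m)); move: hm; rewrite -/l; lra.
exists a => //; apply/eqP; rewrite eq_le fa/=; apply/ler_addgt0Pr => x x0.
have x2 : 0 < x / 2 by rewrite divr_gt0.
have [N _ hN] := f_hat_linf x2.
have /cvgrPdist_lt/(_ _ x2)/nbhs_ballP[dd /= dd0 hd] : f t @[t --> a] --> f a by exact: cf.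
have [k Nk hk] := A_hat_freq N Aa dd0.
have := hN k Nk; have : ball a dd (th k) by rewrite -ball_normE/= distrC.
move=> /hd /=; rewrite ltr_norml -/l => /andP[h1 _]; lra.
Qed.

Variable rho : R.
Hypothesis rho0 : 0 < rho.

Definition near_A_hat := [set t | (dist_to (@eudist R n) t (A_hat th) <= rho%:E)%E].

(** The trajectory finally leaves some neighbourhood of each point that is not a limit
point; finitely many such neighbourhoods and small balls around limit points cover a ball
that contains the trajectory. *)
Lemma near_A_hat_eventually : \forall k \near \oo, near_A_hat (th k).
Proof.
have [U [_ BU [N hU]]] : exists U, [/\ open U, [set t : V | `|t| <= rad] `<=` U &
   exists N, forall k, (N <= k)%N -> U (th k) -> near_A_hat (th k)].
  apply: compact_open_ind.
  - exact: compact_normball.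
  - by exists 0%N.
  - move=> U W _ _ [N1 h1] [N2 h2]; exists (maxn N1 N2) => k.
    by rewrite geq_max => /andP[k1 k2] [Uk|Wk]; [exact: h1|exact: h2].
  - move=> a _; have [Aa|nAa] := pselect (A_hat th a); last first.
      have [e [N [e0 h]]] := not_A_hat nAa; exists (ball a e); split.
      + exact: ball_open.
      + exact: ballxx.
      + by exists N => k Nk /(h k Nk).
    have n1 : 0 < n%:R + 1 :> R by rewrite ltr_wpDl.
    exists (ball a (rho / (n%:R + 1))).
    have r0 : 0 < rho / (n%:R + 1) by rewrite divr_gt0.
    split; [exact: ball_open|exact: ballxx|exists 0%N => k _].
    rewrite -ball_normE/= => h; apply: le_trans (dist_to_le _ _ Aa) _.
    rewrite lee_fin /eudist; apply: le_trans (enorm_le_norm _) _.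
    move: h; rewrite distrC ltr_pdivlMr// => /ltW; apply: le_trans.
    by rewrite mulrC ler_wpM2l// lerDl.
by exists N => // k /= Nk; apply: hU => //; apply: BU; exact: thr.
Qed.

Lemma near_A_hat_compact : compact near_A_hat.
Proof.
apply: bounded_closed_compact.
  exists (rad + rho + 1); split; first exact: num_real.
  move=> x xr t /dist_to_leP/(_ 1 ltr01)[a Aa ha] /=.
  apply: le_trans (ltW xr).
  rewrite -(subrK a t); apply: le_trans (ler_normD _ _) _.
  have := norm_le_enorm (t - a); have := A_hat_norm Aa; move: ha; rewrite /eudist; lra.
move=> t clt; apply/dist_to_leP => e e0.
have e2 : 0 < e / 2 by rewrite divr_gt0.
have n1 : 0 < n%:R + 1 :> R by rewrite ltr_wpDl.
have r0 : 0 < e / 2 / (n%:R + 1) by rewrite divr_gt0.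
have [t' [Qt' bt']] := clt _ (nbhsx_ballx t _ r0).
have [a Aa ha] := (dist_to_leP _ _ _ _).1 Qt' _ e2; exists a => //.
rewrite /eudist -(subrK t' t) -addrA; apply: le_lt_trans (enormD _ _) _.
have : enorm (t - t') <= e / 2.
  apply: le_trans (enorm_le_norm _) _.
  move: bt'; rewrite -ball_normE/= ltr_pdivlMr// => /ltW; apply: le_trans.
  by rewrite mulrC ler_wpM2l// lerDl.
move: ha; rewrite /eudist; lra.
Qed.

End clusters.

(** * Conclusions for one stable trajectory *)

Lemma smooth_continuous (R : realType) (n : nat) (f : 'rV[R]_n -> R) g :
  smooth_on_balls f g -> continuous f.
Proof.
move=> sf x; have [C C1 [_ hC]] := sf (`|x| + 1).
have C0 : 0 <= C by apply: le_trans C1.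
suff h : f t @[t --> x] --> f x by exact: h.
apply/(@cvgrPdist_le _ _ _ (nbhs x) (nbhs_filter x)) => eps eps0.
pose K := (enorm (g x) + C * n%:R) * n%:R + 1.
have K0 : 0 < K.
  by rewrite ltr_wpDl// mulr_ge0// addr_ge0 ?enorm_ge0// mulr_ge0.
have d0 : 0 < Num.min 1 (eps / K) by rewrite lt_min ltr01 divr_gt0.
apply/nbhs_ballP; exists (Num.min 1 (eps / K)) => // y.
rewrite -ball_normE/= lt_min => /andP[y1 yK].
have xb : `|x| <= `|x| + 1 by rewrite lerDl.
have yb : `|y| <= `|x| + 1.
  rewrite -(subrK x y) addrC; apply: le_trans (ler_normD _ _) _.
  by rewrite lerD2l distrC ltW.
have := hC _ _ xb yb; set v := y - x => h.
have vn : enorm v <= n%:R * `|x - y| by rewrite distrC; exact: enorm_le_norm.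
have cs : `|ip (g x) v| <= enorm (g x) * enorm v.
  rewrite ler_norml cauchy_schwarz andbT lerNl.
  have := cauchy_schwarz (g x) (- v).
  by rewrite -scaleN1r ipZr mulN1r scaleN1r enormN.
have vn0 : n%:R * `|x - y| <= n%:R by rewrite -[leRHS]mulr1 ler_wpM2l// ltW.
have h2 : C * enorm v ^+ 2 <= C * n%:R * enorm v.
  rewrite expr2 -mulrA ler_wpM2l// ler_wpM2r ?enorm_ge0//; exact: le_trans vn vn0.
rewrite distrC -(subrK (ip (g x) v) (f y - f x)).
apply: le_trans (ler_normD _ _) _.
apply: le_trans (_ : (enorm (g x) + C * n%:R) * enorm v <= _).
  by rewrite mulrDl addrC lerD// (le_trans h h2).
apply: le_trans (_ : (enorm (g x) + C * n%:R) * (n%:R * `|x - y|) <= _).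
  by rewrite ler_wpM2l// addr_ge0 ?enorm_ge0// mulr_ge0.
rewrite mulrA; apply: le_trans (_ : K * `|x - y| <= _).
  by rewrite ler_wpM2r// /K lerDl.
by move: yK; rewrite ltr_pdivlMr// mulrC => /ltW.
Qed.

Section trajectory_rates.
Context (R : realType) (n : nat).
Notation V := 'rV[R]_n.
Variables (f : V -> R) (al : nat -> R) (th e : nat -> V).
Local Notation gam := (gamma al).
Hypotheses (sf : smooth_on_balls f (grad f))
  (al_gt0 : forall i, 0 < al i) (al_cvg0 : al n @[n --> \oo] --> 0)
  (al_sum : (\sum_(0 <= n <oo) (al n)%:E = +oo)%E)
  (algo : forall i, th i.+1 = th i - al i *: grad f (th i) + al i *: e i).
Variables (delta mu M : set V -> R -> R) (nu N : set V -> R).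
Hypotheses (lojv : lojasiewicz_value f delta mu M) (lojd : lojasiewicz_dist f nu N).
Variables (r rho rad : R).
Hypotheses (r0 : 0 < r) (rho0 : 0 < rho) (thr : forall k, `|th k| <= rad)
  (st : stable th).
Hypothesis noise : forall eps, 0 < eps -> \forall m \near \oo, forall k, (m <= k)%N ->
  gam k - gam m <= 1 -> enorm (\sum_(m <= i < k) al i *: e i) <= eps * gam m `^ (- r).

Let Q := Q_hat rho th.
Let fh := f_hat f th.
Let m_ := mu Q fh.
Let v_ := nu Q.

Let QE : Q = near_A_hat th rho.
Proof. by rewrite /Q /Q_hat asboolT. Qed.

Let cQ : compact Q. Proof. rewrite QE; exact: (@near_A_hat_compact R n th rad thr rho). Qed.
Let cf : continuous f. Proof. exact: smooth_continuous sf. Qed.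

Let Qfh : (f @` Q) fh.
Proof.
have [a Aa fa] := f_hat_attained thr cf; exists a => //; rewrite QE.
apply/dist_to_leP => x x0; exists a => //.
by rewrite /eudist subrr enorm0 addr_gt0.
Qed.

Let lojQ : [/\ 0 < delta Q fh < 1, 1 < m_ <= 2, 1 <= M Q fh &
  forall t, Q t -> `|f t - fh| <= delta Q fh ->
          `|f t - fh| <= M Q fh * enorm (grad f t) `^ m_].
Proof. exact: lojv cQ Qfh. Qed.

Let m1 : 1 < m_. Proof. by have [_ /andP[]] := lojQ. Qed.
Let m2 : m_ <= 2. Proof. by have [_ /andP[]] := lojQ. Qed.

Let Q_near : \forall k \near \oo, Q (th k).
Proof. by have := @near_A_hat_eventually R n th rad thr rho rho0; rewrite -QE. Qed.

Let u k := f (th k) - fh.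
Let G k := enorm (grad f (th k)).

Let all_rates :
  [/\ forall x, 0 < x -> \forall k \near \oo, G k ^+ 2 <= x,
   1 <= r * (2 - m_) -> exists A, \forall k \near \oo,
    `|u k| <= A * gam k `^ (- (m_ * (2 - m_)^-1)) /\
    G k ^+ 2 <= A * gam k `^ (- (m_ * (2 - m_)^-1)) &
   r * (2 - m_) < 1 -> forall A, 0 < A -> \forall k \near \oo,
    `|u k| <= A * gam k `^ (- (m_ * r)) /\ G k ^+ 2 <= A * gam k `^ (- (m_ * r))].
Proof.
have [C C1 smooth] := sf rad; have [/andP[d0 _] _ M1 lj] := lojQ.
have ljn : \forall m \near \oo, `|f (th m) - fh| <= delta Q fh ->
   `|f (th m) - fh| <= M Q fh * enorm (grad f (th m)) `^ m_.
  by apply: filterS Q_near => k; exact: lj.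
exact: (descent_rates C1 smooth al_gt0 al_cvg0 al_sum thr algo r0 m1 m2 M1 d0 noise
  (f_hat_linf thr cf) (fun x m0 => @f_hat_freq _ _ th rad thr f cf x m0) ljn).
Qed.

(** The limit point at which [f] equals [fhat] is critical, because the gradient tends to
0 along the trajectory.  So the distance of [f (th k)] to the critical values is at most
[|u k|]. *)
Let crit_point : exists2 a, crit f a & f a = fh.
Proof.
have [a Aa fa] := f_hat_attained thr cf; exists a => //.
have [Gs _ _] := all_rates; have [C C1 [gL _]] := sf rad.
have C0 : 0 < C by apply: lt_le_trans C1.
have g0 : enorm (grad f a) <= 0.
  apply/ler_addgt0Pr => x x0; rewrite add0r.
  have x2 : 0 < (x / 2) ^+ 2 by rewrite exprn_gt0// divr_gt0.
  have [K _ hK] := Gs _ x2.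
  have nC : 0 < C * (n%:R + 1) by rewrite mulr_gt0// ltr_wpDl.
  have xC : 0 < x / 2 / (C * (n%:R + 1)) by rewrite !divr_gt0.
  have [k Kk hk] := A_hat_freq K Aa xC.
  have h1 : G k <= x / 2.
    by rewrite -ler_sqr ?nnegrE ?enorm_ge0 ?divr_ge0 ?(ltW x0)//; exact: hK.
  have h2 := gL a (th k) (A_hat_norm thr Aa) (thr k).
  have h3 : C * enorm (a - th k) <= x / 2.
    apply: le_trans (ler_wpM2l (ltW C0) (enorm_le_norm _)) _.
    move: hk; rewrite distrC ltr_pdivlMr// => /ltW; apply: le_trans.
    have -> : C * (n%:R * `|a - th k|) = `|a - th k| * (C * n%:R) by ring.
    by rewrite ler_wpM2l// ler_wpM2l ?(ltW C0)// lerDl.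
  have := enormB_le (grad f a) (grad f (th k)); move: h1; rewrite /G; lra.
have e0 : enorm (grad f a) = 0 by apply/eqP; rewrite eq_le g0 enorm_ge0.
apply/rowP => i; rewrite [RHS]mxE; apply/eqP; rewrite -normr_le0 -e0.
exact: coord_le_enorm.
Qed.

Let grad_sq k := (G k ^+ 2)%:E.
Let dist_C k := dist_to (@rdist R) (f (th k)) (crit_values f).
Let dist_S k := dist_to (@eudist R n) (th k) (crit f).
Let rate (s : R) k := gam k `^ (- s).

Let dist_C_le k : (dist_C k <= (`|u k|)%:E)%E.
Proof.
have [a ca fa] := crit_point.
by apply: (@dist_to_le R R (@rdist R) (f (th k)) (crit_values f) fh); exists a.
Qed.

Let v0 : 0 < v_. Proof. by have [/andP[]] := lojd cQ. Qed.
Let N1 : 1 <= N Q. Proof. by have [] := lojd cQ. Qed.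

(** The second Lojasiewicz inequality: the exponent [nu] applied to the norm is [nu / 2]
applied to its square. *)
Let dist_S_le k A q : Q (th k) -> 0 <= A -> G k ^+ 2 <= A * gam k `^ (- q) ->
  (dist_S k <= (N Q * A `^ (v_ / 2) * rate (q * v_ / 2) k)%:E)%E.
Proof.
move=> Qk A0 Gk; have [_ _ h] := lojd cQ.
have cne : crit f !=set0 by have [a ca _] := crit_point; exists a.
apply: le_trans (h cne _ Qk) _; rewrite lee_fin -mulrA.
apply: ler_wpM2l; first exact: le_trans N1.
have -> : enorm (grad f (th k)) `^ v_ = (G k ^+ 2) `^ (v_ / 2).
  rewrite -powR_mulrn ?enorm_ge0// -powRrM; congr powR; by rewrite mulrCA mulfV// mulr1.
have -> : A `^ (v_ / 2) * rate (q * v_ / 2) k = (A * gam k `^ (- q)) `^ (v_ / 2).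
  rewrite powRM ?powR_ge0// -powRrM; congr (_ * powR _ _); by rewrite mulNr mulrA.
apply: ge0_ler_powR => //; rewrite ?nnegrE ?sqr_ge0//.
- by rewrite divr_ge0// ltW.
- by rewrite mulr_ge0// powR_ge0.
Qed.

Let little_o_of q : (forall A, 0 < A -> \forall k \near \oo,
    `|u k| <= A * gam k `^ (- q) /\ G k ^+ 2 <= A * gam k `^ (- q)) ->
  [/\ little_o grad_sq (rate q), little_o dist_C (rate q) &
      little_o dist_S (rate (q * v_ / 2))].
Proof.
move=> h; split=> x x0.
- by apply: filterS (h x x0) => k [_ ?]; rewrite lee_fin.
- apply: filterS (h x x0) => k [? _]; apply: le_trans (dist_C_le k) _.
  by rewrite lee_fin.
- have NQ : 0 < N Q by apply: lt_le_trans N1.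
  have xN : 0 < x / N Q by rewrite divr_gt0.
  have A0 : 0 < (x / N Q) `^ (2 / v_) by exact: powR_gt0.
  have [K1 _ hK1] := Q_near; have [K2 _ hK2] := h _ A0.
  exists (maxn K1 K2) => // k; rewrite /= geq_max => /andP[/hK1 Qk /hK2 [_ Gk]].
  apply: le_trans (dist_S_le Qk (ltW A0) Gk) _.
  rewrite lee_fin ler_wpM2r ?powR_ge0// -powRrM.
  have -> : 2 / v_ * (v_ / 2) = 1 by field; rewrite gt_eqF.
  by rewrite powRr1 ?(ltW xN)// mulrCA mulfV ?gt_eqF// mulr1.
Qed.

Let big_O_of q : (exists A, \forall k \near \oo,
    `|u k| <= A * gam k `^ (- q) /\ G k ^+ 2 <= A * gam k `^ (- q)) ->
  [/\ big_O grad_sq (rate q), big_O dist_C (rate q) &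
      big_O dist_S (rate (q * v_ / 2))].
Proof.
move=> [A h]; split.
- by exists A; apply: filterS h => k [_ ?]; rewrite lee_fin.
- exists A; apply: filterS h => k [? _]; apply: le_trans (dist_C_le k) _.
  by rewrite lee_fin.
- exists (N Q * (Num.max 0 A) `^ (v_ / 2)).
  have [K1 _ hK1] := Q_near; have [K2 _ hK2] := h.
  exists (maxn K1 K2) => // k; rewrite /= geq_max => /andP[/hK1 Qk /hK2 [_ Gk]].
  apply: dist_S_le => //; first by rewrite le_max lexx.
  by apply: le_trans Gk _; rewrite ler_wpM2r ?powR_ge0// le_max lexx orbT.
Qed.

Let little_o_of_big q p : p < q -> (exists A, \forall k \near \oo,
    `|u k| <= A * gam k `^ (- q) /\ G k ^+ 2 <= A * gam k `^ (- q)) ->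
  little_o grad_sq (rate p) /\ little_o dist_C (rate p).
Proof.
move=> pq [A h].
suff hB : forall B, 0 < B -> \forall k \near \oo,
    `|u k| <= B * gam k `^ (- p) /\ G k ^+ 2 <= B * gam k `^ (- p).
  split=> x x0; apply: filterS (hB x x0) => k [? ?]; first by rewrite lee_fin.
  by apply: le_trans (dist_C_le k) _; rewrite lee_fin.
move=> B B0; pose A' := `|A| + 1; have A'0 : 0 < A' by rewrite ltr_wpDl.
have qp : 0 < q - p by rewrite subr_gt0.
have [T0 T00 small] := powR_small (divr_gt0 B0 A'0) qp.
have [K1 _ hK1] := gamma_oo al_gt0 al_sum T0; have [K2 _ hK2] := h.
exists (maxn K1 K2) => // k; rewrite /= geq_max => /andP[/hK1 hT /hK2 [hu hG]].
have g0 : 0 < gam k by apply: lt_le_trans hT.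
suff hb : A * gam k `^ (- q) <= B * gam k `^ (- p).
  by split; [exact: le_trans hb|exact: le_trans hb].
have -> : - q = - (q - p) + - p by ring.
rewrite powRD_gt0// mulrA ler_wpM2r ?powR_ge0//.
apply: le_trans (_ : A' * gam k `^ (- (q - p)) <= _).
  by rewrite ler_wpM2r ?powR_ge0// (le_trans (ler_norm A))// lerDl.
by have := small _ hT; rewrite ler_pdivlMr// mulrC.
Qed.

Let mu_hatE : mu_hat f mu rho th = m_. Proof. by rewrite /mu_hat asboolT. Qed.
Let nu_hatE : nu_hat f mu nu rho th = m_ * v_ / 2. Proof. by rewrite /nu_hat asboolT. Qed.

Let rhat := r_hat f mu rho th.

Let case_lt : (r%:E < rhat)%E -> [/\ r * (2 - m_) < 1, p_hat f mu r rho th = m_ * r &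
  q_hat f mu nu r rho th = m_ * r * v_ / 2].
Proof.
move=> rr; have rm : r * (2 - m_) < 1.
  move: rr; rewrite /rhat /r_hat mu_hatE; case: (ltP m_ 2) => [m2'|m2'].
    by rewrite lte_fin -[_^-1]mul1r ltr_pdivlMr// subr_gt0.
  have -> : m_ = 2 by apply/eqP; rewrite eq_le m2.
  by rewrite subrr mulr0.
split=> //; first by rewrite /p_hat mu_hatE min_l// ltW.
by rewrite /q_hat nu_hatE min_l/=; [ring|exact: ltW].
Qed.

Let case_ge : (rhat <= r%:E)%E -> [/\ 1 <= r * (2 - m_), m_ < 2,
  p_hat f mu r rho th = m_ * (2 - m_)^-1 &
  q_hat f mu nu r rho th = m_ * (2 - m_)^-1 * v_ / 2].
Proof.
rewrite /p_hat /q_hat mu_hatE nu_hatE -/rhat => rr; rewrite min_r//.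
move: rr; rewrite /rhat /r_hat mu_hatE; case: (ltP m_ 2) => [m2'|m2'].
  rewrite lee_fin -[_^-1]mul1r ler_pdivrMr ?subr_gt0// => h.
  by split=> //=; ring.
by rewrite leye_eq.
Qed.

(** For the exponent [min(1, r)], the exponent [mu * r] exceeds [r] in the first regime and
[mu / (2 - mu)] exceeds 1 in the second, because [mu > 1]. *)
Lemma rates_of_trajectory :
  [/\ little_o grad_sq (rate (Num.min 1 r)) /\ little_o dist_C (rate (Num.min 1 r)),
    (r%:E < rhat)%E ->
      [/\ little_o grad_sq (rate (p_hat f mu r rho th)),
          little_o dist_C (rate (p_hat f mu r rho th)) &
          little_o dist_S (rate (q_hat f mu nu r rho th))] &
    (rhat <= r%:E)%E ->
      [/\ big_O grad_sq (rate (p_hat f mu r rho th)),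
          big_O dist_C (rate (p_hat f mu r rho th)) &
          big_O dist_S (rate (q_hat f mu nu r rho th))]].
Proof.
have [_ HO Ho] := all_rates.
split.
- have [rr|rr] := ltP r%:E rhat.
    have [/Ho h _ _] := case_lt rr.
    apply: (little_o_of_big (q := m_ * r)); last by exists 1; exact: h.
    by apply: le_lt_trans (_ : r < _); rewrite ?ge_min ?lexx ?orbT// ltr_pMl.
  have [/HO h m2' _ _] := case_ge rr.
  apply: little_o_of_big h; apply: le_lt_trans (_ : 1 < _); first by rewrite ge_min lexx.
  by rewrite ltr_pdivlMr ?subr_gt0// mul1r; have := m1; lra.
- by move=> /case_lt[/Ho h -> ->]; exact: little_o_of.
- by move=> /case_ge[/HO h _ -> ->]; exact: big_O_of.
Qed.

End trajectory_rates.

(** * Noise of the algorithm and convergence rates *)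

(** The weights [gamma_i^r] of the uniform estimate are removed by summation by parts
against the nonincreasing [gamma_i^-r], which produces the factor [gamma_m^-r]; the
parameter moves by at most [K] over a window of length 1. *)
Lemma noise_of_uniform (R : realType) (n : nat) (xi : 'I_n -> nat -> 'rV[R]_n -> R)
  (al : nat -> R) (th : nat -> 'rV[R]_n) (rad K r : R) :
  (forall i, 0 < al i) -> (\sum_(0 <= n <oo) (al n)%:E = +oo)%E -> 0 < r -> 0 <= K ->
  (forall i, `|th i| <= rad) -> (forall i, `|th i.+1 - th i| <= K * al i) ->
  (forall l (e : R), 0 < e -> exists n0, forall m k, (n0 <= m)%N ->
     tame [set t | `|t| <= rad] 1 e
       (fun t => \sum_(m <= i < k) (al i * gamma al i `^ r) * xi l i t)) ->
  forall e : R, 0 < e -> \forall m \near \oo, forall k, (m <= k)%N ->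
  gamma al k - gamma al m <= 1 ->
  enorm (\sum_(m <= i < k) al i *: \row_l xi l i (th i)) <= e * gamma al m `^ (- r).
Proof.
move=> al0 al_sum r0 K0 thr dth unif e e0.
have n1 : 0 < n%:R + 1 :> R by rewrite ltr_wpDl.
have K1 : 0 < 1 + K by rewrite ltr_wpDr.
pose e' := e / (n%:R + 1) / (1 + K).
have e'0 : 0 < e' by rewrite !divr_gt0.
have unif' : \forall m \near \oo, forall l : 'I_n, forall k,
    tame [set t | `|t| <= rad] 1 e'
       (fun t => \sum_(m <= i < k) (al i * gamma al i `^ r) * xi l i t).
  apply: filter_forall => l; have [n0 hn0] := unif l e' e'0.
  by exists n0 => // m /= nm k; exact: hn0.
have [N _ hN] : \forall m \near \oo, 1 <= gamma al m by exact: gamma_oo.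
have [N' _ hN'] := unif'.
exists (maxn N N') => // m; rewrite /= geq_max => /andP[Nm N'm] k mk gk.
have g0 i : (m <= i)%N -> 0 < gamma al i.
  by move=> mi; apply: (lt_le_trans ltr01); apply: hN => /=; exact: leq_trans mi.
have coord l : `|\sum_(m <= i < k) al i * xi l i (th i)| <= e' * (1 + K) * gamma al m `^ (- r).
  have -> : \sum_(m <= i < k) al i * xi l i (th i) = \sum_(m <= i < k)
      gamma al i `^ (- r) * (al i * gamma al i `^ r * xi l i (th i)).
    apply: eq_big_nat => i /andP[mi _]; rewrite powRN.
    have gi := powR_gt0 r (g0 i mi); field; by rewrite gt_eqF.
  apply: (@abel_nonincr R (fun i => al i * gamma al i `^ r * xi l i (th i))
     (fun i => gamma al i `^ (- r)) (e' * (1 + K)) m) => //.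
  - move=> i mi; apply: powR_decr; [exact: g0|exact: gamma_nd|exact: ltW].
  - by move=> i _; exact: powR_ge0.
  move=> j /andP[mj jk].
  apply: le_trans (@moving_sum_le R n [set t | `|t| <= rad] e' K
    (fun i t => al i * gamma al i `^ r * xi l i t) th al m j mj (ltW e'0) K0
    (fun i => ltW (al0 i)) thr (fun i _ => dth i) _) _.
    move=> p /andP[mp _]; apply: hN'; exact: leq_trans mp.
  rewrite ler_wpM2l ?(ltW e'0)// lerD2l -[leRHS]mulr1 ler_wpM2l//.
  by rewrite -gamma_sub//; apply: le_trans gk; rewrite lerD2r; exact: gamma_nd.
apply: le_trans (enorm_le_sum _) _.
apply: le_trans (_ : \sum_(l < n) e' * (1 + K) * gamma al m `^ (- r) <= _).
  apply: ler_sum => l _; apply: le_trans (coord l).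
  by rewrite summxE; under eq_bigr do rewrite !mxE.
rewrite sumr_const card_ord -[leLHS]mulr_natl mulrA ler_wpM2r ?powR_ge0//.
rewrite /e' divfK ?gt_eqF// mulrA ler_pdivrMr// mulrC ler_wpM2l ?(ltW e0)//.
by rewrite lerDl.
Qed.

Definition clamp (R : realType) (L s : R) : R := Num.max (- L) (Num.min L s).

Lemma clamp_bound (R : realType) (L s : R) : 0 <= L -> `|clamp L s| <= L.
Proof.
move=> L0; rewrite ler_norml /clamp le_max lexx/= ge_max ge_min lexx/= andbT.
by rewrite (le_trans _ L0)// oppr_le0.
Qed.

Lemma clamp_id (R : realType) (L s : R) : `|s| <= L -> clamp L s = s.
Proof. by rewrite ler_norml => /andP[h1 h2]; rewrite /clamp min_r// max_r. Qed.

Lemma measurable_clamp d (T : measurableType d) (R : realType) (L : R) (f : T -> R) :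
  measurable_fun setT f -> measurable_fun setT (fun z => clamp L (f z)).
Proof.
move=> mf; apply: measurable_maxr; first exact: measurable_cst.
by apply: measurable_minr => //; exact: measurable_cst.
Qed.

Theorem theorem4p2
  (R : realType) (N1 N2 dx : nat) (N1_gt0 : (0 < N1)%N) (N2_gt0 : (0 < N2)%N)
  (phi1 phi2 : R -> R)
  (dphi1 : forall s : R, derivable phi1 s 1)
  (dphi2 : forall s : R, derivable phi2 s 1)
  (psi : 'I_N2 -> borelRV R dx -> R)
  (mpsi : forall k : 'I_N2, measurable_fun [set: borelRV R dx] (psi k))
  (pi : probability (borelRV R dx * R)%type R)
  (alpha : nat -> R) (alpha_gt0 : forall n : nat, 0 < alpha n)
  (d : measure_display) (Omega : measurableType d) (P : probability Omega R)
  (theta : nat -> Omega -> borelRV R (dtheta N1 N2))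
  (x : nat -> Omega -> borelRV R dx) (y : nat -> Omega -> R)
  (mtheta0 : measurable_fun [set: Omega] (theta 0%N))
  (mx : forall n : nat, measurable_fun [set: Omega] (x n))
  (my : forall n : nat, measurable_fun [set: Omega] (y n))
  (algorithm : forall (n : nat) (w : Omega),
     theta n.+1 w =
     theta n w + (alpha n * (y n w - net_G phi1 phi2 psi (theta n w) (x n w)))
                   *: net_H phi1 phi2 psi (theta n w) (x n w) :> 'rV[R]_(dtheta N1 N2))
  (delta mu M : set 'rV[R]_(dtheta N1 N2) -> R -> R)
  (nu N : set 'rV[R]_(dtheta N1 N2) -> R)
  (loj_value : lojasiewicz_value (risk phi1 phi2 psi pi) delta mu M)
  (loj_dist : lojasiewicz_dist (risk phi1 phi2 psi pi) nu N)
  (rho : Omega -> R) (rho_gt0 : forall w : Omega, 0 < rho w)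
  (alpha_cvg0 : alpha n @[n --> \oo] --> 0)
  (alpha_inv : (limn_esup (fun n : nat =>
                  `|(alpha n.+1)^-1 - (alpha n)^-1|%:E) < +oo)%E)
  (alpha_sum : (\sum_(0 <= n <oo) (alpha n)%:E = +oo)%E)
  (r : R) (r_gt0 : 0 < r)
  (alpha_gamma_sum :
     (\sum_(0 <= n <oo) (alpha n ^+ 2 * gamma alpha n `^ (2 * r))%:E < +oo)%E)
  (phi1_analytic : forall s : R, analytic_at phi1 s)
  (phi2_analytic : forall s : R, analytic_at phi2 s)
  (phi_continuations : analytic_continuations phi1 phi2)
  (xy_iid : iid_with_law P pi (fun (n : nat) (w : Omega) => (x n w, y n w)))
  (xy_bounded : exists2 L : R, 1 <= L &
     {ae P, forall w, (forall k : 'I_N2, `|psi k (x 0%N w)| <= L) /\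
                      `|y 0%N w| <= L}) :
  let f := risk phi1 phi2 psi pi in
  let traj := fun w : Omega => (fun n : nat => theta n w) in
  let grad_sq := fun (w : Omega) (n : nat) =>
    (enorm (grad f (theta n w)) ^+ 2)%:E in
  let dist_C := fun (w : Omega) (n : nat) =>
    dist_to (@rdist R) (f (theta n w)) (crit_values f) in
  let dist_S := fun (w : Omega) (n : nat) =>
    dist_to (@eudist R (dtheta N1 N2)) (theta n w) (crit f) in
  let Lambda := [set w : Omega | stable (traj w)] in
  let rhat := fun w : Omega => r_hat f mu (rho w) (traj w) in
  let p := Num.min 1 r in
  let phat := fun w : Omega => p_hat f mu r (rho w) (traj w) in
  let qhat := fun w : Omega => q_hat f mu nu r (rho w) (traj w) in
  let rate := fun (s : R) (n : nat) => gamma alpha n `^ (- s) in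
  [/\ {ae P, forall w, Lambda w ->
         little_o (grad_sq w) (rate p) /\ little_o (dist_C w) (rate p)},
      {ae P, forall w, Lambda w -> (r%:E < rhat w)%E ->
         [/\ little_o (grad_sq w) (rate (phat w)),
             little_o (dist_C w) (rate (phat w)) &
             little_o (dist_S w) (rate (qhat w))]} &
      {ae P, forall w, Lambda w -> (rhat w <= r%:E)%E ->
         [/\ big_O (grad_sq w) (rate (phat w)),
             big_O (dist_C w) (rate (phat w)) &
             big_O (dist_S w) (rate (qhat w))]}].
Proof.
move=> f traj grad_sq dist_C dist_S Lambda rhat p phat qhat rate.
have [L L1 bounded0] := xy_bounded.
have L0 : 0 <= L by apply: le_trans L1.
pose T := (borelRV R dx * R)%type.
pose Z n w : T := (x n w, y n w).
have mZ n : measurable_fun setT (Z n) by apply/measurable_fun_pairP; split; [exact: mx|exact: my].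
have [indZ lawZ] := xy_iid.
(* bounds valid for every sample are needed to apply the estimates above; truncation at
   [L] provides them and almost surely changes none of the samples *)
pose psi' k (z : T) := clamp L (psi k z.1).
pose y' (z : T) := clamp L z.2.
have mpsi1 k : measurable_fun setT (fun z : T => psi k z.1) by exact: (measurableT_comp (mpsi k)).
have my1 : measurable_fun setT (fun z : T => z.2) by exact: measurable_snd.
have mpsi' k : measurable_fun setT (psi' k) by exact: measurable_clamp.
have my' : measurable_fun setT y' by exact: measurable_clamp.
have psiL k z : `|psi' k z| <= L by exact: clamp_bound.
have yL z : `|y' z| <= L by exact: clamp_bound.
pose Good : set T := [set z | (forall k, psi' k z = psi k z.1) /\ y' z = z.2].
have mGood : measurable Good.
  have -> : Good = (\bigcap_(k in [set: 'I_N2]) (fun z => psi' k z - psi k z.1) @^-1` [set 0])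
      `&` (fun z => y' z - z.2) @^-1` [set 0].
    apply/seteqP; split=> z /=.
      by move=> [h1 h2]; split=> [k _ /=|]; [rewrite h1 subrr|rewrite h2 subrr].
    move=> [h1 h2]; split=> [k|]; apply/eqP; rewrite -subr_eq0; apply/eqP => //.
    exact: (h1 k).
  apply: measurableI.
    apply: fin_bigcap_measurable => // k _.
    rewrite -[X in measurable X]setTI; apply: measurable_funB => //.
  rewrite -[X in measurable X]setTI; apply: measurable_funB => //.
have piGood : pi (~` Good) = 0%E.
  rewrite -(lawZ 0%N _ (measurableC mGood)).
  have [B [mB PB0 hB]] := bounded0.
  apply/eqP; rewrite eq_le measure_ge0 andbT -PB0; apply: le_measure; rewrite ?inE//.
    rewrite -[X in measurable X]setTI; apply: mZ => //; exact: measurableC.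
  move=> w /= nG; apply: hB => /= -[h1 h2]; apply: nG; split=> [k|]; exact: clamp_id.
have aeGood : {ae P, forall w, forall n, Good (Z n w)}.
  apply/ae_foralln => n; exists (Z n @^-1` ~` Good); split.
  - by rewrite -[X in measurable X]setTI; apply: mZ => //; exact: measurableC.
  - exact: etrans (lawZ n _ (measurableC mGood)) piGood.
  - by move=> w /= h hG; apply: h.
have netE z : Good z -> forall t : 'rV[R]_(dtheta N1 N2), net_G phi1 phi2 psi t z.1 = net phi1 phi2 psi' t z.
  move=> [psiE _] t; rewrite /net_G /net /net_in; congr phi1.
  by apply: eq_bigr => i _; congr (_ * phi2 _); apply: eq_bigr => j _; rewrite psiE.
have ana_meas (phi : R -> R) : (forall s, analytic_at phi s) -> measurable_fun setT phi.
  move=> a; apply: continuous_measurable_fun => s.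
  by apply: differentiable_continuous; apply/derivable1_diffP; exact: (analytic_derive (a s)).1.
have mphi1 := ana_meas _ phi1_analytic; have mphi2 := ana_meas _ phi2_analytic.
have fE : f = mean_risk phi1 phi2 psi' y' pi.
  apply/funext => t; rewrite /f /risk /mean_risk /half_sq.
  have mnet (q : 'I_N2 -> T -> R) : (forall k, measurable_fun setT (q k)) ->
      measurable_fun setT (net phi1 phi2 q t).
    move=> mq; apply: (measurableT_comp mphi1); apply: measurable_sum => i.
    apply: measurable_funM; first exact: measurable_cst.
    apply: (measurableT_comp mphi2); apply: measurable_sum => j.
    by apply: measurable_funM; first exact: measurable_cst.
  have germh : germ P pi Z t (half_sq phi1 phi2 psi' y').
    exact: (germ_half_sq phi1_analytic phi2_analytic _ _ _ mpsi' my' psiL yL).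
  have [mh [K hK] _] := germh.
  have ih := bounded_integrable pi mh hK.
  have i2 : pi.-integrable setT (EFin \o (fun z => (y' z - net phi1 phi2 psi' t z) ^+ 2)).
    have := integrableZl measurableT 2 ih; apply: eq_integrable => // z _ /=.
    by rewrite -EFinM /half_sq mulrA mulfV// mul1r.
  rewrite RintegralZl//; congr (_ * fine _).
  apply: ae_eq_integral => //.
  - apply/measurable_EFinP; apply: measurable_funX; apply: measurable_funB => //.
    exact: (mnet (fun k z => psi k z.1)).
  - by apply/measurable_EFinP; apply: measurable_funX; apply: measurable_funB => //; exact: mnet.
  - exists (~` Good); split=> //; first exact: measurableC.
    move=> z /= h hG; apply: h => _; have [_ yE] := hG.
    by rewrite netE// yE.
have sf : smooth_on_balls f (grad f).
  rewrite fE => rad.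
  have [C C1 [h1 h2]] := mean_risk_smooth N1 phi1_analytic phi2_analytic mZ xy_iid mpsi' my' psiL yL rad.
  have gE t := grad_mean_risk phi1_analytic phi2_analytic mZ xy_iid mpsi' my' psiL yL t.
  by exists C => //; split=> t t' ? ?; rewrite !gE; [exact: h1|exact: h2].
pose F (l : 'I_(dtheta N1 N2)) := gradient_sample phi1 phi2 psi' y' l.
have gF l t0 : germ P pi Z t0 (F l).
  exact: (germ_gradient_sample phi1_analytic phi2_analytic _ _ _ mpsi' my' psiL yL).
have gradE t : grad f t = - \row_l \int[pi]_z F l t z.
  by rewrite fE (grad_mean_risk phi1_analytic phi2_analytic mZ xy_iid mpsi' my' psiL yL).
pose c i := alpha i * gamma alpha i `^ r.
have gam0 i : 0 <= gamma alpha i by apply: sumr_ge0 => j _; exact: ltW.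
have sc : (\sum_(0 <= i <oo) (c i ^+ 2)%:E < +oo)%E.
  apply: le_lt_trans alpha_gamma_sum; rewrite le_eqVlt; apply/orP; left; apply/eqP.
  apply: eq_eseriesr => i _; congr _%:E; rewrite /c exprMn; congr (_ * _).
  by rewrite -powR_mulrn ?powR_ge0// -powRrM mulrC.
(* integer radii keep the exceptional set a countable union *)
have aeUnif : {ae P, forall w, forall (rad : nat) l, forall e : R, 0 < e -> exists n0,
    forall m k, (n0 <= m)%N -> tame [set t | `|t| <= rad%:R] 1 e
      (fun t => \sum_(m <= i < k) c i * noise pi Z (F l) w i t)}.
  apply/ae_foralln => rad.
  have h (l : 'I_(dtheta N1 N2)) := uniform_noise mZ xy_iid (@compact_normball R (dtheta N1 N2) rad%:R)
    (fun t0 _ => gF l t0) sc.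
  by apply: filter_forall => l; exact: h.
have main : {ae P, forall w, Lambda w ->
  [/\ little_o (grad_sq w) (rate p) /\ little_o (dist_C w) (rate p),
      (r%:E < rhat w)%E -> [/\ little_o (grad_sq w) (rate (phat w)),
             little_o (dist_C w) (rate (phat w)) &
             little_o (dist_S w) (rate (qhat w))] &
      (rhat w <= r%:E)%E -> [/\ big_O (grad_sq w) (rate (phat w)),
             big_O (dist_C w) (rate (phat w)) &
             big_O (dist_S w) (rate (qhat w))]]}.
  apply: filterS2 aeGood aeUnif => w good unif st.
  pose th k : 'rV[R]_(dtheta N1 N2) := theta k w.
  have [rad thr] : exists rad : nat, forall k, `|th k| <= rad%:R.
    have sup_ge k : ((enorm (th k))%:E <= ereal_sup (range (fun k => (enorm (th k))%:E)))%E.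
      by apply: ereal_sup_ubound; exists k.
    have fin : ereal_sup (range (fun k => (enorm (th k))%:E)) \is a fin_num.
      by rewrite fin_numElt (lt_le_trans (ltNyr (enorm (th 0%N))) (sup_ge 0%N))/=.
    set s := ereal_sup _ in sup_ge fin.
    have s0 : 0 <= fine s.
      by rewrite fine_ge0//; apply: le_trans (sup_ge 0%N); rewrite lee_fin enorm_ge0.
    exists (Num.bound (fine s)) => k; apply: le_trans (norm_le_enorm _) _.
    apply: le_trans (ltW (archi_boundP s0)).
    by rewrite -lee_fin fineK.
  have FK : exists2 K, 0 <= K & forall l t z, `|t| <= rad%:R -> `|F l t z| <= K.
    have [K1 K11 lip] := gradient_sample_lip N1 phi1_analytic phi2_analytic mZ xy_iid mpsi' my' psiL yL rad%:R.
    have /choice[K2 hK2] : forall l, exists K, forall z, `|F l 0 z| <= K.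
      by move=> l; have [_ [K hK] _] := gF l 0; exists K.
    have K20 l : 0 <= K2 l by apply: le_trans (normr_ge0 _) (hK2 l point).
    have K10 : 0 <= K1 by apply: le_trans K11.
    exists (K1 * rad%:R + \sum_l K2 l).
      by rewrite addr_ge0 ?mulr_ge0//; apply: sumr_ge0.
    move=> l t z tr; rewrite -(subrK (F l 0 z) (F l t z)).
    apply: le_trans (ler_normD _ _) _; apply: lerD.
      have := lip l t 0 z tr; rewrite normr0 ler0n => /(_ isT) /le_trans; apply.
      by rewrite subr0 ler_wpM2l.
    apply: le_trans (hK2 l z) _; rewrite (bigD1 l)//= lerDl.
    exact: sumr_ge0.
  have [K K0 hK] := FK.
  have move_ k : th k.+1 = th k + alpha k *: \row_l F l (th k) (Z k w).
    rewrite /th algorithm; congr (_ + _); rewrite -scalerA; congr (_ *: _).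
    have gz := good k; have [_ yE] := gz.
    have -> : net_H phi1 phi2 psi (theta k w) (x k w) =
        grad (fun s => net phi1 phi2 psi' s (Z k w)) (th k).
      by rewrite /net_H; congr (grad _ _); apply/funext => s; exact: (netE (Z k w) gz s).
    rewrite gradE_net//; apply/rowP => l; rewrite !mxE /F /gradient_sample.
    by rewrite -(netE _ gz) yE.
  pose e k : 'rV[R]_(dtheta N1 N2) := \row_l noise pi Z (F l) w k (th k).
  have algo k : th k.+1 = th k - alpha k *: grad f (th k) + alpha k *: e k.
    rewrite move_ gradE scalerN opprK -addrA -scalerDr; congr (_ + _ *: _).
    by apply/rowP => l; rewrite !mxE /noise addrC subrK.
  have dth k : `|th k.+1 - th k| <= K * alpha k.
    rewrite move_ [X in X - _]addrC addrK normrZ gtr0_norm// mulrC ler_wpM2r ?(ltW (alpha_gt0 k))//.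
    by apply: norm_le_coord => // l; rewrite mxE; apply: hK.
  have nz := noise_of_uniform (xi := fun l k t => noise pi Z (F l) w k t) alpha_gt0 alpha_sum
    r_gt0 K0 thr dth (unif rad).
  exact: (rates_of_trajectory sf alpha_gt0 alpha_cvg0 alpha_sum algo loj_value loj_dist r_gt0
    (rho_gt0 w) thr st nz).
split.
- by apply: filterS main => w h /h[].
- by apply: filterS main => w h /h[].
- by apply: filterS main => w h /h[].
Qed.
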